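(* Assume the conditions Parameter Space, Convexity, Differentiability and Integrability, Margin, Local Loss, Approximate Sparsity, Identifiability, Integrability, Higher-Order Smoothness, Density and Convergence Rates listed in the context, and suppose that $\sqrt n\,a_n^2\to0$, $a_n\big(n^{1/r}B_n+\sqrt{\ln(pn)}\big)\to0$, and $B_n^2\ln(pn)=o\big(n^{1-4/(r\wedge\widetilde r)}\big)$. If $J\ge2$, suppose also that $$(1+\sqrt n\,B_na_n)\big(\overline\Delta_n^{1/2}+(B_na_n/\overline\Delta_n)^{r/2}\big)\to0.$$ Then the debiased estimator $\widehat\beta$ defined in the context satisfies $$\frac{\sqrt n(\widehat\beta-\beta_0)}{\sigma_0}\overset{D}{\to}\mathrm N(0,1),\qquad\text{where}\qquad \sigma_0^2:=\frac{\mathrm E\big[(m_1'(X^\top\theta_0,Y)(D-W^\top\mu_0))^2\big]}{\big(\mathrm E[m_{11}''(X^\top\theta_0,Y)(D-W^\top\mu_0)D]\big)^2}.$$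
   Context: **Setting.** For each sample size $n\ge3$ there are a dimension $p=p_n\ge2$ and a distribution $P=P_n$ of a pair $(X,Y)$, $X=(X_1,\dots,X_p)^\top\in\mathcal X\subseteq\mathbb R^p$, $Y\in\mathcal Y$; everything may depend on $n$ (triangular array). $(X_1,Y_1),\dots,(X_n,Y_n)$ are i.i.d. from $P$. $m:\mathbb R\times\mathcal Y\to\mathbb R$ is a known loss; $m_1',m_{11}'',m_{111}'''$ are its partial derivatives in the first argument. $\Theta\subseteq\mathbb R^p$ and $\theta_0=\operatorname{argmin}_{\theta\in\Theta}\mathrm E[m(X^\top\theta,Y)]$. $\mathbb E_n$ is the sample average over $i=1,\dots,n$. ''Constant'' means non-random and not depending on $n$; conditions hold for every $n$ with the same constants. $V_n\lesssim_{\mathrm P}b_n$ means $V_n/b_n$ is bounded in probability. Limits are as $n\to\infty$. Write $X=(D,W^\top)^\top$ with $D=X_1$ scalar and $W\in\mathbb R^{p-1}$, and $\theta_0=(\beta_0,\gamma_0^\top)^\top$ with $\beta_0\in\mathbb R$. $\mu_0\in\mathbb R^{p-1}$ is the solution of $\mathrm E[m_{11}''(X^\top\theta_0,Y)(D-W^\top\mu_0)W]=\mathbf 0_{p-1}$ (it exists and is unique under the conditions below). **Debiased estimator.** Given (possibly data-dependent) penalty levels $\lambda_1,\lambda_2\in(0,\infty)$: Step 1: $\widetilde\theta=(\widetilde\beta,\widetilde\gamma^\top)^\top\in\operatorname{argmin}_{\theta\in\Theta}\{\mathbb E_n[m(X_i^\top\theta,Y_i)]+\lambda_1\|\theta\|_1\}$;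 optionally, with $\widetilde T_1$ the support of this vector, replace $\widetilde\theta$ by an element of $\operatorname{argmin}\{\mathbb E_n[m(X_i^\top\theta,Y_i)]:\theta\in\Theta,\operatorname{supp}(\theta)\subseteq\widetilde T_1\}$. Step 2: $\widetilde\mu\in\operatorname{argmin}_{\mu\in\mathbb R^{p-1}}\{\mathbb E_n[m_{11}''(X_i^\top\widetilde\theta,Y_i)(D_i-W_i^\top\mu)^2]+\lambda_2\|\mu\|_1\}$; optionally, with $\widetilde T_2$ the support of this vector, replace $\widetilde\mu$ by an element of the argmin of $\mathbb E_n[m_{11}''(X_i^\top\widetilde\theta,Y_i)(D_i-W_i^\top\mu)^2]$ over $\mu\in\mathbb R^{p-1}$ with $\operatorname{supp}(\mu)\subseteq\widetilde T_2$. Step 3: $$\widehat\beta:=\widetilde\beta-\frac{\mathbb E_n[m_1'(X_i^\top\widetilde\theta,Y_i)(D_i-W_i^\top\widetilde\mu)]}{\mathbb E_n[m_{11}''(X_i^\top\widetilde\theta,Y_i)(D_i-W_i^\top\widetilde\mu)D_i]}$$ ($\widehat\beta$ may be set arbitrarily when the denominator vanishes). Convention: $m_{11}''(t,y):=0$ wherever this second derivative does not exist. Minimizers are assumed to exist. **Conditions.** - *Parameter Space*: $\Theta$ is a non-empty convex subset of $\mathbb R^p$ and $\theta_0$ is interior to it. - *Convexity*: $m(\cdot,y)$ is convex for all $y\in\mathcal Y$. - *Differentiability and Integrability*: for every $\theta\in\Theta$, $m_1'(X^\top\theta,Y)$ exists almost surely and $\mathrm E[|m(X^\top\theta,Y)|]<\infty$.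 - *Margin*: with $\mathcal E(\theta):=\mathrm E[m(X^\top\theta,Y)-m(X^\top\theta_0,Y)]$, there are constants $c_M\in(0,1]$, $c_M'\in(0,\infty]$ such that $\mathcal E(\theta)\ge c_M\|\theta-\theta_0\|_2^2$ for all $\theta\in\Theta$ with $\|\theta-\theta_0\|_2\le c_M'$. - *Local Loss*: there are constants $c_L\in(0,\infty]$, $C_L\in[1,\infty)$, $r\in(4,\infty)$, a non-random sequence $B_n\in[1,\infty)$ and a function $L:\mathcal X\times\mathcal Y\to[1,\infty)$ such that (1) for all $(x,y)\in\mathcal X\times\mathcal Y$ and $t_1,t_2\in\mathbb R$ with $|t_1|\vee|t_2|\le c_L$, $|m(x^\top\theta_0+t_1,y)-m(x^\top\theta_0+t_2,y)|\le L(x,y)|t_1-t_2|$, with $\max_{1\le j\le p}\mathrm E[|L(X,Y)X_j|^2]\le C_L^2$ and $\mathrm E[|L(X,Y)\|X\|_\infty|^r]\le B_n^r$; (2) for all $\theta\in\Theta$ with $\|\theta-\theta_0\|_2\le c_L$, $\mathrm E[|m(X^\top\theta,Y)-m(X^\top\theta_0,Y)|^2]\le C_L^2\|\theta-\theta_0\|_2^2$; (3) for all such $\theta$, $\mathrm E[|m_1'(X^\top\theta,Y)-m_1'(X^\top\theta_0,Y)|^2]\le C_L^2\|\theta-\theta_0\|_2$. - *Approximate Sparsity*: there are a constant $q\in[0,1]$ and a non-random sequence $s_q=s_{q,n}\in[1,\infty)$ with $\sum_{j=1}^p|\theta_{0,j}|^q\le s_q$ (for $q=0$ the sum is the number of non-zero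 $\theta_{0,j}$). - *Identifiability*: there is a constant $c_I\in(0,\infty)$ with $\mathrm E[|m_1'(X^\top\theta_0,Y)(D-W^\top\mu_0)|^2]\ge c_I$. - *Integrability*: there are constants $C_M\in(0,\infty)$, $\widetilde r\in(4,\infty)$ with $\max_{1\le j\le p}(\mathrm E[|X_j|^{\widetilde r}])^{1/\widetilde r}\le C_M$, $(\mathrm E[|D-W^\top\mu_0|^{\widetilde r}])^{1/\widetilde r}\le C_M$ and $(\mathrm E[|m_1'(X^\top\theta_0,Y)|^{\widetilde r}])^{1/\widetilde r}\le C_M$. - *Higher-Order Smoothness*: there are constants $C_m\in(0,\infty)$, $J\in\mathbb N$ and, for each $y\in\mathcal Y$, points $-\infty=t_{y,0}<t_{y,1}\le\dots\le t_{y,J-1}<t_{y,J}=\infty$ such that for all $y\in\mathcal Y$, $m(\cdot,y)$ is continuously differentiable on $\mathbb R$ and three times differentiable on each $(t_{y,j-1},t_{y,j})$, $j\in[J]$, with $|m_{11}''(t,y)|\le C_m$ and $|m_{111}'''(t,y)|\le C_m$ there; in addition, $m_{11}''(X^\top\theta_0,Y)$ exists almost surely. - *Density*: if $J\ge2$, there are a constant $C_f\in(0,\infty)$ and a non-random sequence $\overline\Delta_n\in(0,\infty)$ with $\mathrm P(X^\top\theta_0-\overline\Delta_n\le t_{Y,j}\le X^\top\theta_0+\overline\Delta_n)\le C_f\overline\Delta_n$ for all $j\in[J-1]$. - *Convergence Rates*: there is a non-random sequence $a_n\in(0,\infty)$ with $a_n\to0$ and $\|\widetilde\theta-\theta_0\|_1+\|\widetilde\mu-\mu_0\|_1\lesssim_{\mathrm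 P}a_n$. *)

(* Defs.v *)
From HB Require Import structures.
From mathcomp Require Export all_boot all_order all_algebra.
From mathcomp Require Export all_classical all_reals all_analysis.
From mathcomp Require Export measurable_realfun.

Set Implicit Arguments.
Unset Strict Implicit.
Unset Printing Implicit Defensive.

Export Order.TTheory GRing.Theory Num.Theory.
Export numFieldNormedType.Exports.

Local Open Scope classical_set_scope.
Local Open Scope ring_scope.

(* The regressor dimension is p = k.+1 with k >= 1.  A regressor vector is a
   tuple, because tuples carry the product sigma-algebra; a parameter is a row
   vector, because row vectors carry the linear and topological structure. *)

Section vectors.
Context {R : realType}.

Definition norm1 {n} (v : 'rV[R]_n) : R := \sum_(j < n) `|v 0 j|.

Definition norm2 {n} (v : 'rV[R]_n) : R :=
  Num.sqrt (\sum_(j < n) v 0 j ^+ 2).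

Definition supp {n} (v : 'rV[R]_n) : {set 'I_n} := [set j | v 0 j != 0]%SET.

(* Stated by cases on q since the library has 0 `^ 0 = 1. *)
Definition sparsity (q : R) {n} (v : 'rV[R]_n) : R :=
  if q == 0 then #|supp v|%:R else \sum_(j < n) `|v 0 j| `^ q.

Definition norm_inf {p} (x : p.-tuple R) : R :=
  \big[Num.max/0]_(j < p) `|tnth x j|.

Definition dotp {p} (x : p.-tuple R) (theta : 'rV[R]_p) : R :=
  \sum_(j < p) tnth x j * theta 0 j.

(* X = (D, W) with D scalar; the residual is D - W^T mu. *)
Definition regD {k} (x : k.+1.-tuple R) : R := tnth x ord0.
Definition regW {k} (x : k.+1.-tuple R) (j : 'I_k) : R := tnth x (lift ord0 j).

Definition resid {k} (x : k.+1.-tuple R) (mu : 'rV[R]_k) : R :=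
  regD x - \sum_(j < k) regW x j * mu 0 j.

End vectors.

Definition argmin {T : Type} {disp : Order.disp_t} {V : porderType disp}
    (A : set T) (f : T -> V) : set T :=
  [set x | A x /\ forall y, A y -> (f x <= f y)%O].

(* m_1' is meaningful where [derivable (m^~ y) t 1] holds. *)
Section loss_derivatives.
Context {R : realType} {Y : Type}.
Implicit Types (m : R -> Y -> R).

Definition m1 m (t : R) (y : Y) : R := derive1 (fun s => m s y : R^o) t.

Definition has_m11 m (t : R) (y : Y) : Prop :=
  derivable (fun s => m1 m s y : R^o) t 1.

Definition m11 m (t : R) (y : Y) : R :=
  if `[< has_m11 m t y >] then derive1 (fun s => m1 m s y : R^o) t else 0.

Definition has_m111 m (t : R) (y : Y) : Prop :=
  derivable (fun s => m11 m s y : R^o) t 1.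

Definition m111 m (t : R) (y : Y) : R := derive1 (fun s => m11 m s y : R^o) t.

End loss_derivatives.

Section conditions.
Context {R : realType} {k : nat} {d : measure_display} {Y : measurableType d}.
Local Notation X := (k.+1.-tuple R).
Variables (P : probability (X * Y)%type R) (m : R -> Y -> R).
Variables (calX : set X) (Theta : set 'rV[R]_k.+1).
Variables (theta0 : 'rV[R]_k.+1) (mu0 : 'rV[R]_k).

(* Joint measurability of the loss is what makes the expectations below
   meaningful. *)
Definition setting : Prop :=
  [/\ {ae P, forall z, calX z.1},
      measurable_fun [set: R * Y] (fun u => m u.1 u.2) &
      argmin Theta (fun theta => 'E_P[fun z => (m (dotp z.1 theta) z.2)%R]%E)
             theta0].

Definition is_mu0 : Prop := forall j : 'I_k,
  ('E_P[fun z => (m11 m (dotp z.1 theta0) z.2 * resid z.1 mu0 * regW z.1 j)%R]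
    = 0)%E.

Definition parameter_space : Prop :=
  [/\ Theta !=set0, convex_set Theta & interior Theta theta0].

Definition convexity : Prop :=
  forall y, convex_function [set: R^o] (fun t => m t y).

Definition differentiability_integrability : Prop :=
  forall theta, Theta theta ->
    {ae P, forall z, derivable (fun s => m s z.2 : R^o) (dotp z.1 theta) 1} /\
    ('E_P[fun z => (`|m (dotp z.1 theta) z.2|)%R] < +oo)%E.

Definition excess_risk (theta : 'rV[R]_k.+1) : \bar R :=
  'E_P[fun z => (m (dotp z.1 theta) z.2 - m (dotp z.1 theta0) z.2)%R]%E.

Definition margin (cM : R) (cM' : \bar R) : Prop :=
  forall theta, Theta theta ->
    ((norm2 (theta - theta0))%:E <= cM')%E ->
    ((cM * norm2 (theta - theta0) ^+ 2)%:E <= excess_risk theta)%E.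

Definition local_loss (cL : \bar R) (CL r B : R) (L : X * Y -> R) : Prop :=
  [/\ measurable_fun setT L,
      forall x y, calX x -> 1 <= L (x, y),
      [/\ forall x y t1 t2, calX x -> ((Num.max `|t1| `|t2|)%:E <= cL)%E ->
            `|m (dotp x theta0 + t1) y - m (dotp x theta0 + t2) y|
              <= L (x, y) * `|t1 - t2|,
          forall j : 'I_k.+1,
            ('E_P[fun z => (`|L z * tnth z.1 j| ^+ 2)%R] <= (CL ^+ 2)%:E)%E &
          ('E_P[fun z => (`|L z * norm_inf z.1| `^ r)%R] <= (B `^ r)%:E)%E],
      forall theta, Theta theta -> ((norm2 (theta - theta0))%:E <= cL)%E ->
        ('E_P[fun z =>
           (`|m (dotp z.1 theta) z.2 - m (dotp z.1 theta0) z.2| ^+ 2)%R]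
          <= (CL ^+ 2 * norm2 (theta - theta0) ^+ 2)%:E)%E &
      forall theta, Theta theta -> ((norm2 (theta - theta0))%:E <= cL)%E ->
        ('E_P[fun z =>
           (`|m1 m (dotp z.1 theta) z.2 - m1 m (dotp z.1 theta0) z.2| ^+ 2)%R]
          <= (CL ^+ 2 * norm2 (theta - theta0))%:E)%E].

Definition identifiability (cI : R) : Prop :=
  (cI%:E <= 'E_P[fun z =>
     (`|m1 m (dotp z.1 theta0) z.2 * resid z.1 mu0| ^+ 2)%R])%E.

Definition integrability (CM r' : R) : Prop :=
  [/\ forall j : 'I_k.+1,
        ('N[P]_(r'%:E)[(fun z => (tnth z.1 j)%:E)] <= CM%:E)%E,
      ('N[P]_(r'%:E)[(fun z => (resid z.1 mu0)%:E)] <= CM%:E)%E &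
      ('N[P]_(r'%:E)[(fun z => (m1 m (dotp z.1 theta0) z.2)%:E)] <= CM%:E)%E].

Definition knots (J : nat) (t : nat -> \bar R) : Prop :=
  [/\ t 0%N = -oo%E, t J = +oo%E, (t 0%N < t 1%N)%E, (t J.-1 < t J)%E &
      forall j, (0 < j)%N -> (j.+1 < J)%N -> (t j <= t j.+1)%E].

Definition higher_order_smoothness (Cm : R) (J : nat)
    (t : Y -> nat -> \bar R) : Prop :=
  [/\ forall y, knots J (t y),
      forall y, (forall s, derivable (fun u => m u y : R^o) s 1) /\
                continuous (fun s => m1 m s y : R^o),
      forall y j s, (j < J)%N -> (t y j < s%:E)%E -> (s%:E < t y j.+1)%E ->
        [/\ has_m11 m s y, has_m111 m s y,
            `|m11 m s y| <= Cm & `|m111 m s y| <= Cm] &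
      {ae P, forall z, has_m11 m (dotp z.1 theta0) z.2}].

Definition density (Cf Delta : R) (J : nat) (t : Y -> nat -> \bar R) : Prop :=
  forall j, (0 < j < J)%N ->
    measurable_fun [set: Y] (t ^~ j) /\
    (P [set z | ((dotp z.1 theta0 - Delta)%:E <= t z.2 j)%E /\
                (t z.2 j <= (dotp z.1 theta0 + Delta)%:E)%E]
      <= (Cf * Delta)%:E)%E.

Definition sigma0_sq : R :=
  fine 'E_P[fun z => ((m1 m (dotp z.1 theta0) z.2 * resid z.1 mu0) ^+ 2)%R]%E /
  fine 'E_P[fun z =>
         (m11 m (dotp z.1 theta0) z.2 * resid z.1 mu0 * regD z.1)%R]%E ^+ 2.

End conditions.

Section estimator.
Context {R : realType} {k n : nat} {Y : Type}.
Variables (S : 'I_n -> k.+1.-tuple R * Y) (m : R -> Y -> R).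

Definition sample_avg (f : k.+1.-tuple R * Y -> R) : R :=
  n%:R^-1 * \sum_(i < n) f (S i).

Definition emp_loss (theta : 'rV[R]_k.+1) : R :=
  sample_avg (fun z => m (dotp z.1 theta) z.2).

(* In steps 1 and 2 the second disjunct is the optional refit on the support of
   the penalized solution. *)
Definition step1 (Theta : set 'rV[R]_k.+1) (lam : R) (theta : 'rV[R]_k.+1) :=
  exists2 th, argmin Theta (fun u => emp_loss u + lam * norm1 u) th &
    theta = th \/
    argmin [set u | Theta u /\ supp u \subset supp th] emp_loss theta.

Definition emp_wls (theta : 'rV[R]_k.+1) (mu : 'rV[R]_k) : R :=
  sample_avg (fun z => m11 m (dotp z.1 theta) z.2 * resid z.1 mu ^+ 2).

Definition step2 (theta : 'rV[R]_k.+1) (lam : R) (mu : 'rV[R]_k) :=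
  exists2 v, argmin setT (fun u => emp_wls theta u + lam * norm1 u) v &
    mu = v \/ argmin [set u | supp u \subset supp v] (emp_wls theta) mu.

(* Nothing is required of the estimate when the denominator vanishes. *)
Definition step3 (theta : 'rV[R]_k.+1) (mu : 'rV[R]_k) (beta : R) :=
  let num := sample_avg (fun z => m1 m (dotp z.1 theta) z.2 * resid z.1 mu) in
  let den := sample_avg (fun z =>
    m11 m (dotp z.1 theta) z.2 * resid z.1 mu * regD z.1) in
  den != 0 -> beta = theta 0 ord0 - num / den.

End estimator.

(* Taking A i = setT outside a subset of indices gives the product rule for
   every subfamily. *)
Definition iid_from {R : realType} {dO dT : measure_display}
    {Omega : measurableType dO} {T : measurableType dT}
    (Q : probability Omega R) (P : probability T R) {n : nat}
    (Z : 'I_n -> {RV Q >-> T}) : Prop :=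
  (forall i A, measurable A -> distribution Q (Z i) A = P A) /\
  (forall A : 'I_n -> set T, (forall i, measurable (A i)) ->
    Q (\bigcap_(i in [set: 'I_n]) Z i @^-1` A i)
      = (\prod_(i < n) Q (Z i @^-1` A i))%E).

Section stochastic_order.
Context {R : realType} {dO : nat -> measure_display}
  {Omega : forall n, measurableType (dO n)}.
Variable Q : forall n, probability (Omega n) R.

Definition bounded_in_prob (V : forall n, Omega n -> R) : Prop :=
  forall eps : R, 0 < eps -> exists K : R,
    \forall n \near \oo, (Q n [set w | (K < `|V n w|)%R] <= eps%:E)%E.

Definition cvg_in_distribution (V : forall n, Omega n -> R)
    (nu : set R -> \bar R) : Prop :=
  forall x : R, {for x, continuous (fun u : R => nu `]-oo, u]%classic)} ->
    Q n [set w | V n w <= x] @[n --> \oo] --> nu `]-oo, x]%classic.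

End stochastic_order.

(* Main.v *)
(** Write e = m_1'(X^T theta0, Y), v = D - W^T mu0 and g = m_11''(X^T theta0, Y).
    When numerator and denominator of step 3 are expanded around (theta0, mu0),
    the terms linear in the estimation errors are averages of e X_j and g v W_j.
    These have mean zero, by the first-order condition for theta0 and by the
    choice of mu0, hence are of order sqrt (ln (pn) / n) uniformly in j, and they
    get multiplied by l1-errors of order a_n. The quadratic terms are of order
    a_n^2. The Taylor expansion fails only for observations with a knot between
    X^T theta0 and X^T theta~, whose contribution is controlled through their
    small probability by Cauchy-Schwarz. The denominator tends to E[g v D], which
    is at least 2 c_M by the margin condition in the direction (1, - mu0).
    Therefore the studentized estimator differs from the normalized sum of
    - e v / sd by o_P(1), and the central limit theorem for triangular arrays,
    obtained by Stein's method, applies. *)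

From HB Require Import structures.
Require Import Defs.
From mathcomp Require Import ring lra zify.

Set Implicit Arguments.
Unset Strict Implicit.
Unset Printing Implicit Defensive.

Local Open Scope classical_set_scope.
Local Open Scope ring_scope.

(** * Independence *)

(** The estimates depend on the whole sample, so terms containing them are not averages of
    independent variables. Every bound is therefore made uniform: off one bad event, chosen before
    [theta] and [mu], the expansion holds for all parameters in an l1-ball of radius [K * a n].
    Duality between the l1-norm and the maximum over coordinates leaves p averages of each kind, and
    a union bound over Chernoff bounds suffices; no empirical process over a function class appears.
    The envelopes of the centered products have [rho / 2] moments, [rho] being the smaller of r and
    r'. They are truncated at the order of the inverse noise level, and the condition on
    [B n ^+ 2 * ln] makes the truncated mass negligible. The knot set is enlarged to cover every
    displacement allowed by the ball; the root of its probability is, up to a constant, the second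
    factor in the rate assumption for [J >= 2]. Constants are fixed in the order eps, [K], [A], n,
    with [K] from boundedness in probability and [A] so large that the Markov bounds add up to at
    most eps. In the central limit theorem the constant precedes the laws, because the array is
    triangular. *)

Definition leave_one_out {R : realType} {Omega T : Type} {n : nat}
    (Z : 'I_n -> Omega -> T) (i : 'I_n) (g : 'I_n -> T -> R) (w : Omega) : R :=
  \sum_(j < n | j != i) g j (Z j w).

Section independence.
Context {R : realType} {dO dT : measure_display}.
Context {Omega : measurableType dO} {T : measurableType dT}.
Variables (Q : probability Omega R) (P : probability T R) (n : nat).
Variable Z : 'I_n -> {RV Q >-> T}.
Hypothesis iidZ : iid_from P Z.

Lemma iid_law i A : measurable A -> Q (Z i @^-1` A) = P A.
Proof. by move=> mA; rewrite -(iidZ.1 i A mA). Qed.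

(** A pi-system generating the information in all observations but the i-th. Leaving coordinate [i]
    free lets a constraint on [Z i] be added and the product rule be applied again. *)
Let cylinders (i : 'I_n) : set (set Omega) :=
  [set C | exists2 A : 'I_n -> set T,
    (forall j, measurable (A j)) /\ A i = setT &
    C = \bigcap_(j in [set: 'I_n]) Z j @^-1` A j].

Let cylinder_measurable i C : cylinders i C -> measurable C.
Proof.
move=> [A [mA _]] ->; apply: fin_bigcap_measurable; first exact: finite_finset.
by move=> j _; rewrite -[X in measurable X]setTI; exact: measurable_funPT.
Qed.

(** For fixed [A], both sides are finite measures in [C]: the restriction of [Q] to the preimage of
    [A], and [Q] scaled by [P A]. They agree on the pi-system, hence on the sigma-algebra it
    generates. *)
Let cylinder_indep i A C : measurable A -> <<s cylinders i >> C ->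
  Q (Z i @^-1` A `&` C) = (P A * Q C)%E.
Proof.
move=> mA sC.
have mZA : measurable (Z i @^-1` A).
  by rewrite -[X in measurable X]setTI; exact: measurable_funPT.
have PA0 : 0 <= fine (P A) by exact: fine_ge0.
pose m1 : {measure set Omega -> \bar R} := mrestr Q mZA.
pose m2 : {measure set Omega -> \bar R} := mscale (NngNum PA0) Q.
suff : m1 C = m2 C.
  by rewrite /m1 /m2 /= /mrestr /mscale/= setIC fineK ?fin_num_measure.
apply: (g_sigma_algebra_measure_unique (cylinders i) _ (fun=> setT)) => //.
- exact: cylinder_measurable.
- move=> _; exists (fun=> setT) => //.
  by apply/esym; rewrite -subTset => w _ j _.
- by rewrite -subTset => w _; exists 0%N.
- move=> _ _ [A1 [mA1 A1i] ->] [A2 [mA2 A2i] ->].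
  exists (fun j => A1 j `&` A2 j); last by rewrite -bigcapI.
  by split=> [j|]; [exact: measurableI|rewrite A1i A2i setTI].
- move=> _ [B [mB Bi] ->].
  rewrite /m1 /m2 /= /mrestr /mscale/= fineK ?fin_num_measure//.
  pose B' j := if j == i then A else B j.
  have mB' j : measurable (B' j) by rewrite /B'; case: ifP.
  have -> : (\bigcap_(j in [set: 'I_n]) Z j @^-1` B j) `&` Z i @^-1` A =
            \bigcap_(j in [set: 'I_n]) Z j @^-1` B' j.
    apply/seteqP; split=> w.
      move=> [Bw Aw] j _; rewrite /B'; case: eqP => [->//|_]; exact: Bw.
    move=> Bw; split=> [j _|].
      by have := Bw j I; rewrite /B'; case: eqP => [->|//]; rewrite Bi.
    by have := Bw i I; rewrite /B' eqxx.
  rewrite (iidZ.2 _ mB') (iidZ.2 _ mB) (bigD1 i)//= [in RHS](bigD1 i)//=.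
  rewrite Bi preimage_setT probability_setT mul1e {1}/B' eqxx iid_law//.
  by congr (_ * _)%E; apply: eq_bigr => j /negbTE ji; rewrite /B' ji.
- move=> k; rewrite /m1 /= /mrestr setTI.
  by rewrite (le_lt_trans (probability_le1 _ _))// ltry.
Qed.

Let measurable_leave_one_out_cylinder i (g : 'I_n -> T -> R) :
  (forall j, measurable_fun setT (g j)) ->
  measurable_fun [set: g_sigma_algebraType (cylinders i)]
    (leave_one_out Z i g : g_sigma_algebraType (cylinders i) -> R).
Proof.
move=> mg; rewrite /leave_one_out.
under eq_fun do rewrite big_mkcond/=.
apply: measurable_sum => j.
case: (eqVneq j i) => [_|ji]; first exact: measurable_cst.
move=> _ B mB; rewrite setTI; apply: sub_sigma_algebra.
exists (fun k => if k == j then g j @^-1` B else setT).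
  split=> [k|]; last by rewrite eq_sym (negbTE ji).
  by case: ifP => // _; rewrite -[X in measurable X]setTI; exact: mg.
apply/seteqP; split=> w.
  by move=> Bw k _; case: eqP => [->|].
by move=> /(_ j I); rewrite eqxx.
Qed.

Lemma measurable_leave_one_out i (g : 'I_n -> T -> R) : (forall j, measurable_fun setT (g j)) ->
  measurable_fun [set: Omega] (leave_one_out Z i g).
Proof.
move=> mg; rewrite /leave_one_out.
under eq_fun do rewrite big_mkcond/=.
apply: measurable_sum => j; case: (j != i); last exact: measurable_cst.
exact: measurableT_comp.
Qed.

Lemma iid_leave_one_out i (g : 'I_n -> T -> R) A (B : set R) : (forall j, measurable_fun setT (g j)) ->
  measurable A -> measurable B ->
  Q (Z i @^-1` A `&` leave_one_out Z i g @^-1` B) =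
  (P A * Q (leave_one_out Z i g @^-1` B))%E.
Proof.
move=> mg mA mB; apply: cylinder_indep => //.
have := @measurable_leave_one_out_cylinder i g mg.
by move=> /(_ measurableT B mB); rewrite setTI.
Qed.

Section product_expectation.
Variables (i : 'I_n) (g : 'I_n -> T -> R) (u : T -> R) (F : R -> R).
Hypothesis mg : forall j, measurable_fun setT (g j).
Hypothesis iu : P.-integrable setT (EFin \o u).
Hypothesis mF : measurable_fun setT F.
Hypothesis iF : Q.-integrable setT (EFin \o (F \o leave_one_out Z i g)).

Let mV : measurable_fun [set: Omega] (leave_one_out Z i g).
Proof. exact: measurable_leave_one_out. Qed.
Let V : {mfun Omega >-> R} :=
  MeasurableFun.Pack (MeasurableFun.Class (isMeasurableFun.Build _ _ _ _ _ mV)).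
Let nu := distribution Q V.

Let mpair : measurable_fun [set: Omega] (fun w => (Z i w, V w)).
Proof. by apply: measurable_fun_pair => //; exact: measurable_funPT. Qed.
Let W : {mfun Omega >-> (T * R)%type} := MeasurableFun.Pack
  (MeasurableFun.Class (isMeasurableFun.Build _ _ _ _ _ mpair)).

(** Product measures are determined by rectangles, where this is [iid_leave_one_out]. Fubini's
    theorem for the product then factors the expectations below. *)
Let joint_law (X : set (T * R)) : measurable X ->
  (P \x nu)%E X = distribution Q W X.
Proof. by apply: product_measure_unique => A B mA mB; exact: iid_leave_one_out. Qed.

Let h (x : T * R) : \bar R := (u x.1 * F x.2)%:E.

Let mh : measurable_fun setT h.
Proof.
apply/measurable_EFinP; apply: measurable_funM.
  by apply: measurableT_comp => //; apply/measurable_EFinP; case/integrableP: iu.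
exact: measurableT_comp.
Qed.

Let iFnu : nu.-integrable setT (EFin \o F).
Proof.
apply: (integrable_pushforward mV); last exact: measurableT.
  exact/measurable_EFinP.
by rewrite preimage_setT.
Qed.

Let mun : measurable_fun setT (EFin \o u). Proof. by case/integrableP: iu. Qed.

Let ih : (P \x nu)%E.-integrable setT h.
Proof.
apply/(integrable12ltyP _ _ mh).
rewrite [ltLHS](_ : _ =
    (\int[P]_x (`|(u x)%:E| * \int[nu]_y `|(F y)%:E|))%E).
  rewrite ge0_integralZr//; last 2 first.
    exact: measurableT_comp.
    by apply: integral_ge0 => x _; exact: abse_ge0.
  case/integrableP: iu => _; case/integrableP: iFnu => _ /= h1 h2.
  by apply: lte_mul_pinfty => //; [exact: integral_ge0|rewrite ge0_fin_numE//; exact: integral_ge0].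
apply: eq_integral => x _; rewrite -ge0_integralZl//.
- by apply: eq_integral => y _; rewrite /h/= normrM EFinM.
- by apply: measurableT_comp => //; exact/measurable_EFinP.
Qed.

Let ihW : Q.-integrable setT (h \o W).
Proof.
have : (distribution Q W).-integrable setT h.
  apply/integrableP; split=> //; case/integrableP: ih => _.
  by rewrite (eq_measure_integral (distribution Q W))// => A mA _; exact: joint_law.
move=> /integrableP[_ hoo]; apply/integrableP; split; first exact: measurableT_comp.
move: hoo; rewrite ge0_integral_distribution//.
exact: measurableT_comp.
Qed.

Lemma integrable_indepM :
  Q.-integrable setT (fun w => (u (Z i w) * F (leave_one_out Z i g w))%:E).
Proof. exact: ihW. Qed.

Lemma Rintegral_indepM :
  \int[Q]_w (u (Z i w) * F (leave_one_out Z i g w)) =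
  \int[P]_x u x * \int[Q]_w F (leave_one_out Z i g w).
Proof.
have E1 : (\int[Q]_w (h \o W) w = \int[P \x nu]_z h z)%E.
  rewrite -integral_distribution//; apply: eq_measure_integral => A mA _.
  by apply/esym; exact: joint_law.
rewrite /Rintegral [X in fine X]E1 -(integral12_prod_meas1 ih)/= /fubini_F.
under eq_integral => x _.
  rewrite /h/=; under eq_integral do rewrite EFinM.
  rewrite integralZl//; over.
have -> : (\int[nu]_y (F y)%:E = \int[Q]_w (F (leave_one_out Z i g w))%:E)%E.
  by rewrite integral_distribution//; exact/measurable_EFinP.
set c := (\int[Q]_w (F _)%:E)%E.
have cfin : c \is a fin_num by exact: integrable_fin_num.
rewrite -(fineK cfin) integralZr//= fineM//.
exact: integrable_fin_num.
Qed.

End product_expectation.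

End independence.

(** * Expectation bounds *)

Section measurable_comparison.
Context {R : realType} {d : measure_display} {T : measurableType d}.
Implicit Types f g : T -> R.

Lemma measurable_setlt f g : measurable_fun setT f -> measurable_fun setT g ->
  measurable [set x | f x < g x].
Proof.
move=> mf mg; have := measurable_fun_ltr mf mg => /(_ measurableT [set true] I).
by rewrite setTI.
Qed.

Lemma measurable_setle f g : measurable_fun setT f -> measurable_fun setT g ->
  measurable [set x | f x <= g x].
Proof.
move=> mf mg; have := measurable_fun_ler mf mg => /(_ measurableT [set true] I).
by rewrite setTI.
Qed.

End measurable_comparison.

Section expectation_bounds.
Context {R : realType} {d : measure_display} {T : measurableType d}.
Variable P : probability T R.
Implicit Types (f g : T -> R) (a b c : R).

(** The bound is stated in the extended reals, so it can be established before integrability, which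
    it implies. Most moments below travel in this form, together with their measurability. *)
Definition mean_le f c :=
  measurable_fun setT f /\ (\int[P]_x (`|f x|)%:E <= c%:E)%E.

Lemma mean_le_integrable f c : mean_le f c -> P.-integrable setT (EFin \o f).
Proof.
move=> [mf fc]; apply/integrableP; split; first exact/measurable_EFinP.
by apply: le_lt_trans fc _; rewrite ltry.
Qed.

Lemma mean_le_Rintegral f c : mean_le f c -> `|\int[P]_x f x| <= c.
Proof.
move=> fc; apply: le_trans (le_normr_Rintegral _ (mean_le_integrable fc)) _ => //.
rewrite -lee_fin fineK; first exact: fc.2.
apply: integrable_fin_num => //.
exact: integrable_norm (mean_le_integrable fc).
Qed.

Lemma Rintegral_mean_le f : P.-integrable setT (EFin \o f) ->
  mean_le f (\int[P]_x `|f x|).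
Proof.
move=> fi; split; first by case/integrableP: fi => /measurable_EFinP.
by rewrite fineK//; apply: integrable_fin_num => //; exact: integrable_norm.
Qed.

Lemma mean_le_ge0 f c : mean_le f c -> 0 <= c.
Proof.
by move=> [_ fc]; rewrite -lee_fin (le_trans _ fc)//; exact: integral_ge0.
Qed.

Lemma le_mean_le f g c : measurable_fun setT g -> (forall x, `|g x| <= `|f x|) ->
  mean_le f c -> mean_le g c.
Proof.
move=> mg gf [mf fc]; split=> //; apply: le_trans fc.
apply: ge0_le_integral => //.
- by apply/measurable_EFinP; exact: measurableT_comp.
- by apply/measurable_EFinP; exact: measurableT_comp.
- by move=> x _; rewrite lee_fin.
Qed.

Lemma mean_leW f c c' : c <= c' -> mean_le f c -> mean_le f c'.
Proof. by move=> cc' [mf fc]; split=> //; rewrite (le_trans fc)// lee_fin. Qed.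

Lemma mean_le_cst c : mean_le (cst c) `|c|.
Proof. by split=> //=; rewrite integral_cst//= probability_setT mule1. Qed.

Lemma mean_leZ f c a : mean_le f c -> mean_le (fun x => a * f x) (`|a| * c).
Proof.
move=> [mf fc]; split; first exact: measurable_funM.
under eq_integral do rewrite normrM EFinM.
rewrite ge0_integralZl_EFin//; last first.
  by apply/measurable_EFinP; exact: measurableT_comp.
by rewrite EFinM lee_pmul// integral_ge0.
Qed.

Lemma mean_leD f g a b : mean_le f a -> mean_le g b ->
  mean_le (fun x => f x + g x) (a + b).
Proof.
move=> [mf fc] [mg gc]; split; first exact: measurable_funD.
apply: (@le_trans _ _ (\int[P]_x ((`|f x|)%:E + (`|g x|)%:E))%E).
  apply: ge0_le_integral => //.
  - by apply/measurable_EFinP/measurableT_comp => //; exact: measurable_funD.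
  - by apply: emeasurable_funD; apply/measurable_EFinP; exact: measurableT_comp.
  - by move=> x _; rewrite -EFinD lee_fin ler_normD.
rewrite ge0_integralD//; last 2 first.
- by apply/measurable_EFinP; exact: measurableT_comp.
- by apply/measurable_EFinP; exact: measurableT_comp.
by rewrite EFinD leeD.
Qed.

Lemma mean_le_norm f c : mean_le f c -> mean_le (fun x => `|f x|) c.
Proof.
move=> fc; apply: le_mean_le (fc) => [|x]; rewrite ?normr_id//.
by apply: measurableT_comp => //; exact: fc.1.
Qed.

Lemma le_mean_Rintegral f g : P.-integrable setT (EFin \o f) ->
  P.-integrable setT (EFin \o g) -> (forall x, f x <= g x) ->
  \int[P]_x f x <= \int[P]_x g x.
Proof. by move=> fi gi fg; apply: le_Rintegral. Qed.

Lemma mean_Rintegral_cst c : \int[P]_x c = c.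
Proof.
by rewrite /Rintegral integral_cst//= probability_setT mule1.
Qed.

(** Markov's inequality, with a strict threshold. *)
Lemma mean_le_tail f a c : 0 < a -> mean_le f c ->
  (P [set x | (a < `|f x|)%R] <= (c / a)%:E)%E.
Proof.
move=> a0 [mf fc].
have mnf : measurable_fun setT (Num.norm \o f) by exact: measurableT_comp.
have := @le_integral_abse _ _ _ P setT measurableT (EFin \o f) a.
move=> /(_ (proj2 (measurable_EFinP _ _) mf) a0) h.
rewrite -(@lee_pmul2l _ a%:E)// ?lte_fin// -EFinM mulrCA divff ?gt_eqF// mulr1.
apply: le_trans fc; apply: le_trans h.
rewrite lee_pmul2l// ?lte_fin// setTI.
apply: le_measure; rewrite ?inE//.
- exact: measurable_setlt.
- exact: measurable_setle.
- by move=> x /= /ltW; rewrite lee_fin.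
Qed.

End expectation_bounds.

Section sample_sums.
Context {R : realType} {dO dT : measure_display}.
Context {Omega : measurableType dO} {T : measurableType dT}.
Variables (Q : probability Omega R) (P : probability T R) (n : nat).
Variable Z : 'I_n -> {RV Q >-> T}.
Hypothesis iidZ : iid_from P Z.

Lemma mean_le_sample i f c : mean_le P f c -> mean_le Q (fun w => f (Z i w)) c.
Proof.
move=> [mf fc]; split; first exact: measurableT_comp.
have -> : (\int[Q]_w (`|f (Z i w)|)%:E = \int[P]_x (`|f x|)%:E)%E => //.
rewrite -[LHS](@ge0_integral_distribution _ _ _ _ _ Q (Z i) (EFin \o (Num.norm \o f)))//.
  by apply: eq_measure_integral => A mA _; exact: iidZ.1.
  by apply/measurable_EFinP; exact: measurableT_comp.
by move=> y; rewrite /= lee_fin.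
Qed.

Lemma Rintegral_sample i f : measurable_fun setT f -> P.-integrable setT (EFin \o f) ->
  \int[Q]_w f (Z i w) = \int[P]_x f x.
Proof.
move=> mf fi; rewrite /Rintegral; congr fine.
have := mean_le_integrable (mean_le_sample i (Rintegral_mean_le fi)) => fZi.
rewrite -[LHS](@integral_distribution _ _ _ _ _ Q (Z i) (EFin \o f))//; last exact/measurable_EFinP.
by apply: eq_measure_integral => A mA _; exact: iidZ.1.
Qed.

Lemma mean_le_sum f c : mean_le P f c ->
  mean_le Q (fun w => \sum_(i < n) f (Z i w)) (n%:R * c).
Proof.
move=> fc; rewrite -[n in n%:R]card_ord cardE.
rewrite (_ : (fun w => _) = fun w => \sum_(i <- enum 'I_n) f (Z i w)); last first.
  by apply/funext => w; rewrite big_enum.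
elim: (enum _) => [|i s ih].
  rewrite mul0r; under eq_fun do rewrite big_nil.
  by have := mean_le_cst Q 0; rewrite normr0.
under eq_fun do rewrite big_cons.
rewrite /= -natr1 mulrDl mul1r addrC.
by apply: mean_leD ih; exact: mean_le_sample.
Qed.

(** Induction on the prefix length: the new factor is independent of the previous ones, whose sum is
    a leave-one-out sum with the later summands set to zero. This is why [leave_one_out] takes a
    family of functions. *)
Let mgf_prefix (g : T -> R) M m : measurable_fun setT g ->
  (forall x, `|g x| <= M) -> (m <= n)%N ->
  \int[Q]_w expR (\sum_(i < n | (i < m)%N) g (Z i w)) =
  (\int[P]_x expR (g x)) ^+ m.
Proof.
move=> mg gM; elim: m => [_|m ih mn].
  rewrite expr0; under eq_Rintegral do rewrite big_pred0// expR0.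
  exact: mean_Rintegral_cst.
pose i0 := Ordinal mn; pose h (j : 'I_n) := if (j < m)%N then g else cst 0.
have mh j : measurable_fun setT (h j) by rewrite /h; case: ifP.
have bh j x : `|h j x| <= M.
  by rewrite /h; case: ifP => //= _; rewrite normr0 (le_trans _ (gM x)).
have hE w : leave_one_out Z i0 h w = \sum_(i < n | (i < m)%N) g (Z i w).
  rewrite /leave_one_out [RHS]big_mkcond [LHS]big_mkcond/=; apply: eq_bigr => j _.
  rewrite /h; have [->|ji] := eqVneq j i0; first by rewrite /= ltnn.
  by case: ifP.
have sE w : \sum_(i < n | (i < m.+1)%N) g (Z i w) =
    g (Z i0 w) + leave_one_out Z i0 h w.
  rewrite (bigD1 i0)//= hE; congr (_ + _); apply: eq_bigl => j.
  by rewrite ltnS leq_eqVlt -val_eqE/=; case: ltngtP.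
under eq_Rintegral do rewrite sE expRD.
have mloo : measurable_fun setT (leave_one_out Z i0 h).
  exact: measurable_leave_one_out.
rewrite (@Rintegral_indepM _ _ _ _ _ _ _ _ _ iidZ i0 h (expR \o g) expR)//.
- under [X in _ * X]eq_Rintegral do rewrite hE.
  by rewrite ih ?exprS// ltnW.
- apply: (@mean_le_integrable _ _ _ P _ `|expR M|).
  apply: le_mean_le (mean_le_cst P _) => [|x /=]; first exact: measurableT_comp.
  by rewrite !ger0_norm ?expR_ge0// ler_expR (le_trans (ler_norm _)).
- apply: (@mean_le_integrable _ _ _ Q _ `|expR (n%:R * M)|).
  apply: le_mean_le (mean_le_cst Q _) => [|w /=]; first exact: measurableT_comp.
  rewrite !ger0_norm ?expR_ge0// ler_expR (le_trans (ler_norm _))//.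
  rewrite /leave_one_out (le_trans (ler_norm_sum _ _ _))//.
  rewrite big_mkcond/= mulr_natl -[n in _ *+ n]card_ord -sumr_const.
  apply: ler_sum => j _; case: ifP => // _.
  by rewrite (le_trans _ (bh j (Z j w))).
Qed.

Lemma iid_mgf (g : T -> R) M : measurable_fun setT g -> (forall x, `|g x| <= M) ->
  \int[Q]_w expR (\sum_(i < n) g (Z i w)) = (\int[P]_x expR (g x)) ^+ n.
Proof.
move=> mg gM; rewrite -(mgf_prefix mg gM (leqnn n)); apply: eq_Rintegral => w _.
by congr expR; apply: eq_bigl => i; rewrite ltn_ord.
Qed.

End sample_sums.

(** [expR (- x) >= 1 - x] gives [expR x <= (1 - x)^-1], and the quadratic dominates this as long as
    [x <= 2^-1]. *)
Lemma expR_le_quadratic {R : realType} (x : R) : x <= 2^-1 ->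
  expR x <= 1 + x + 2 * x ^+ 2.
Proof.
move=> x2; have x1 : 0 < 1 - x by lra.
have h : expR x <= (1 - x)^-1.
  rewrite -[expR x]invrK -expRN lef_pV2 ?posrE ?expR_gt0//.
  exact: expR_ge1Dx.
apply: le_trans h _; rewrite -div1r ler_pdivrMr//.
have -> : (1 + x + 2 * x ^+ 2) * (1 - x) = 1 + x ^+ 2 * (1 - 2 * x) by ring.
by rewrite lerDl mulr_ge0 ?sqr_ge0//; lra.
Qed.

(** * Exponential bounds for sums of bounded functions *)

Section chernoff.
Context {R : realType} {dO dT : measure_display}.
Context {Omega : measurableType dO} {T : measurableType dT}.
Variables (Q : probability Omega R) (P : probability T R) (n : nat).
Variable Z : 'I_n -> {RV Q >-> T}.
Hypothesis iidZ : iid_from P Z.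

(** Markov's inequality for the exponential of [lam] times the sum; [lam * M <= 2^-1] makes the
    quadratic bound on [expR] available. The mean bound [b1] is kept because truncated variables are
    no longer centered. *)
Lemma iid_chernoff (g : T -> R) (M lam u b1 b2 : R) : measurable_fun setT g ->
  (forall x, `|g x| <= M) -> 0 < lam -> lam * M <= 2^-1 ->
  \int[P]_x g x <= b1 -> \int[P]_x (g x ^+ 2) <= b2 ->
  (Q [set w | (u < \sum_(i < n) g (Z i w))%R]
    <= (expR (- (lam * u) + n%:R * (lam * b1 + 2 * lam ^+ 2 * b2)))%:E)%E.
Proof.
move=> mg gM lam0 lamM gb1 gb2.
have mlg : measurable_fun setT (fun x => lam * g x) by exact: measurable_funM.
have lgM x : `|lam * g x| <= lam * M.
  by rewrite normrM gtr0_norm// ler_pM2l.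
have mS : measurable_fun setT (fun w => \sum_(i < n) g (Z i w)).
  by apply: measurable_sum => i; exact: measurableT_comp.
have mlS : measurable_fun setT (fun w => \sum_(i < n) lam * g (Z i w)).
  by apply: measurable_sum => i; exact: (measurableT_comp mlg).
pose E w := expR (\sum_(i < n) lam * g (Z i w)).
have EM : mean_le Q E (\int[Q]_w `|E w|).
  apply: Rintegral_mean_le; apply: (@mean_le_integrable _ _ _ Q _ `|expR (n%:R * (lam * M))|).
  apply: le_mean_le (mean_le_cst Q _) => [|w /=]; first exact: measurableT_comp.
  rewrite !ger0_norm ?expR_ge0// ler_expR (le_trans (ler_norm _))//.
  rewrite (le_trans (ler_norm_sum _ _ _))//.
  by rewrite mulr_natl -[n in _ *+ n]card_ord -sumr_const ler_sum.
apply: (@le_trans _ _ (Q [set w | (expR (lam * u) < `|E w|)%R])).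
  apply: le_measure; rewrite ?inE//.
  - exact: measurable_setlt.
  - apply: measurable_setlt => //; apply: measurableT_comp => //.
    exact: measurableT_comp.
  - move=> w /= uS; rewrite ger0_norm ?expR_ge0// ltr_expR.
    by rewrite -mulr_sumr ltr_pM2l.
apply: le_trans (mean_le_tail (expR_gt0 _) EM) _; rewrite lee_fin.
under eq_Rintegral do rewrite ger0_norm ?expR_ge0//.
rewrite (iid_mgf iidZ mlg lgM) expRD mulrC expRN ler_pM2l ?invr_gt0 ?expR_gt0//.
rewrite expRM_natl.
rewrite lerXn2r ?nnegrE ?expR_ge0//; first by apply: Rintegral_ge0 => x _; exact: expR_ge0.
have ig : mean_le P g `|M|.
  by apply: le_mean_le (mean_le_cst P M) => // x /=; rewrite (le_trans (gM x)) ?ler_norm.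
have ig2 : mean_le P (fun x => g x ^+ 2) `|M ^+ 2|.
  apply: le_mean_le (mean_le_cst P _) => [|x /=]; first exact: measurable_funX.
  by rewrite !normrX ler_pXn2r ?nnegrE// (le_trans (gM x)) ?ler_norm.
have i1 := mean_le_integrable (mean_leD (mean_leD (mean_le_cst P 1) (mean_leZ lam ig))
  (mean_leZ (2 * lam ^+ 2) ig2)).
apply: (@le_trans _ _ (\int[P]_x (1 + lam * g x + 2 * lam ^+ 2 * g x ^+ 2))).
  apply: le_mean_Rintegral => //.
    apply: (@mean_le_integrable _ _ _ P _ `|expR (lam * M)|).
    apply: le_mean_le (mean_le_cst P _) => [|x /=]; first exact: measurableT_comp.
    by rewrite !ger0_norm ?expR_ge0// ler_expR (le_trans (ler_norm _)).
  move=> x; rewrite -mulrA -exprMn; apply: expR_le_quadratic.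
  by rewrite (le_trans (ler_norm _))// (le_trans (lgM x)).
rewrite RintegralD//; last 2 first.
- exact: mean_le_integrable (mean_leD (mean_le_cst P 1) (mean_leZ lam ig)).
- exact: mean_le_integrable (mean_leZ (2 * lam ^+ 2) ig2).
rewrite RintegralD//; last 2 first.
- exact: mean_le_integrable (mean_le_cst P 1).
- exact: mean_le_integrable (mean_leZ lam ig).
rewrite mean_Rintegral_cst.
rewrite (RintegralZl _ measurableT (mean_le_integrable ig)).
rewrite (RintegralZl _ measurableT (mean_le_integrable ig2)).
apply: le_trans (expR_ge1Dx _); rewrite -addrA lerD2l lerD//.
  by rewrite ler_pM2l.
by rewrite ler_wpM2l// mulr_ge0// sqr_ge0.
Qed.

End chernoff.

(** * Stein's method for the normal distribution *)

Section mean_value.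
Context {R : realType}.
Implicit Types f df : R -> R.

Lemma is_derive_mvt f df (a b : R) : (forall x : R, is_derive x 1 f (df x)) -> a < b ->
  exists2 c, c \in `]a, b[ & f b - f a = df c * (b - a).
Proof.
move=> fdf ab; apply: (MVT ab (fun x _ => fdf x)).
by apply: derivable_within_continuous => x _; have [] := fdf x.
Qed.

Lemma is_derive_lipschitz f df (k : R) : (forall x : R, is_derive x 1 f (df x)) ->
  (forall x, `|df x| <= k) -> forall x y : R, `|f x - f y| <= k * `|x - y|.
Proof.
move=> fdf dfk x y.
wlog xy : x y / x < y.
  move=> H; have [|yx|->] := ltgtP x y; first exact: H.
    by rewrite distrC [`|x - y|]distrC; exact: H.
  by rewrite !subrr normr0 mulr0.
have [c _ fc] := is_derive_mvt fdf xy.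
by rewrite distrC fc normrM distrC ler_wpM2r.
Qed.

End mean_value.

(** * The standard normal law and Mills' ratio *)

Section gaussian.
Context {R : realType}.
Local Notation mu := (@lebesgue_measure R).
Implicit Types x y u : R.

Definition std_pdf : R -> R := normal_pdf 0 1.

Lemma std_pdfE x : std_pdf x = normal_peak 1 * expR (- (x ^+ 2) / 2).
Proof. by rewrite /std_pdf normal_pdfE ?oner_eq0// /normal_fun subr0 expr1n. Qed.

Lemma std_pdf_gt0 x : 0 < std_pdf x.
Proof. by rewrite std_pdfE mulr_gt0 ?normal_peak_gt0 ?oner_eq0 ?expR_gt0. Qed.

Lemma std_pdfN x : std_pdf (- x) = std_pdf x.
Proof. by rewrite !std_pdfE sqrrN. Qed.

Lemma std_pdf_le_peak x : std_pdf x <= normal_peak 1.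
Proof. by rewrite /std_pdf normal_pdf_ub ?oner_eq0. Qed.

Lemma std_pdf_decr x y : `|x| <= y -> std_pdf y <= std_pdf x.
Proof.
move=> xy; rewrite !std_pdfE ler_pM2l ?normal_peak_gt0 ?oner_eq0// ler_expR.
rewrite !mulNr lerN2 ler_pM2r ?invr_gt0// -[x ^+ 2]real_normK ?num_real//.
by rewrite ler_pXn2r ?nnegrE// (le_trans _ xy).
Qed.

Lemma is_derive_std_pdf x : is_derive x 1 std_pdf (- x * std_pdf x).
Proof.
have -> : std_pdf = fun x => normal_peak 1 * expR (- (x ^+ 2) / 2).
  by apply/funext => u; exact: std_pdfE.
apply: is_derive_eq; rewrite !scaler0 add0r /GRing.scale/= !mulr1.
by field.
Qed.

Lemma integrable_std_pdf : mu.-integrable setT (EFin \o std_pdf).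
Proof. exact: integrable_normal_pdf. Qed.

Lemma Rintegral_std_pdf : \int[mu]_x std_pdf x = 1.
Proof. by rewrite /Rintegral integral_normal_pdf. Qed.

Definition std_cdf x : R := \int[mu]_(u in `]-oo, x]) std_pdf u.

Definition std_primitive (g : R -> R) x : R :=
  \int[mu]_(u in `]-oo, x]) (g u * std_pdf u).

Lemma integrable_std_primitive (g : R -> R) c : continuous g ->
  (forall x, `|g x| <= c) ->
  mu.-integrable setT (EFin \o (fun u => g u * std_pdf u)).
Proof.
move=> cg gc; apply: (@le_integrable _ _ _ mu setT measurableT _
    (EFin \o (fun u => c * std_pdf u))).
- apply/measurable_EFinP/measurable_funM; last exact: measurable_normal_pdf.
  exact: continuous_measurable_fun.
- move=> x _ /=; rewrite lee_fin !normrM ler_wpM2r//.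
  by rewrite (le_trans (gc x))// ler_norm.
- exact: (integrableZl measurableT c integrable_std_pdf).
Qed.

Lemma is_derive_std_primitive (g : R -> R) c x : continuous g ->
  (forall x, `|g x| <= c) -> is_derive x 1 (std_primitive g) (g x * std_pdf x).
Proof.
move=> cg gc.
have xu : x < x + 1 by rewrite ltrDl.
have ig : mu.-integrable [set` Interval -oo%O (BRight (x + 1))]
    (EFin \o (fun u => g u * std_pdf u)).
  apply: (integrableS measurableT) => //.
  exact: integrable_std_primitive cg gc.
have cx : {for x, continuous (fun u => g u * std_pdf u)}.
  apply: continuousM; first exact: cg.
  by apply: continuous_normal_pdf; rewrite oner_eq0.
have [dF F'] := continuous_FTC1 xu ig (ltNyr _) cx.
by apply: DeriveDef; [exact: dF|rewrite -derive1E].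
Qed.

Lemma std_cdfE : std_cdf = std_primitive (cst 1).
Proof.
by apply/funext => x; apply: eq_Rintegral => u _; rewrite mul1r.
Qed.

Lemma is_derive_std_cdf x : is_derive x 1 std_cdf (std_pdf x).
Proof.
rewrite std_cdfE -[std_pdf x]mul1r; apply: (@is_derive_std_primitive _ 1) => //.
  exact: cst_continuous.
by move=> u; rewrite normr1.
Qed.

Lemma EFin_std_cdf x : (std_cdf x)%:E = normal_prob 0 1 `]-oo, x]%classic.
Proof.
rewrite /std_cdf /Rintegral fineK//.
by apply: integrable_fin_num => //; apply: (integrableS measurableT) => //; exact: integrable_std_pdf.
Qed.

Lemma std_cdf_ge0 x : 0 <= std_cdf x.
Proof. by apply: Rintegral_ge0 => u _; exact/ltW/std_pdf_gt0. Qed.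

Lemma std_cdf_le1 x : std_cdf x <= 1.
Proof. by rewrite -lee_fin EFin_std_cdf; exact: probability_le1. Qed.

(** The identity as a random variable under the normal law, so that the limits of [cdf] at infinity
    apply to [std_cdf]. *)
Let idR : measurableTypeR R -> R := idfun.

#[local] HB.instance Definition _ :=
  @isMeasurableFun.Build _ _ _ _ idR (@measurable_id _ _ setT).

Let std_id : {RV (@normal_prob R 0 1) >-> R} := idR.

Let cdf_std_id x : cdf std_id x = (std_cdf x)%:E.
Proof. by rewrite EFin_std_cdf. Qed.

Lemma std_cdf_tail_right e y0 : 0 < e -> exists2 y, y0 <= y & 1 - std_cdf y < e.
Proof.
move=> e0; have /fine_cvgP[_ h] := cvg_cdfy1 std_id.
have /(pinfty_ex_ge (num_real y0))[y y0y /=] : \forall y \near +oo,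
    1 - e < (fine \o cdf std_id) y.
  by apply: (cvgr_gt _ h); rewrite ltrBlDr ltrDl.
rewrite -[1 - e < _]/(1 - e < fine (cdf std_id y)) cdf_std_id/= => hy.
by exists y => //; lra.
Qed.

Lemma std_cdf_tail_left e y0 : 0 < e -> exists2 y, y0 <= y & std_cdf (- y) < e.
Proof.
move=> e0; have /fine_cvgP[_ h] := cvg_cdfNy0 std_id.
have : \forall y \near -oo, (fine \o cdf std_id) y < e by exact: (cvgr_lt _ h).
move=> [M [_ HM]]; pose y := Num.max y0 (- M + 1).
exists y; first by rewrite le_max lexx.
rewrite -[std_cdf _]/(fine (std_cdf (- y))%:E) -cdf_std_id; apply: HM.
have : - M + 1 <= y by rewrite le_max lexx orbT.
lra.
Qed.

(* Both sides have known derivatives and vanish at infinity, so it suffices to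
   compare derivatives. *)
Lemma mills_bounds (T : R -> R) : (forall x : R, is_derive x 1 T (- std_pdf x)) ->
  (forall x, 0 <= T x) ->
  (forall e y0, 0 < e -> exists2 y, y0 <= y & T y < e) ->
  forall x, 0 < x -> x * T x <= std_pdf x /\ x * std_pdf x <= (1 + x ^+ 2) * T x.
Proof.
move=> dT T0 Tlim x x0.
(* A function that is nonincreasing from [x] on and exceeds each [- e] arbitrarily far out cannot be
   negative at [x]: it would stay below [D x], which is below [D x / 2]. *)
have noneg (D dD : R -> R) : (forall y : R, x <= y -> is_derive y 1 D (dD y)) ->
    (forall y : R, x <= y -> dD y <= 0) ->
    (forall e y0, 0 < e -> exists2 y, y0 <= y & - e < D y) -> 0 <= D x.
  move=> dDD dD0 Dlim; rewrite leNgt; apply/negP => Dx0.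
  have e0 : 0 < - D x / 2 by lra.
  have [y xy Dy] := Dlim _ (x + 1) e0.
  have xy' : x < y by lra.
  have dD1 c : c \in `]x, y[ -> is_derive c 1 D (dD c).
    by rewrite in_itv/= => /andP[xc _]; apply: dDD; exact: ltW.
  have cD : {within `[x, y], continuous D}.
    by apply: derivable_within_continuous => c; rewrite in_itv/= => /andP[xc _]; have [] := dDD c xc.
  have [c] := MVT xy' dD1 cD.
  rewrite in_itv/= => /andP[xc _] Dxy.
  have : dD c * (y - x) <= 0 by rewrite mulr_le0_ge0 ?dD0 ?ltW// subr_gt0.
  by rewrite -Dxy; lra.
split.
- suff : 0 <= std_pdf x / x - T x.
    by rewrite subr_ge0 ler_pdivlMr// mulrC.
  apply: (noneg (fun y => std_pdf y / y - T y) (fun y => - std_pdf y / y ^+ 2)).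
  + move=> y xy; have y0 : y != 0 by rewrite gt_eqF// (lt_le_trans x0).
    have dp := is_derive_std_pdf y.
    have dTy := dT y.
    have dV : is_derive y 1 (fun z : R => z^-1) (- y ^- 2 *: 1).
      exact: (@is_deriveV _ id).
    by apply: is_derive_eq; rewrite /GRing.scale/=; field; rewrite y0.
  + by move=> y _; rewrite mulNr oppr_le0 divr_ge0 ?sqr_ge0 ?(ltW (std_pdf_gt0 _)).
  + move=> e y0 e0; have [y y0y Ty] := Tlim e (Num.max x y0) e0.
    move: y0y; rewrite ge_max => /andP[xy y0y].
    exists y => //; have : 0 <= std_pdf y / y.
      by rewrite divr_ge0 ?(ltW (std_pdf_gt0 _)) ?(ltW (lt_le_trans x0 xy)).
    lra.
- have p1 y : 0 < 1 + y ^+ 2 by rewrite ltr_pwDl// sqr_ge0.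
  suff : 0 <= T x - x * std_pdf x / (1 + x ^+ 2).
    by rewrite subr_ge0 ler_pdivrMr// [T x * _]mulrC.
  apply: (noneg (fun y => T y - y * std_pdf y / (1 + y ^+ 2))
     (fun y => - (2 * std_pdf y) / (1 + y ^+ 2) ^+ 2)).
  + move=> y xy; have y0 : 1 + y ^+ 2 != 0 by rewrite gt_eqF.
    have dp := is_derive_std_pdf y.
    have dTy := dT y.
    have d1 : is_derive y 1 (fun z : R => 1 + z ^+ 2) (2 * y).
      by apply: is_derive_eq; rewrite /GRing.scale/=; ring.
    have dV := @is_deriveV _ (fun z : R => 1 + z ^+ 2) _ _ _ y0 d1.
    by apply: is_derive_eq; rewrite /GRing.scale/=; field; rewrite y0.
  + by move=> y _; rewrite mulNr oppr_le0 divr_ge0 ?sqr_ge0 ?mulr_ge0 ?(ltW (std_pdf_gt0 _)).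
  + move=> e y0 e0; pose y := Num.max (Num.max 1 y0) (normal_peak 1 / e + 1).
    have : Num.max 1 y0 <= y by rewrite le_max lexx.
    rewrite ge_max => /andP[y1 y0y].
    have ye : normal_peak 1 / e + 1 <= y by rewrite le_max lexx orbT.
    have ey : normal_peak 1 < e * y.
      rewrite -ltr_pdivrMl// mulrC; lra.
    exists y => //; have : y * std_pdf y / (1 + y ^+ 2) < e; last first.
      by have := T0 y; lra.
    rewrite ltr_pdivrMr//.
    have := std_pdf_le_peak y; have := std_pdf_gt0 y => h1 h2.
    apply: (@le_lt_trans _ _ (y * normal_peak 1)); first by rewrite ler_pM2l//; lra.
    apply: (@lt_trans _ _ (y * (e * y))); first by rewrite ltr_pM2l//; lra.
    by rewrite mulrDr mulr1 expr2 mulrCA ltrDr.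
Qed.

Lemma mills_right x : 0 < x -> x * (1 - std_cdf x) <= std_pdf x /\
  x * std_pdf x <= (1 + x ^+ 2) * (1 - std_cdf x).
Proof.
apply: (@mills_bounds (fun y => 1 - std_cdf y)) => [y|y|e y0]; last first.
- exact: std_cdf_tail_right.
- by rewrite subr_ge0 std_cdf_le1.
- have dc := is_derive_std_cdf y.
  by apply: is_derive_eq; rewrite add0r mul1r.
Qed.

Lemma mills_left x : 0 < x -> x * std_cdf (- x) <= std_pdf x /\
  x * std_pdf x <= (1 + x ^+ 2) * std_cdf (- x).
Proof.
apply: (@mills_bounds (fun y => std_cdf (- y))) => [y|y|].
- have dc := is_derive_std_cdf (- y).
  have dN : is_derive y 1 (fun z : R => - z) (-1) by apply: is_derive_eq.
  have := @is_derive1_comp _ std_cdf (fun z => - z) y _ _ dc dN.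
  by rewrite std_pdfN mulrN1.
- exact: std_cdf_ge0.
- move=> e y0 e0; exact: std_cdf_tail_left.
Qed.

End gaussian.

(** * Bounded solutions of the Stein equation *)

Section stein_equation.
Context {R : realType}.
Local Notation mu := (@lebesgue_measure R).
Local Notation phi := (@std_pdf R).
Local Notation Phi := (@std_cdf R).
Variables (h : R -> R) (K Lh : R).
Hypothesis h01 : forall x, 0 <= h x <= 1.
Hypothesis h_lip : forall x y, `|h x - h y| <= Lh * `|x - y|.
Hypothesis K1 : 1 <= K.
Hypothesis h_left : forall x, x <= - K -> h x = 1.
Hypothesis h_right : forall x, K <= x -> h x = 0.

Let Nh : R := \int[mu]_u (h u * phi u).

Let Lh0 : 0 <= Lh.
Proof.
have := h_lip 1 0; rewrite subr0 normr1 mulr1 => hl.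
by rewrite (le_trans _ hl).
Qed.

Let ch : continuous h.
Proof.
have Lh1 : 0 < Lh + 1 by rewrite ltr_wpDl.
move=> x; apply/cvgrPdist_lt => e e0; near=> y.
apply: (le_lt_trans (h_lip x y)).
apply: (@le_lt_trans _ _ ((Lh + 1) * `|x - y|)); first by rewrite ler_wpM2r// lerDl.
rewrite -ltr_pdivlMl//; near: y.
apply/nbhs_ballP; exists ((Lh + 1)^-1 * e); last by [].
by rewrite /= mulr_gt0// invr_gt0.
Unshelve. all: by end_near. Qed.

Let h_norm x : `|h x| <= 1.
Proof. by have /andP[h0 h1] := h01 x; rewrite ger0_norm. Qed.

Let ihphi : mu.-integrable setT (EFin \o (fun u => h u * phi u)).
Proof. exact: integrable_std_primitive ch h_norm. Qed.

Let Nh01 : 0 <= Nh <= 1.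
Proof.
apply/andP; split.
  apply: Rintegral_ge0 => u _; apply: mulr_ge0; last exact: ltW (std_pdf_gt0 u).
  by have /andP[] := h01 u.
rewrite -Rintegral_std_pdf; apply: le_Rintegral => //.
  exact: integrable_std_pdf.
move=> u _; rewrite ler_piMl ?(ltW (std_pdf_gt0 u))//.
by have /andP[] := h01 u.
Qed.

(** The integral of [(h u - Nh) * phi u] up to [x], the numerator of the Stein solution. Where [h]
    is constant it is a multiple of a normal tail, so Mills' bounds apply. *)
Let F x := std_primitive h x - Nh * Phi x.

Let dF (x : R) : is_derive x 1 F ((h x - Nh) * phi x).
Proof.
have d1 := is_derive_std_primitive x ch h_norm.
have d2 := is_derive_std_cdf x.
apply: is_derive_eq; rewrite /GRing.scale/=; ring.
Qed.

Let F_left x : x <= - K -> F x = (1 - Nh) * Phi x.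
Proof.
move=> xK; rewrite /F mulrBl mul1r; congr (_ - _).
apply: eq_Rintegral => u; rewrite inE/= in_itv/= => ux.
by rewrite h_left ?mul1r// (le_trans ux).
Qed.

Let F_right x : K <= x -> F x = Nh * (1 - Phi x).
Proof.
move=> Kx; rewrite /F mulrBr mulr1; congr (_ - _).
rewrite /Nh [RHS](_ : _ = \int[mu]_(u in `]-oo, x] `|` `]x, +oo[) (h u * phi u)); last first.
  by congr Rintegral; rewrite -itv_bndbnd_setU//=; apply/seteqP; split => u //= _; rewrite in_itv.
rewrite Rintegral_setU//=.
- rewrite [X in _ = _ + X](_ : _ = 0) ?addr0//.
  rewrite (@eq_Rintegral _ _ _ _ _ (cst 0)); last first.
    move=> u; rewrite inE/= in_itv/= andbT => xu.
    by rewrite h_right ?mul0r// ltW// (le_lt_trans Kx).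
  by rewrite /Rintegral integral0.
- by apply: (integrableS measurableT) => //; apply: measurableU.
- apply/disj_setPS => u /= []; rewrite !in_itv/= andbT => ux.
  by rewrite ltNge ux.
Qed.

Let F_le1 x : `|F x| <= 1.
Proof.
have p0 u : 0 <= phi u by exact/ltW/std_pdf_gt0.
have i1 : mu.-integrable `]-oo, x] (EFin \o (fun u => h u * phi u)).
  by apply: (integrableS measurableT).
have i2 : mu.-integrable `]-oo, x] (EFin \o phi).
  by apply: (integrableS measurableT) => //; exact: integrable_std_pdf.
have /andP[N0 N1] := Nh01; have := std_cdf_ge0 x; have := std_cdf_le1 x => c1 c0.
have : 0 <= std_primitive h x <= Phi x.
  apply/andP; split.
    apply: Rintegral_ge0 => u _; apply: mulr_ge0 => //.
    by have /andP[] := h01 u.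
  apply: le_Rintegral => // u _; rewrite ler_piMl//.
  by have /andP[] := h01 u.
move=> /andP[H0 H1]; rewrite /F ler_norml; apply/andP; split.
  suff : Nh * Phi x <= 1 by lra.
  by rewrite mulr_ile1.
have : 0 <= Nh * Phi x by rewrite mulr_ge0.
lra.
Qed.

Definition stein_solution x := F x / phi x.
(** The value that Stein's equation forces on the derivative; [is_derive_stein_solution] confirms
    it. *)
Definition stein_derivative x := h x - Nh + x * stein_solution x.

Lemma is_derive_stein_solution (x : R) :
  is_derive x 1 stein_solution (stein_derivative x).
Proof.
have p0 : phi x != 0 by rewrite gt_eqF// std_pdf_gt0.
have d1 := dF x; have d2 := is_derive_std_pdf x.
have d3 := is_deriveV p0 d2.
apply: is_derive_eq; rewrite /stein_derivative /stein_solution /GRing.scale/=.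
by field; rewrite p0.
Qed.

(* [x * f x] has derivative [f x + x * f' x], whose boundedness in the tails is
   the lower Mills inequality. *)
Let second x := (1 + x ^+ 2) * stein_solution x + x * (h x - Nh).

(** In the tails 1 is enough. On [[- K, K]], [F] is at most 1 in absolute value and
    [phi x >= phi K], which gives [(phi K)^-1] for the solution; the factor [1 + K ^+ 2] and the
    summands [K] and 1 account for the derivative and for [second]. *)
Let bound : R := (1 + K ^+ 2) / phi K + K + 1.

Let bound1 : 1 <= bound.
Proof.
rewrite /bound -[leLHS]add0r lerD// addr_ge0 ?(le_trans _ K1)// divr_ge0//.
  by rewrite addr_ge0// sqr_ge0.
exact/ltW/std_pdf_gt0.
Qed.

(** In each tail the solution, its derivative and [second] take these forms up to sign, with [M] the
    normal mass beyond [y] and [c] equal to [Nh] on the right, [1 - Nh] on the left. The upper Mills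
    bound controls the first two; the third takes both. *)
Let tail_bounds (y c M : R) : 0 <= c <= 1 -> 1 <= y -> 0 <= M ->
  y * M <= phi y -> y * phi y <= (1 + y ^+ 2) * M ->
  [/\ 0 <= c * (M / phi y) <= 1, -1 <= c * (y * (M / phi y) - 1) <= 0 &
      0 <= c * ((1 + y ^+ 2) * (M / phi y) - y) <= 1].
Proof.
move=> /andP[c0 c1] y1 M0 up lo; have p0 := std_pdf_gt0 y.
set q := M / phi y.
have Mq : M = q * phi y by rewrite /q divfK// gt_eqF.
have q0 : 0 <= q by rewrite divr_ge0// ltW.
have y0 : 0 <= y by lra.
have yq1 : y * q <= 1 by move: up; rewrite Mq mulrA -[leRHS]mul1r ler_pM2r.
have lq : y <= (1 + y ^+ 2) * q.
  by move: lo; rewrite Mq mulrA ler_pM2r.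
have q1 : q <= 1 by apply: le_trans yq1; rewrite ler_peMl.
have yq0 : 0 <= y * q by rewrite mulr_ge0.
have w1 : (1 + y ^+ 2) * q - y <= 1.
  have -> : (1 + y ^+ 2) * q - y = q + y * (y * q - 1) by ring.
  have : y * (y * q - 1) <= 0 by rewrite mulr_ge0_le0//; lra.
  lra.
split; apply/andP; split.
- exact: mulr_ge0.
- exact: mulr_ile1.
- rewrite -lerN2 opprK -mulrN mulr_ile1//; lra.
- rewrite mulr_ge0_le0//; lra.
- by rewrite mulr_ge0// subr_ge0.
- by rewrite mulr_ile1// subr_ge0.
Qed.

Let stein_bounds x : [/\ `|stein_solution x| <= bound,
  `|stein_derivative x| <= bound & `|second x| <= bound].
Proof.
have /andP[N0 N1] := Nh01; have K1' : 1 <= K := K1.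
have [xK|Kx] := lerP x (- K).
  have x0 : 0 < - x by lra.
  have [up lo] := mills_left x0; rewrite opprK in up lo.
  have c01 : 0 <= 1 - Nh <= 1 by lra.
  have x1 : 1 <= - x by lra.
  have [b1 b2 b3] := tail_bounds c01 x1 (std_cdf_ge0 x) up lo.
  have B1 := bound1.
  rewrite /second /stein_derivative /stein_solution F_left// h_left//.
  rewrite !std_pdfN in b1 b2 b3.
  split.
  - by rewrite -mulrA ler_norml; lra.
  - have -> : 1 - Nh + x * ((1 - Nh) * Phi x / phi x) =
      - ((1 - Nh) * (- x * (Phi x / phi x) - 1)) by ring.
    rewrite normrN ler_norml; lra.
  - have -> : (1 + x ^+ 2) * ((1 - Nh) * Phi x / phi x) + x * (1 - Nh) =
       (1 - Nh) * ((1 + (- x) ^+ 2) * (Phi x / phi x) - - x) by ring.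
    rewrite ler_norml; lra.
have [Kx'|xK] := lerP K x.
  have x0 : 0 < x by lra.
  have [up lo] := mills_right x0.
  have x1 : 1 <= x by lra.
  have M0 : 0 <= 1 - Phi x by rewrite subr_ge0 std_cdf_le1.
  have [b1 b2 b3] := tail_bounds Nh01 x1 M0 up lo.
  have B1 := bound1.
  rewrite /second /stein_derivative /stein_solution F_right// h_right//.
  split.
  - by rewrite -mulrA ler_norml; lra.
  - have -> : 0 - Nh + x * (Nh * (1 - Phi x) / phi x) =
      Nh * (x * ((1 - Phi x) / phi x) - 1) by ring.
    rewrite ler_norml; lra.
  - have -> : (1 + x ^+ 2) * (Nh * (1 - Phi x) / phi x) + x * (0 - Nh) =
       Nh * ((1 + x ^+ 2) * ((1 - Phi x) / phi x) - x) by ring.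
    rewrite ler_norml; lra.
have xK' : `|x| <= K by rewrite ler_norml !ltW.
have pK := std_pdf_gt0 K.
have fK : `|stein_solution x| <= (phi K)^-1.
  rewrite /stein_solution normrM normfV (gtr0_norm (std_pdf_gt0 x)).
  rewrite -[leRHS]mul1r ler_pM ?invr_ge0 ?(ltW (std_pdf_gt0 x))//.
  by rewrite lef_pV2 ?posrE ?std_pdf_gt0// std_pdf_decr.
have g1 : `|h x - Nh| <= 1.
  have /andP[h0 h1] := h01 x; rewrite ler_norml; lra.
have iK : 0 <= (phi K)^-1 by rewrite invr_ge0 ltW.
have K2 : 0 <= K ^+ 2 / phi K by rewrite mulr_ge0 ?sqr_ge0.
rewrite /bound mulrDl mul1r; split.
- lra.
- rewrite /stein_derivative (le_trans (ler_normD _ _))// normrM.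
  have : `|x| * `|stein_solution x| <= K * (phi K)^-1 by rewrite ler_pM.
  have : K * (phi K)^-1 <= K ^+ 2 / phi K.
    by rewrite ler_wpM2r// expr2 ler_peMl//; lra.
  lra.
- rewrite /second (le_trans (ler_normD _ _))// (normrM (1 + x ^+ 2)) (normrM x).
  have n1 : `|1 + x ^+ 2| <= 1 + K ^+ 2.
    rewrite ger0_norm ?addr_ge0 ?sqr_ge0// lerD2l -[x ^+ 2]real_normK ?num_real//.
    by rewrite ler_pXn2r ?nnegrE// (le_trans _ K1).
  have : `|1 + x ^+ 2| * `|stein_solution x| <= (phi K)^-1 + K ^+ 2 / phi K.
    by rewrite -[X in _ <= X + _]mul1r -mulrDl ler_pM.
  have : `|x| * `|h x - Nh| <= K by rewrite -[leRHS]mulr1 ler_pM.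
  lra.
Qed.

(** The derivative is [h x - Nh + x * stein_solution x], so its Lipschitz constant is that of [h]
    plus [bound], which dominates the derivative [second] of the last summand. *)
Lemma stein_solution_bounded : exists2 C : R, 0 < C &
  [/\ forall x, `|stein_solution x| <= C,
      forall x, `|stein_derivative x| <= C &
      forall x y, `|stein_derivative x - stein_derivative y| <= C * `|x - y|].
Proof.
exists (bound + Lh); first by have := bound1; have := Lh0; lra.
split=> [x|x|x y].
- by have [+ _ _] := stein_bounds x; have := Lh0; lra.
- by have [_ + _] := stein_bounds x; have := Lh0; lra.
have dxf (u : R) : is_derive u 1 (fun v => v * stein_solution v) (second u).
  have d := is_derive_stein_solution u.
  apply: is_derive_eq; rewrite /GRing.scale/= /second /stein_derivative; ring.
have sb u : `|second u| <= bound by have [] := stein_bounds u.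
have := is_derive_lipschitz dxf sb x y; have := h_lip x y.
rewrite /stein_derivative.
have -> : h x - Nh + x * stein_solution x - (h y - Nh + y * stein_solution y) =
  (h x - h y) + (x * stein_solution x - y * stein_solution y) by ring.
move=> h1 h2; apply: le_trans (ler_normD _ _) _.
by rewrite addrC mulrDl lerD.
Qed.

Lemma stein_equation x : stein_derivative x - x * stein_solution x = h x - Nh.
Proof. by rewrite /stein_derivative addrK. Qed.

End stein_equation.

(** * The central limit theorem *)

Lemma lipschitz_continuous {R : realType} (f : R -> R) (k : R) :
  (forall x y, `|f x - f y| <= k * `|x - y|) -> continuous f.
Proof.
move=> fk; have k1 : 0 < `|k| + 1 by rewrite ltr_wpDl.
move=> x; apply/cvgrPdist_lt => e e0; near=> y.
apply: (le_lt_trans (fk x y)).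
apply: (@le_lt_trans _ _ ((`|k| + 1) * `|x - y|)).
  by rewrite ler_wpM2r// (le_trans (ler_norm _))// lerDl.
rewrite -ltr_pdivlMl//; near: y.
apply/nbhs_ballP; exists ((`|k| + 1)^-1 * e); last by [].
by rewrite /= mulr_gt0// invr_gt0.
Unshelve. all: by end_near. Qed.

Section mean_sums.
Context {R : realType} {d : measure_display} {T : measurableType d}.
Variable P : probability T R.

Lemma integrable_addr (f g : T -> R) : P.-integrable setT (EFin \o f) ->
  P.-integrable setT (EFin \o g) ->
  P.-integrable setT (EFin \o (fun x => f x + g x)).
Proof.
move=> fi gi; rewrite (_ : _ \o _ = (EFin \o f) \+ (EFin \o g)).
  exact: integrableD.
by apply/funext => x /=; rewrite EFinD.
Qed.

Lemma integrable_bigsum (I : Type) (s : seq I) (g : I -> T -> R) :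
  (forall i, P.-integrable setT (EFin \o g i)) ->
  P.-integrable setT (EFin \o (fun x => \sum_(i <- s) g i x)).
Proof.
move=> ig; elim: s => [|i s ih].
  rewrite (_ : _ \o _ = cst 0%E); first exact: integrable0.
  by apply/funext => x /=; rewrite big_nil.
under eq_fun do rewrite big_cons.
exact: integrable_addr.
Qed.

Lemma Rintegral_bigsum (I : Type) (s : seq I) (g : I -> T -> R) :
  (forall i, P.-integrable setT (EFin \o g i)) ->
  \int[P]_x (\sum_(i <- s) g i x) = \sum_(i <- s) \int[P]_x g i x.
Proof.
move=> ig; elim: s => [|i s ih].
  by under eq_Rintegral do rewrite big_nil; rewrite big_nil mean_Rintegral_cst.
under eq_Rintegral do rewrite big_cons.
rewrite big_cons -ih RintegralD//; exact: integrable_bigsum.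
Qed.

Lemma mean_leM_bounded (f g : T -> R) c k : mean_le P f c ->
  measurable_fun setT g -> (forall x, `|g x| <= k) ->
  mean_le P (fun x => f x * g x) (`|k| * c).
Proof.
move=> fc mg gk; apply: le_mean_le (mean_leZ k fc) => [|x].
  by apply: measurable_funM => //; exact: fc.1.
by rewrite !normrM mulrC ler_wpM2r// (le_trans (gk x)) ?ler_norm.
Qed.

End mean_sums.

(** * Stein's method by leaving one observation out *)

Section stein_clt.
Context {R : realType} {dO dT : measure_display}.
Context {Omega : measurableType dO} {T : measurableType dT}.
Variables (Q : probability Omega R) (P : probability T R) (n : nat).
Variable Z : 'I_n -> {RV Q >-> T}.
Hypotheses (iidZ : iid_from P Z) (n0 : (0 < n)%N).
Variables (psi : T -> R) (del kap : R).
Hypothesis psi0 : \int[P]_x psi x = 0.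
Hypothesis psi2 : mean_le P (fun x => psi x ^+ 2) 1.
Hypothesis psi2E : \int[P]_x (psi x ^+ 2) = 1.
Hypothesis mpsi : measurable_fun setT psi.
Hypothesis del01 : 0 < del <= 1.
Hypothesis psikap : mean_le P (fun x => `|psi x| `^ (2 + del)) kap.

Let a : R := (Num.sqrt n%:R)^-1.

Let a0 : 0 < a.
Proof. by rewrite invr_gt0 sqrtr_gt0 ltr0n. Qed.

Let na2 : n%:R * a ^+ 2 = 1.
Proof. by rewrite exprVn sqr_sqrtr ?ler0n// divff// pnatr_eq0 -lt0n. Qed.

Let xi x := a * psi x.

Let mxi : measurable_fun setT xi. Proof. exact: measurable_funM. Qed.

Let psi_le1 : mean_le P psi 1.
Proof.
have := mean_leD (mean_leZ 2^-1 psi2) (mean_leZ 2^-1 (mean_le_cst P 1)).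
rewrite normr1 !mulr1 ger0_norm ?invr_ge0// (_ : 2^-1 + 2^-1 = 1); last by field.
apply: le_mean_le => // x; rewrite [leRHS]ger0_norm /=; last first.
  by have := sqr_ge0 (psi x); lra.
rewrite -[psi x ^+ 2]real_normK ?num_real//.
have : 0 <= (`|psi x| - 1) ^+ 2 by exact: sqr_ge0.
nra.
Qed.

Let xi_le : mean_le P xi a.
Proof.
have := mean_leZ a psi_le1; by rewrite (gtr0_norm a0) mulr1.
Qed.

Let xi0 : \int[P]_x xi x = 0.
Proof. by rewrite RintegralZl ?psi0 ?mulr0//; exact: mean_le_integrable psi_le1. Qed.

Let xi2_le : mean_le P (fun x => xi x ^+ 2) (a ^+ 2).
Proof.
under eq_fun do rewrite exprMn; have := mean_leZ (a ^+ 2) psi2.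
by rewrite ger0_norm ?sqr_ge0// mulr1.
Qed.

Let xi2E : \int[P]_x (xi x ^+ 2) = a ^+ 2.
Proof.
under eq_Rintegral do rewrite exprMn.
by rewrite RintegralZl ?psi2E ?mulr1//; exact: mean_le_integrable psi2.
Qed.

Let xikap : mean_le P (fun x => `|xi x| `^ (2 + del)) (a `^ (2 + del) * kap).
Proof.
have := mean_leZ (a `^ (2 + del)) psikap; rewrite ger0_norm ?powR_ge0//.
apply: le_mean_le => [|x].
  apply: (@measurableT_comp _ _ _ _ _ _ (fun x => x `^ (2 + del)) _ (Num.norm \o xi)) => //.
  exact: measurableT_comp.
by rewrite /xi normrM (gtr0_norm a0) powRM// ltW.
Qed.

Definition clt_sum (w : Omega) : R :=
  (Num.sqrt n%:R)^-1 * \sum_(i < n) psi (Z i w).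

Let clt_sumE w : clt_sum w = \sum_(i < n) xi (Z i w).
Proof. by rewrite /clt_sum mulr_sumr. Qed.

Let V (i : 'I_n) (w : Omega) : R := leave_one_out Z i (fun=> xi) w.

Let clt_sum_split i w : clt_sum w = V i w + xi (Z i w).
Proof. by rewrite clt_sumE (bigD1 i)//= addrC. Qed.

Lemma measurable_clt_sum : measurable_fun setT clt_sum.
Proof.
rewrite (_ : clt_sum = fun w => \sum_(i < n) xi (Z i w)); last first.
  by apply/funext => w; exact: clt_sumE.
apply: measurable_sum => i; exact: measurableT_comp.
Qed.

Let mV i : measurable_fun setT (V i).
Proof. exact: measurable_leave_one_out. Qed.

Let V_le i : mean_le Q (V i) (n%:R * a).
Proof.
have h := mean_leD (mean_le_sum iidZ (mean_le_norm xi_le)) (mean_le_cst Q 0).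
rewrite normr0 addr0 in h; apply: le_mean_le h => // w.
rewrite addr0 [leRHS]ger0_norm ?sumr_ge0// /V /leave_one_out.
rewrite (le_trans (ler_norm_sum _ _ _))// big_mkcond/=.
by apply: ler_sum => j _; case: ifP.
Qed.

Lemma clt_sum_second_moment : mean_le Q (fun w => clt_sum w ^+ 2) 1.
Proof.
have id_le i : Q.-integrable setT (EFin \o (idfun \o V i)).
  exact: mean_le_integrable (V_le i).
have ixi := mean_le_integrable xi_le.
have mid : measurable_fun [set: R] (@idfun R) by exact: measurable_id.
pose t i w := xi (Z i w) * V i w + xi (Z i w) ^+ 2.
have ixV i := @integrable_indepM _ _ _ _ _ _ _ _ _ iidZ i (fun=> xi) xi idfun
  (fun=> mxi) ixi mid (id_le i).
have it i : Q.-integrable setT (EFin \o t i).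
  apply: integrable_addr; first exact: ixV.
  exact: mean_le_integrable (mean_le_sample iidZ i xi2_le).
have E i : \int[Q]_w t i w = a ^+ 2.
  rewrite (RintegralD measurableT (ixV i)
    (mean_le_integrable (mean_le_sample iidZ i xi2_le))).
  have -> : \int[Q]_w (xi (Z i w) * V i w) = 0.
    have := @Rintegral_indepM _ _ _ _ _ _ _ _ _ iidZ i (fun=> xi) xi idfun
      (fun=> mxi) ixi mid (id_le i).
    by rewrite xi0 mul0r.
  rewrite add0r.
  rewrite (@Rintegral_sample _ _ _ _ _ _ _ _ _ iidZ i (fun x => xi x ^+ 2)) ?xi2E//.
    exact: xi2_le.1.
  exact: mean_le_integrable xi2_le.
have sE w : clt_sum w ^+ 2 = \sum_(i < n) t i w.
  rewrite expr2 {2}clt_sumE mulr_sumr; apply: eq_bigr => i _.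
  by rewrite (clt_sum_split i) /t; ring.
have iS : Q.-integrable setT (EFin \o (fun w => clt_sum w ^+ 2)).
  rewrite (_ : _ \o _ = EFin \o (fun w => \sum_(i < n) t i w)).
    exact: integrable_bigsum.
  by apply/funext => w /=; rewrite sE.
have := Rintegral_mean_le iS; congr mean_le.
under eq_Rintegral do rewrite ger0_norm ?sqr_ge0// sE.
rewrite Rintegral_bigsum//; under eq_bigr do rewrite E.
by rewrite sumr_const card_ord -mulr_natl na2.
Qed.

Section test_function.
Variables (f df : R -> R) (C : R).
Hypothesis fdf : forall x : R, is_derive x 1 f (df x).
Hypothesis fC : forall x, `|f x| <= C.
Hypothesis dfC : forall x, `|df x| <= C.
Hypothesis df_lip : forall x y, `|df x - df y| <= C * `|x - y|.

Let C0 : 0 <= C. Proof. by rewrite (le_trans _ (fC 0)). Qed.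

Let mf : measurable_fun setT f.
Proof.
apply: continuous_measurable_fun; apply: (@lipschitz_continuous _ _ C).
exact: is_derive_lipschitz fdf dfC.
Qed.

Let mdf : measurable_fun setT df.
Proof.
by apply: continuous_measurable_fun; apply: (@lipschitz_continuous _ _ C).
Qed.

(** For [t] in the unit interval the Lipschitz bound on [df] gives quadratic order, beyond it the
    bound on [df] gives linear order, and the power [1 + del] covers both. This is how a moment of
    order [2 + del] comes to suffice. *)
Let taylor v t : `|f (v + t) - f v - t * df v| <= 2 * C * (`|t| `^ (1 + del)).
Proof.
have [->|t0] := eqVneq t 0.
  by rewrite addr0 subrr mul0r subr0 normr0 mulr_ge0 ?powR_ge0// mulr_ge0.
have [c] : exists2 c, `|c - v| <= `|t| & f (v + t) - f v = t * df c.
  have [t1|t1|/esym/eqP] := ltgtP 0 t; last by rewrite (negbTE t0).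
    have vt : v < v + t by rewrite ltrDl.
    have [c] := is_derive_mvt fdf vt.
    rewrite in_itv/= => /andP[vc cv] ->; exists c; last by ring.
    by rewrite !gtr0_norm ?subr_gt0//; lra.
  have vt : v + t < v by rewrite gtrDl.
  have [c] := is_derive_mvt fdf vt.
  rewrite in_itv/= => /andP[vc cv] E; exists c; last by rewrite -opprB E; ring.
  rewrite ltr0_norm ?subr_lt0// ltr0_norm//; lra.
move=> cv ->; rewrite -mulrBr normrM.
have t0' : 0 < `|t| by rewrite normr_gt0.
rewrite powRD; last by rewrite normr_eq0 t0 implybT.
rewrite powRr1// mulrCA ler_wpM2l//.
have /andP[d0 d1] := del01.
have [t1|t1] := lerP `|t| 1.
  apply: le_trans (df_lip _ _) _.
  apply: (@le_trans _ _ (C * `|t|)); first by rewrite ler_wpM2l.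
  have : `|t| <= `|t| `^ del.
    by apply: ger1_powR => //; rewrite t0'.
  move=> /(ler_wpM2l C0).
  have : 0 <= C * `|t| `^ del by rewrite mulr_ge0 ?powR_ge0.
  lra.
have : 1 <= `|t| `^ del.
  by rewrite -[leLHS](powRr0 `|t|) ler_powR// ltW.
move=> /(ler_wpM2l C0).
have := dfC c; have := dfC v; have := ler_normB (df c) (df v).
lra.
Qed.

(** An equal share of Stein's expression is charged to each observation: the weight of [df] is
    [a ^+ 2], which is both 1/n and the variance of [xi]. *)
Let term i w := xi (Z i w) * f (clt_sum w) - a ^+ 2 * df (clt_sum w).

Let mS := measurable_clt_sum.

Let term_le i : mean_le Q (term i) (`|C| * a + a ^+ 2 * `|C|).
Proof.
apply: mean_leD.
  apply: mean_leM_bounded (mean_le_sample iidZ i xi_le) _ _.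
    exact: measurableT_comp.
  by move=> w; exact: fC.
have h := mean_leZ (- a ^+ 2) (mean_le_cst Q C).
rewrite normrN ger0_norm ?sqr_ge0// in h; apply: le_mean_le h => [|w] /=.
  by apply: measurableT_comp => //; apply: measurable_funM => //; exact: measurableT_comp.
by rewrite !normrM !normrN normrM ler_wpM2l// (le_trans (dfC _)) ?ler_norm.
Qed.

Let bdd_integrable (g : R -> R) i : measurable_fun setT g -> (forall x, `|g x| <= C) ->
  Q.-integrable setT (EFin \o (g \o V i)).
Proof.
move=> mg gC; apply: (@mean_le_integrable _ _ _ Q _ `|C|).
apply: le_mean_le (mean_le_cst Q C) => [|w]; first exact: measurableT_comp.
by rewrite /= (le_trans (gC _)) ?ler_norm.
Qed.

Let indep0 i (u : T -> R) (g : R -> R) : P.-integrable setT (EFin \o u) ->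
  \int[P]_x u x = 0 -> measurable_fun setT g -> (forall x, `|g x| <= C) ->
  Q.-integrable setT (EFin \o (fun w => u (Z i w) * g (V i w))) /\
  \int[Q]_w (u (Z i w) * g (V i w)) = 0.
Proof.
move=> iu u0 mg gC; have ib := bdd_integrable i mg gC; split.
  exact: (@integrable_indepM _ _ _ _ _ _ _ _ _ iidZ i (fun=> xi)).
rewrite (@Rintegral_indepM _ _ _ _ _ _ _ _ _ iidZ i (fun=> xi) u g)//.
by rewrite u0 mul0r.
Qed.

Let centered2_integrable : P.-integrable setT (EFin \o (fun x => xi x ^+ 2 - a ^+ 2)).
Proof.
apply: (@mean_le_integrable _ _ _ P _ (a ^+ 2 + `|- a ^+ 2|)).
exact: (mean_leD xi2_le (mean_le_cst P (- a ^+ 2))).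
Qed.

Let centered2_mean : \int[P]_x (xi x ^+ 2 - a ^+ 2) = 0.
Proof.
rewrite RintegralB//; last 2 first.
- exact: mean_le_integrable xi2_le.
- exact: mean_le_integrable (mean_le_cst P (a ^+ 2)).
by rewrite xi2E mean_Rintegral_cst subrr.
Qed.

(** Subtracting [xi * f (V i)] and [(xi ^+ 2 - a ^+ 2) * df (V i)], which have mean zero by
    independence, leaves [xi] times the Taylor remainder of [f] at [V i] and [a ^+ 2] times an
    increment of [df]. *)
Let term_mean i : `|\int[Q]_w term i w| <=
  2 * C * (a `^ (2 + del) * kap) + C * a ^+ 2 * a.
Proof.
have [i1 E1] := indep0 i (mean_le_integrable xi_le) xi0 mf fC.
have [i2 E2] := indep0 i centered2_integrable centered2_mean mdf dfC.
pose rem w := term i w - (xi (Z i w) * f (V i w) +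
  (xi (Z i w) ^+ 2 - a ^+ 2) * df (V i w)).
have it := mean_le_integrable (term_le i).
have -> : \int[Q]_w term i w = \int[Q]_w rem w.
  rewrite (RintegralB measurableT it (integrable_addr i1 i2)).
  by rewrite (RintegralD measurableT i1 i2) E1 E2 addr0 subr0.
apply: mean_le_Rintegral.
have h1 := mean_leZ (2 * C) (mean_le_sample iidZ i xikap).
have h2 := mean_leZ (C * a ^+ 2) (mean_le_sample iidZ i (mean_le_norm xi_le)).
have p1 : 0 <= 2 * C by rewrite mulr_ge0.
have p2 : 0 <= C * a ^+ 2 by rewrite mulr_ge0 ?sqr_ge0.
rewrite ger0_norm// in h1; rewrite ger0_norm// in h2.
apply: le_mean_le (mean_leD h1 h2) => [|w].
  have mxZ : measurable_fun setT (xi \o Z i) by exact: measurableT_comp.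
  apply: measurable_funB; first exact: (term_le i).1.
  apply: measurable_funD; first by apply: measurable_funM => //; exact: measurableT_comp.
  apply: measurable_funM; last exact: measurableT_comp.
  by apply: measurable_funB => //; exact: measurable_funX.
rewrite [leRHS]ger0_norm; last by rewrite addr_ge0// mulr_ge0// ?powR_ge0.
rewrite /rem /term (clt_sum_split i); set x := xi _; set v := V i w.
have -> : x * f (v + x) - a ^+ 2 * df (v + x) - (x * f v + (x ^+ 2 - a ^+ 2) * df v) =
  x * (f (v + x) - f v - x * df v) - a ^+ 2 * (df (v + x) - df v) by ring.
rewrite (le_trans (ler_normB _ _))// lerD// normrM.
  apply: le_trans (ler_wpM2l (normr_ge0 _) (taylor v x)) _.
  rewrite mulrCA ler_wpM2l//.
  have [->|x0] := eqVneq x 0; first by rewrite normr0 mul0r powR_ge0.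
  rewrite -{1}[`|x|]powRr1// -powRD; last by rewrite normr_eq0 x0 implybT.
  by rewrite addrA -natr1.
rewrite [C * _]mulrC -[leRHS]mulrA ger0_norm ?sqr_ge0// ler_wpM2l ?sqr_ge0//.
by have := df_lip (v + x) v; rewrite addrAC subrr add0r.
Qed.

Lemma stein_discrepancy :
  `|\int[Q]_w (df (clt_sum w) - clt_sum w * f (clt_sum w))| <=
  2 * C * kap * a `^ del + C * a.
Proof.
have -> : \int[Q]_w (df (clt_sum w) - clt_sum w * f (clt_sum w)) =
    - \sum_(i < n) \int[Q]_w term i w.
  rewrite -Rintegral_bigsum; last by move=> i; exact: mean_le_integrable (term_le i).
  rewrite -mulN1r -RintegralZl//; last first.
    by apply: integrable_bigsum => i; exact: mean_le_integrable (term_le i).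
  apply: eq_Rintegral => w _; rewrite sumrB -mulr_suml -clt_sumE.
  rewrite sumr_const card_ord -mulr_natl mulrA na2; ring.
rewrite normrN (le_trans (ler_norm_sum _ _ _))//.
apply: (@le_trans _ _ (\sum_(i < n) (2 * C * (a `^ (2 + del) * kap) + C * a ^+ 2 * a))).
  by apply: ler_sum => i _; exact: term_mean.
rewrite sumr_const card_ord -[leLHS]mulr_natl powRD; last by rewrite (gt_eqF a0) implybT.
rewrite powR_mulrn ?(ltW a0)//.
have -> : n%:R * (2 * C * (a ^+ 2 * a `^ del * kap) + C * a ^+ 2 * a) =
  (n%:R * a ^+ 2) * (2 * C * kap * a `^ del + C * a) by ring.
by rewrite na2 mul1r.
Qed.

End test_function.
End stein_clt.

(** * Passage from Lipschitz test functions to distribution functions *)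

Section trapezoid.
Context {R : realType}.
Variables (x e : R).
Hypothesis e0 : 0 < e.

(** The indicator of []-oo, x]] relaxed linearly over [[x, x + e]], to serve as a test function in
    Stein's method. *)
Definition ramp (u : R) : R := Num.min 1 (Num.max 0 ((x + e - u) / e)).

Lemma ramp01 u : 0 <= ramp u <= 1.
Proof. by rewrite /ramp ge_min lexx le_min ler01 le_max lexx. Qed.

Lemma ramp_left u : u <= x -> ramp u = 1.
Proof.
move=> ux; rewrite /ramp; apply/min_idPl; rewrite le_max ler_pdivlMr// mul1r.
by apply/orP; right; lra.
Qed.

Lemma ramp_right u : x + e <= u -> ramp u = 0.
Proof.
move=> ux; rewrite /ramp.
have -> : Num.max 0 ((x + e - u) / e) = 0.
  by apply/max_idPl; rewrite ler_pdivrMr// mul0r; lra.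
by apply/min_idPr.
Qed.

Lemma ramp_lip u v : `|ramp u - ramp v| <= e^-1 * `|u - v|.
Proof.
wlog uv : u v / u <= v.
  move=> H; have [|/ltW vu] := leP u v; first exact: H.
  by rewrite distrC [`|u - v|]distrC; exact: H.
set p := (x + e - u) / e; set q := (x + e - v) / e.
have pq : p - q = e^-1 * `|u - v|.
  rewrite distrC ger0_norm ?subr_ge0// /p /q; field.
  by rewrite gt_eqF.
have qp : q <= p by rewrite -subr_ge0 pq mulr_ge0// invr_ge0 ltW.
rewrite -pq /ramp -/p -/q ler_norml.
have [p0|p0] := lerP 0 p; have [q0|q0] := lerP 0 q; rewrite !minEle;
by do ![case: ifPn; rewrite -?ltNge => ?]; lra.
Qed.

End trapezoid.

Section clt.
Context {R : realType}.
Local Notation mu := (@lebesgue_measure R).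

(** The constant is the bound on the Stein solution of [h]. It precedes the quantifiers over spaces,
    laws and sample sizes, so it stays fixed along a triangular array. *)
Lemma clt_test_function (h : R -> R) (K Lh : R) :
  (forall x, 0 <= h x <= 1) -> (forall x y, `|h x - h y| <= Lh * `|x - y|) ->
  1 <= K -> (forall x, x <= - K -> h x = 1) -> (forall x, K <= x -> h x = 0) ->
  exists2 C : R, 0 < C & forall (dO dT : measure_display)
    (Omega : measurableType dO) (T : measurableType dT)
    (Q : probability Omega R) (P : probability T R) (n : nat)
    (Z : 'I_n -> {RV Q >-> T}) (psi : T -> R) (del kap : R),
    iid_from P Z -> (0 < n)%N -> \int[P]_x psi x = 0 ->
    mean_le P (fun x => psi x ^+ 2) 1 -> \int[P]_x (psi x ^+ 2) = 1 ->
    measurable_fun setT psi -> 0 < del <= 1 ->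
    mean_le P (fun x => `|psi x| `^ (2 + del)) kap ->
    `|\int[Q]_w h (clt_sum Z psi w) - \int[mu]_u (h u * std_pdf u)| <=
      C * (2 * kap * (Num.sqrt n%:R)^-1 `^ del + (Num.sqrt n%:R)^-1).
Proof.
move=> h01 hlip K1 hl hr.
have [C C0 [fC dfC dflip]] := stein_solution_bounded h01 hlip K1 hl hr.
exists C => // dO dT Omega T Q P n Z psi del kap iidZ n0 psi0 psi2 psi2E mpsi del01 psik.
have dS := @is_derive_stein_solution _ h _ h01 hlip.
have mS := measurable_clt_sum Z mpsi.
have mh : measurable_fun setT h.
  by apply: continuous_measurable_fun; exact: lipschitz_continuous hlip.
have ih : Q.-integrable setT (EFin \o (h \o clt_sum Z psi)).
  apply: (@mean_le_integrable _ _ _ Q _ `|1|).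
  apply: le_mean_le (mean_le_cst Q 1) => [|w]; first exact: measurableT_comp.
  by have /andP[a b] := h01 (clt_sum Z psi w); rewrite normr1 ger0_norm.
have := stein_discrepancy iidZ n0 psi0 psi2 psi2E mpsi del01 psik dS fC dfC dflip.
under eq_Rintegral do rewrite stein_equation.
rewrite RintegralB//; last first.
  exact: (mean_le_integrable (mean_le_cst Q (\int[mu]_u (h u * std_pdf u)))).
rewrite mean_Rintegral_cst => /le_trans; apply.
by rewrite le_eqVlt; apply/orP; left; apply/eqP; ring.
Qed.

Lemma std_cdf_increment (x e : R) : 0 <= e ->
  std_cdf (x + e) <= std_cdf x + normal_peak 1 * e.
Proof.
rewrite le_eqVlt => /predU1P[<-|e0]; first by rewrite addr0 mulr0 addr0.
have xe : x < x + e by rewrite ltrDl.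
have [c _ E] := is_derive_mvt (@is_derive_std_cdf R) xe.
have -> : std_cdf (x + e) = std_cdf x + std_pdf c * e.
  by move: E; rewrite addrAC subrr add0r => <-; ring.
by rewrite lerD2l ler_wpM2r ?(ltW e0)// std_pdf_le_peak.
Qed.

Let ramp_large (x e : R) : 0 < e -> let K := `|x| + e + 1 in
  [/\ 1 <= K, forall u, u <= - K -> ramp x e u = 1 & forall u, K <= u -> ramp x e u = 0].
Proof.
move=> e0; have x0 := normr_ge0 x; have := ler_norm x; have := ler_norm (- x).
rewrite normrN => h1 h2; split; first lra.
  by move=> u uK; apply: ramp_left => //; lra.
by move=> u uK; apply: ramp_right => //; lra.
Qed.

Let ramp_measurable (x e : R) : 0 < e -> measurable_fun setT (ramp x e).
Proof.
move=> e0; apply: continuous_measurable_fun.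
exact: lipschitz_continuous (ramp_lip _ e0).
Qed.

Let norm_ramp (x e : R) u : `|ramp x e u| <= 1.
Proof. by have /andP[a b] := ramp01 x e u; rewrite ger0_norm. Qed.

Let std_cdf_indic (x : R) : std_cdf x = \int[mu]_u (\1_(`]-oo, x]%classic) u * std_pdf u).
Proof.
rewrite /std_cdf Rintegral_mkcond; apply: eq_Rintegral => u _.
rewrite patchE indicE; case: ifP => _; rewrite ?mul1r ?mul0r//.
Qed.

Let indic_integrable (x : R) :
  mu.-integrable setT (EFin \o (fun u => \1_(`]-oo, x]%classic) u * std_pdf u)).
Proof.
apply: (@le_integrable _ _ _ mu setT measurableT _ (EFin \o std_pdf)).
- apply/measurable_EFinP/measurable_funM; last exact: measurable_normal_pdf.
  exact: measurable_indic.
- move=> u _ /=; rewrite lee_fin normrM ler_piMl//.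
  by rewrite indicE; case: (_ \in _); rewrite ?normr1 ?normr0.
- exact: integrable_std_pdf.
Qed.

Let ramp_integrable (x e : R) : 0 < e ->
  mu.-integrable setT (EFin \o (fun u => ramp x e u * std_pdf u)).
Proof.
move=> e0; apply: (@integrable_std_primitive _ _ 1); last exact: norm_ramp.
exact: lipschitz_continuous (ramp_lip _ e0).
Qed.

Lemma ramp_mean_lower (x e : R) : 0 < e ->
  std_cdf x <= \int[mu]_u (ramp x e u * std_pdf u).
Proof.
move=> e0; rewrite std_cdf_indic; apply: le_Rintegral => //.
  exact: ramp_integrable.
move=> u _; rewrite ler_wpM2r ?(ltW (std_pdf_gt0 u))// indicE.
case: (boolP (u \in _)) => [|_].
  by rewrite inE/= in_itv/= => ux; rewrite ramp_left.
by have /andP[] := ramp01 x e u.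
Qed.

Lemma ramp_mean_upper (x e : R) : 0 < e ->
  \int[mu]_u (ramp x e u * std_pdf u) <= std_cdf (x + e).
Proof.
move=> e0; rewrite std_cdf_indic; apply: le_Rintegral => //.
  exact: ramp_integrable.
move=> u _; rewrite ler_wpM2r ?(ltW (std_pdf_gt0 u))// indicE.
case: (boolP (u \in _)) => [_|]; first by have /andP[] := ramp01 x e u.
by rewrite notin_setE/= in_itv/= => /negP; rewrite -ltNge => /ltW ux; rewrite ramp_right.
Qed.

Section empirical.
Context {dO : measure_display} {Omega : measurableType dO}.
Variables (Q : probability Omega R) (S : Omega -> R).
Hypothesis mS : measurable_fun setT S.

Let iramp (x e : R) : 0 < e -> Q.-integrable setT (EFin \o (ramp x e \o S)).
Proof.
move=> e0; apply: (@mean_le_integrable _ _ _ Q _ `|1|).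
apply: le_mean_le (mean_le_cst Q 1) => [|w].
  by apply: measurableT_comp => //; exact: ramp_measurable.
by rewrite normr1 /= norm_ramp.
Qed.

Let mle (x : R) : measurable [set w | S w <= x].
Proof. exact: measurable_setle. Qed.

Let prob_indic (x : R) : fine (Q [set w | S w <= x]) = \int[Q]_w \1_([set w | S w <= x]) w.
Proof. by rewrite /Rintegral integral_indic// setIT. Qed.

Let iindic (x : R) : Q.-integrable setT (EFin \o \1_([set w | S w <= x])).
Proof. exact: integrable_indic. Qed.

Lemma prob_le_ramp (x e : R) : 0 < e ->
  fine (Q [set w | S w <= x]) <= \int[Q]_w ramp x e (S w).
Proof.
move=> e0; rewrite prob_indic; apply: le_Rintegral => //.
  exact: iramp.
move=> w _; rewrite indicE; case: (boolP (w \in _)) => [|_].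
  by rewrite inE/= => ux; rewrite ramp_left.
by have /andP[] := ramp01 x e (S w).
Qed.

Lemma ramp_le_prob (x e : R) : 0 < e ->
  \int[Q]_w ramp x e (S w) <= fine (Q [set w | S w <= x + e]).
Proof.
move=> e0; rewrite prob_indic; apply: le_Rintegral => //.
  exact: iramp.
move=> w _; rewrite indicE; case: (boolP (w \in _)) => [_|].
  by have /andP[] := ramp01 x e (S w).
by rewrite notin_setE/= => /negP; rewrite -ltNge => /ltW ux; rewrite ramp_right.
Qed.

End empirical.

(** The ramps starting at [x - e] and at [x] enclose the indicator of []-oo, x]]. Relaxing the
    indicator moves the normal probability by at most the peak of the density times [e]. *)
Lemma clt_cdf (x e : R) : 0 < e -> exists2 C : R, 0 < C &
  forall (dO dT : measure_display)
    (Omega : measurableType dO) (T : measurableType dT)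
    (Q : probability Omega R) (P : probability T R) (n : nat)
    (Z : 'I_n -> {RV Q >-> T}) (psi : T -> R) (del kap : R),
    iid_from P Z -> (0 < n)%N -> \int[P]_x psi x = 0 ->
    mean_le P (fun x => psi x ^+ 2) 1 -> \int[P]_x (psi x ^+ 2) = 1 ->
    measurable_fun setT psi -> 0 < del <= 1 ->
    mean_le P (fun x => `|psi x| `^ (2 + del)) kap ->
    `|fine (Q [set w | clt_sum Z psi w <= x]) - std_cdf x| <= normal_peak 1 * e +
      C * (2 * kap * (Num.sqrt n%:R)^-1 `^ del + (Num.sqrt n%:R)^-1).
Proof.
move=> e0.
have [K1 l1 r1] := ramp_large x e0.
have [C1 C10 H1] := clt_test_function (ramp01 x e) (ramp_lip x e0) K1 l1 r1.
have [K2 l2 r2] := ramp_large (x - e) e0.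
have [C2 C20 H2] := clt_test_function (ramp01 (x - e) e) (ramp_lip (x - e) e0) K2 l2 r2.
exists (C1 + C2); first by rewrite addr_gt0.
move=> dO dT Omega T Q P n Z psi del kap iidZ n0 psi0 psi2 psi2E mpsi del01 psik.
have := H1 _ _ _ _ _ _ _ _ _ _ _ iidZ n0 psi0 psi2 psi2E mpsi del01 psik.
have := H2 _ _ _ _ _ _ _ _ _ _ _ iidZ n0 psi0 psi2 psi2E mpsi del01 psik.
have mS := measurable_clt_sum Z mpsi.
have kap0 := mean_le_ge0 psik.
set b := _ + (Num.sqrt n%:R)^-1.
have b0 : 0 <= b by rewrite addr_ge0 ?mulr_ge0 ?powR_ge0 ?invr_ge0 ?sqrtr_ge0.
have C1b : 0 <= C1 * b by rewrite mulr_ge0// ltW.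
have C2b : 0 <= C2 * b by rewrite mulr_ge0// ltW.
have := prob_le_ramp Q mS x e0.
have := ramp_le_prob Q mS (x - e) e0; rewrite subrK.
have := ramp_mean_upper x e0; have := ramp_mean_lower (x - e) e0.
have := std_cdf_increment x (ltW e0); have := std_cdf_increment (x - e) (ltW e0).
rewrite subrK mulrDl => h1 h2 h3 h4 h5 h6.
rewrite !ler_norml; lra.
Qed.

End clt.

(** * Maximal inequalities *)

Section union_bound.
Context {R : realType} {d : measure_display} {T : measurableType d}.
Variable Q : probability T R.

Lemma measurable_existsb (I : finType) (E : I -> set T) :
  (forall i, measurable (E i)) -> measurable [set w | exists i, E i w].
Proof.
move=> mE; rewrite (_ : [set w | _] = \bigcup_(i in [set: I]) E i).
  by apply: fin_bigcup_measurable => //; exact: finite_finset.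
by apply/seteqP; split => w [i] => [Ew|_ Ew]; exists i.
Qed.

Lemma union_bound (I : finType) (E : I -> set T) (c : R) :
  (forall i, measurable (E i)) -> (forall i, (Q (E i) <= c%:E)%E) ->
  (Q [set w | exists i, E i w] <= (#|I|%:R * c)%:E)%E.
Proof.
move=> mE Ec; rewrite (_ : [set w | _] = \big[setU/set0]_(i <- enum I) E i); last first.
  rewrite big_enum/=; apply/seteqP; split=> w.
    by move=> [i Ei]; rewrite (bigD1 i)//=; left.
  by apply: (big_ind (fun A : set T => A w -> exists i, E i w)) => //
    [A B HA HB [/HA|/HB]|i _ Ei] //; exists i.
rewrite cardE; elim: (enum I) => [|i s ih].
  by rewrite big_nil measure0 mul0r.
rewrite big_cons/= -natr1 mulrDl mul1r addrC EFinD.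
have mU : measurable (\big[setU/set0]_(j <- s) E j) by exact: bigsetU_measurable.
apply: le_trans (measureU2 _ _ _) _ => //.
exact: leeD (Ec i) ih.
Qed.

End union_bound.

Section maximal_inequalities.
Context {R : realType} {dO dT : measure_display}.
Context {Omega : measurableType dO} {T : measurableType dT}.
Variables (Q : probability Omega R) (P : probability T R) (n : nat).
Variable Z : 'I_n -> {RV Q >-> T}.
Hypothesis iidZ : iid_from P Z.
Variables (env : T -> R) (s K : R).
Hypothesis env0 : forall x, 0 <= env x.
Hypothesis menv : measurable_fun setT env.
Hypothesis s1 : 1 <= s.
Hypothesis envK : mean_le P (fun x => env x `^ s) K.

Let s0 : 0 < s. Proof. exact: lt_le_trans s1. Qed.

Lemma envelope_tail M : 0 < M ->
  (Q [set w | exists i, (M < env (Z i w))%R] <= (n%:R * (K / M `^ s))%:E)%E.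
Proof.
move=> M0; have := @union_bound _ _ _ Q 'I_n (fun i => [set w | M < env (Z i w)]).
rewrite card_ord; apply=> i.
  by apply: measurable_setlt => //; exact: measurableT_comp.
apply: le_trans (mean_le_tail (powR_gt0 s M0) (mean_le_sample iidZ i envK)).
apply: le_measure; rewrite ?inE.
- by apply: measurable_setlt => //; exact: measurableT_comp.
- apply: measurable_setlt => //.
  exact: (mean_le_norm (mean_le_sample iidZ i envK)).1.
- move=> w /= Mw; rewrite ger0_norm ?powR_ge0// gt0_ltr_powR ?nnegrE//.
  exact: ltW.
Qed.

(** Truncation is decided by the common envelope and not by [f], so one exceptional event serves all
    coordinates and both signs. *)
Let trunc M (f : T -> R) x := if env x <= M then f x else 0.

Let measurable_trunc M f : measurable_fun setT f -> measurable_fun setT (trunc M f).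
Proof.
move=> mf; apply: measurable_fun_ifT => //.
exact: measurable_fun_ler.
Qed.

Let trunc_sum M f w : ~ (exists i, M < env (Z i w)) ->
  \sum_(i < n) trunc M f (Z i w) = \sum_(i < n) f (Z i w).
Proof.
move=> H; apply: eq_bigr => i _; rewrite /trunc; case: lerP => // Mi.
by exfalso; apply: H; exists i.
Qed.

Let trunc_le M f x : `|trunc M f x| <= `|f x|.
Proof. by rewrite /trunc; case: ifP => //; rewrite normr0. Qed.

(** Unless some observation has its envelope above [M], truncated and full sums coincide; the
    exceptional event is paid for once, the bound [c] once per index. *)
Let prob_sum_trunc M (I : finType) (f : I -> T -> R) u c : 0 < M ->
  (forall j, measurable_fun setT (f j)) ->
  (forall j, (Q [set w | (u < \sum_(i < n) trunc M (f j) (Z i w))%R] <= c%:E)%E) ->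
  (Q [set w | exists j, (u < \sum_(i < n) f j (Z i w))%R] <=
    (n%:R * (K / M `^ s) + #|I|%:R * c)%:E)%E.
Proof.
move=> M0 mf fc.
have mfj j : measurable_fun setT (fun w => \sum_(i < n) f j (Z i w)).
  by apply: measurable_sum => i; exact: measurableT_comp.
have mtj j : measurable_fun setT (fun w => \sum_(i < n) trunc M (f j) (Z i w)).
  apply: measurable_sum => i; apply: measurableT_comp => //.
  exact: measurable_trunc.
have m1 : measurable [set w | exists i, M < env (Z i w)].
  apply: measurable_existsb => i; apply: measurable_setlt => //.
  exact: measurableT_comp.
have m2 : measurable [set w | exists j, u < \sum_(i < n) trunc M (f j) (Z i w)].
  by apply: measurable_existsb => j; exact: measurable_setlt.
apply: (@le_trans _ _ (Q ([set w | exists i, (M < env (Z i w))%R] `|`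
  [set w | exists j, (u < \sum_(i < n) trunc M (f j) (Z i w))%R]))).
  apply: le_measure; rewrite ?inE.
  - by apply: measurable_existsb => j; exact: measurable_setlt.
  - exact: measurableU.
  - move=> w [j uj]; have [H|H] := pselect (exists i, M < env (Z i w)); first by left.
    by right; exists j; rewrite trunc_sum.
apply: le_trans (measureU2 _ _ _) _ => //; rewrite EFinD; apply: leeD.
  exact: envelope_tail.
apply: (@union_bound _ _ _ Q I (fun j => [set w | u < \sum_(i < n) trunc M (f j) (Z i w)])) => //.
by move=> j; exact: measurable_setlt.
Qed.

Section centered.
Variables (I : finType) (xi : I -> T -> R) (sig2 l A : R).
Hypothesis mxi : forall j, measurable_fun setT (xi j).
Hypothesis xienv : forall j x, `|xi j x| <= env x.
Hypothesis xi0 : forall j, \int[P]_x xi j x = 0.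
Hypothesis xi2 : forall j, mean_le P (fun x => xi j x ^+ 2) sig2.
Hypothesis l0 : 0 < l.

Let M : R := (2 * l)^-1.
Let tau : R := n%:R * (K / M `^ s).

Let M0 : 0 < M. Proof. by rewrite invr_gt0 mulr_gt0. Qed.

Let xi_le j : mean_le P (xi j) (2^-1 * sig2 + 2^-1).
Proof.
have := mean_leD (mean_leZ 2^-1 (xi2 j)) (mean_leZ 2^-1 (mean_le_cst P 1)).
rewrite normr1 mulr1 ger0_norm ?invr_ge0//.
apply: le_mean_le => // x; rewrite [leRHS]ger0_norm /=; last first.
  by have := sqr_ge0 (xi j x); lra.
rewrite -[xi j x ^+ 2]real_normK ?num_real//.
have : 0 <= (`|xi j x| - 1) ^+ 2 by exact: sqr_ge0.
nra.
Qed.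

Let trunc_chernoff (sgn : R) j : `|sgn| = 1 ->
  (Q [set w | (n%:R * (A * l) < \sum_(i < n) trunc M (fun x => (sgn * xi j x)%R) (Z i w))%R]
   <= (expR (tau / 2 - n%:R * l ^+ 2 * (A - 2 * sig2)))%:E)%E.
Proof.
move=> sgn1; pose f x := sgn * xi j x.
have fxi x : `|f x| = `|xi j x| by rewrite normrM sgn1 mul1r.
have mf : measurable_fun setT f by exact: measurable_funM.
have mtf : measurable_fun setT (trunc M f) by exact: measurable_trunc.
have bM x : `|trunc M f x| <= M.
  rewrite /trunc; case: ifP => [eM|_]; last by rewrite normr0 ltW.
  by rewrite fxi (le_trans (xienv j x)).
have lM : l * M <= 2^-1.
  by rewrite /M invfM mulrCA divff ?mulr1// gt_eqF.
have f_le : mean_le P f (2^-1 * sig2 + 2^-1).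
  by apply: le_mean_le (xi_le j) => // x; rewrite fxi.
have t_le : mean_le P (trunc M f) (2^-1 * sig2 + 2^-1).
  by apply: le_mean_le f_le => // x; exact: trunc_le.
(* Since [f] has mean zero, the truncation bias is minus the mean of the discarded part. There
   [env x > M], so [env x] is at most [M] times the power [s] of [env x / M]. *)
have b1 : \int[P]_x trunc M f x <= K / M `^ s * M.
  have -> : \int[P]_x trunc M f x = - \int[P]_x (f x - trunc M f x).
    rewrite RintegralB//; [|exact: mean_le_integrable f_le|exact: mean_le_integrable t_le].
    rewrite RintegralZl// ?xi0 ?mulr0 ?sub0r ?opprK//.
    exact: mean_le_integrable (xi_le j).
  apply: le_trans (ler_norm _) _; rewrite normrN; apply: mean_le_Rintegral.
  have h := mean_leZ (M / M `^ s) envK.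
  have c0 : 0 <= M / M `^ s by rewrite divr_ge0 ?powR_ge0 ?ltW.
  rewrite (ger0_norm c0) in h.
  have -> : K / M `^ s * M = M / M `^ s * K by ring.
  apply: le_mean_le h => [|x]; first exact: measurable_funB.
  have p0 : 0 <= M / M `^ s * env x `^ s by rewrite mulr_ge0 ?powR_ge0.
  rewrite (ger0_norm p0) /trunc.
  case: (lerP (env x) M) => [_|Mx]; first by rewrite subrr normr0.
  rewrite subr0 fxi (le_trans (xienv j x))//.
  have e0 : 0 < env x by exact: lt_trans Mx.
  rewrite -(mulr_powRB1 (env0 x) s0) mulrCA ler_peMr//.
  rewrite -(mulr_powRB1 (ltW M0) s0) invfM mulrA divff ?gt_eqF// mul1r mulrC.
  rewrite ler_pdivlMr ?powR_gt0// mul1r.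
  by apply: ge0_ler_powR; rewrite ?nnegrE ?subr_ge0 ?env0 ?(ltW M0) ?(ltW Mx).
have b2 : \int[P]_x (trunc M f x ^+ 2) <= sig2.
  apply: le_trans (ler_norm _) _; apply: mean_le_Rintegral.
  apply: (le_mean_le _ _ (xi2 j)) => [|y]; first exact: measurable_funX.
  by rewrite !normrX ler_pXn2r ?nnegrE// -fxi trunc_le.
apply: le_trans (iid_chernoff iidZ (n%:R * (A * l)) mtf bM l0 lM b1 b2) _.
rewrite lee_fin ler_expR le_eqVlt; apply/orP; left; apply/eqP.
have lM2 : l * M = 2^-1 by rewrite /M invfM mulrCA divff ?mulr1// gt_eqF.
rewrite /tau.
have -> : l * (K / M `^ s * M) = K / M `^ s * (l * M) by ring.
rewrite lM2; ring.
Qed.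

(* Truncating the envelope at [M = 1 / (2 l)] makes Chernoff's bound applicable
   with parameter [l]; both the effect of the truncation on the sum and its bias
   are governed by [tau]. *)
Lemma max_centered :
  (Q [set w | exists j, (n%:R * (A * l) < `|\sum_(i < n) xi j (Z i w)|)%R] <=
  (2 * tau + 2 * #|I|%:R * expR (tau / 2 - n%:R * l ^+ 2 * (A - 2 * sig2)))%:E)%E.
Proof.
pose f (c : bool) (j : I) x := (if c then 1 else -1) * xi j x.
have mf c j : measurable_fun setT (f c j) by exact: measurable_funM.
have bnd c : (Q [set w | exists j, (n%:R * (A * l) < \sum_(i < n) f c j (Z i w))%R] <=
    (tau + #|I|%:R * expR (tau / 2 - n%:R * l ^+ 2 * (A - 2 * sig2)))%:E)%E.
  apply: prob_sum_trunc => // j; apply: trunc_chernoff.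
  by case: c; rewrite ?normrN normr1.
have mE c : measurable [set w | exists j, n%:R * (A * l) < \sum_(i < n) f c j (Z i w)].
  apply: measurable_existsb => j; apply: measurable_setlt => //.
  by apply: measurable_sum => i; apply: measurableT_comp.
have mx j : measurable_fun setT (fun w => \sum_(i < n) xi j (Z i w)).
  by apply: measurable_sum => i; exact: measurableT_comp.
apply: (@le_trans _ _ (Q ([set w | exists j, (n%:R * (A * l) < \sum_(i < n) f true j (Z i w))%R]
  `|` [set w | exists j, (n%:R * (A * l) < \sum_(i < n) f false j (Z i w))%R]))).
  apply: le_measure; rewrite ?inE.
  - apply: measurable_existsb => j; apply: measurable_setlt => //.
    exact: measurableT_comp.
  - exact: measurableU.
  - move=> w [j]; rewrite lter_normr => /orP[h|h]; [left|right]; exists j.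
      by under eq_bigr do rewrite /f mul1r.
    by under eq_bigr do rewrite /f mulN1r; rewrite sumrN.
apply: le_trans (measureU2 _ _ _) _ => //.
apply: le_trans (leeD (bnd true) (bnd false)) _.
by rewrite -EFinD lee_fin le_eqVlt; apply/orP; left; apply/eqP; ring.
Qed.

End centered.

Section nonnegative.
Variables (I : finType) (xi : I -> T -> R) (C0 M t : R).
Hypothesis mxi : forall j, measurable_fun setT (xi j).
Hypothesis xi_ge0 : forall j x, 0 <= xi j x.
Hypothesis xienv : forall j x, xi j x <= env x.
Hypothesis xi1 : forall j, mean_le P (xi j) C0.
Hypothesis M0 : 0 < M.

(** A nonnegative variable bounded by [M] has second moment at most [M * C0], so with parameter
    [(2 * M)^-1] the variance term of Chernoff's bound equals the mean term. The factor 2 in front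
    of [C0] absorbs both. *)
Lemma max_nonnegative :
  (Q [set w | exists j, (n%:R * (2 * C0 + t) < \sum_(i < n) xi j (Z i w))%R] <=
  (n%:R * (K / M `^ s) + #|I|%:R * expR (- (n%:R * t / (2 * M))))%:E)%E.
Proof.
apply: prob_sum_trunc => // j.
have mt : measurable_fun setT (trunc M (xi j)) by exact: measurable_trunc.
have t0 x : 0 <= trunc M (xi j) x by rewrite /trunc; case: ifP.
have bM x : `|trunc M (xi j) x| <= M.
  rewrite ger0_norm// /trunc; case: ifP => [eM|_]; last exact: ltW.
  exact: le_trans (xienv j x) eM.
have lam0 : 0 < (2 * M)^-1 by rewrite invr_gt0 mulr_gt0.
have lamM : (2 * M)^-1 * M <= 2^-1 by rewrite invfM mulfVK// gt_eqF.
have b1 : \int[P]_x trunc M (xi j) x <= C0.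
  apply: le_trans (ler_norm _) _; apply: mean_le_Rintegral.
  by apply: le_mean_le (xi1 j) => // x; exact: trunc_le.
have b2 : \int[P]_x (trunc M (xi j) x ^+ 2) <= M * C0.
  apply: le_trans (ler_norm _) _; apply: mean_le_Rintegral.
  have h := mean_leZ M (xi1 j); rewrite (gtr0_norm M0) in h.
  apply: le_mean_le h => [|x]; first exact: measurable_funX.
  by rewrite expr2 !normrM ler_pM// (gtr0_norm M0).
apply: le_trans (iid_chernoff iidZ (n%:R * (2 * C0 + t)) mt bM lam0 lamM b1 b2) _.
rewrite lee_fin ler_expR le_eqVlt; apply/orP; left; apply/eqP.
by field; rewrite gt_eqF.
Qed.

End nonnegative.
End maximal_inequalities.

(** * Piecewise smooth losses *)

Section knots.
Context {R : realType}.

(** [j] is the last index whose knot lies left of [a]; the next knot is neither left of [a] nor in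
    [[a, b]]. *)
Lemma knots_locate (J : nat) (t : nat -> \bar R) (a b : R) : knots J t -> a <= b ->
  (forall j, (0 < j < J)%N -> ~~ ((a%:E <= t j) && (t j <= b%:E))%E) ->
  exists2 j, (j < J)%N & ((t j < a%:E) && (b%:E < t j.+1))%E.
Proof.
move=> [t0 tJ t01 tJ1 tmono] ab nok.
have J0 : (0 < J)%N by case: J tJ {tmono tJ1 nok} => // tJ; rewrite t0 in tJ.
have ex : exists j, (j < J)%N && (t j < a%:E)%E by exists 0%N; rewrite J0 t0 ltNyr.
have ub j : (j < J)%N && (t j < a%:E)%E -> (j <= J)%N by case/andP => /ltnW.
case: (ex_maxnP ex ub) => j /andP[jJ tja] jmax.
exists j => //; rewrite tja/=.
have [jJ'|Jj] := ltnP j.+1 J; last first.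
  have -> : j.+1 = J by lia.
  by rewrite tJ ltry.
have := nok j.+1; rewrite jJ'/= => /(_ isT); rewrite negb_and -!ltNge => /orP[|//].
by move=> tja'; have := jmax j.+1; rewrite jJ' tja' ltnn => /(_ isT).
Qed.

End knots.

Lemma derive1_quotient {R : realType} (f : R -> R) (s e : R) :
  derivable f s 1 -> 0 < e -> exists2 dl : R, 0 < dl & forall h, h != 0 ->
    `|h| < dl -> `|h^-1 * (f (s + h) - f s) - derive1 f s| < e.
Proof.
move=> df e0.
have /cvgrPdist_lt/(_ _ e0) : h^-1 *: (f (h *: 1 + s) - f s) @[h --> 0^'] --> derive1 f s.
  by rewrite derive1E; exact: df.
rewrite near_withinE => /nbhs_ballP[dl /= dl0 H]; exists dl => // h h0 hdl.
have := H h; rewrite /ball/= sub0r normrN distrC => /(_ hdl h0).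
by rewrite /GRing.scale/= mulr1 [h + s]addrC.
Qed.

Lemma le_lipschitz_derive {R : realType} (f : R -> R) (s k : R) :
  (forall x y, `|f x - f y| <= k * `|x - y|) -> derivable f s 1 ->
  `|derive1 f s| <= k.
Proof.
move=> fk df; apply/ler_addgt0Pl => e e0.
have [dl dl0 H] := derive1_quotient df e0.
have h0 : 0 < dl / 2 by rewrite divr_gt0.
have := H (dl / 2); rewrite gt_eqF// gtr0_norm// => /(_ isT) {}H.
have hd : dl / 2 < dl by lra.
have {}H := H hd.
have : `|(dl / 2)^-1 * (f (s + dl / 2) - f s)| <= k.
  rewrite normrM gtr0_norm ?invr_gt0// mulrC ler_pdivrMr//.
  have := fk (s + dl / 2) s; rewrite addrAC subrr add0r.
  by rewrite (gtr0_norm h0).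
move: H; set A := (dl / 2)^-1 * _; set B := derive1 f s => H HA.
have := ler_normB A (A - B); have -> : A - (A - B) = B by ring.
lra.
Qed.

Section smooth_pieces.
Context {R : realType} {Y : Type}.
Variables (m : R -> Y -> R) (y : Y) (J : nat) (t : nat -> \bar R) (Cm : R).
Hypothesis kn : knots J t.
Hypothesis dm : forall s : R, derivable (fun u => m u y : R^o) s 1.
Hypothesis cm1 : continuous (fun s => m1 m s y : R^o).
Hypothesis Cm0 : 0 < Cm.
Hypothesis sm : forall j s, (j < J)%N -> (t j < s%:E)%E -> (s%:E < t j.+1)%E ->
  [/\ has_m11 m s y, has_m111 m s y, `|m11 m s y| <= Cm & `|m111 m s y| <= Cm].

Lemma m11E s : has_m11 m s y -> m11 m s y = derive1 (fun u => m1 m u y : R^o) s.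
Proof. by move=> h; rewrite /m11; case: asboolP. Qed.

Let is_derive_m (s : R) : is_derive s 1 (fun u => m u y : R^o) (m1 m s y).
Proof. by rewrite /m1 derive1E; apply/derivableP; exact: dm. Qed.

Let is_derive_m1 (s : R) : has_m11 m s y ->
  is_derive s 1 (fun u => m1 m u y : R^o) (m11 m s y).
Proof.
move=> h; have E := m11E h.
by have := h => /derivableP; rewrite -derive1E -E.
Qed.

Let is_derive_m11 (s : R) : has_m111 m s y ->
  is_derive s 1 (fun u => m11 m u y : R^o) (m111 m s y).
Proof. by move=> h; rewrite /m111 derive1E; apply/derivableP; exact: h. Qed.

Let mvt_piece j (a b : R) : (j < J)%N -> a < b -> (t j <= a%:E)%E ->
  (b%:E <= t j.+1)%E -> `|m1 m b y - m1 m a y| <= Cm * `|b - a|.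
Proof.
move=> jJ ab ta bt.
have H c : c \in `]a, b[ -> is_derive c 1 (fun u => m1 m u y : R^o) (m11 m c y).
  rewrite in_itv/= => /andP[ac cb]; apply: is_derive_m1.
  by have [] := @sm j c jJ (le_lt_trans ta _) (lt_le_trans _ bt); rewrite ?lte_fin.
have cc : {within `[a, b], continuous (fun u => m1 m u y : R^o)}.
  exact: continuous_subspaceT.
have [c] := MVT ab H cc; rewrite in_itv/= => /andP[ac cb] ->.
rewrite normrM ler_wpM2r//.
by have [] := @sm j c jJ (le_lt_trans ta _) (lt_le_trans _ bt); rewrite ?lte_fin.
Qed.

(** Induction over the pieces, cutting the interval at each knot. Continuity of the first derivative
    extends the mean value theorem to the closed pieces, so the Lipschitz constants do not add
    up. *)
Lemma m1_lipschitz a b : `|m1 m a y - m1 m b y| <= Cm * `|a - b|.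
Proof.
wlog ab : a b / a < b.
  move=> H; have [|ba|->] := ltgtP a b; first exact: H.
    by rewrite distrC [`|a - b|]distrC; exact: H.
  by rewrite !subrr normr0 mulr0.
rewrite distrC [`|a - b|]distrC.
suff H j : (j <= J)%N -> forall a b, a < b -> (b%:E <= t j)%E ->
    `|m1 m b y - m1 m a y| <= Cm * `|b - a|.
  by apply: (H J (leqnn J)) => //; have [_ -> _ _ _] := kn; rewrite leey.
elim: j => [_|j ih jJ] {ab}a {}b ab bt.
  by move: bt; have [-> _ _ _ _] := kn; rewrite leNgt ltNyr.
have [btj|tjb] := leP (b%:E)%E (t j); first exact: (ih (ltnW jJ)).
have [taj|atj] := leP (t j) a%:E; first exact: (mvt_piece jJ).
have [c tc] : exists c : R, t j = c%:E.
  by case: (t j) tjb atj => [c _ _|//|//]; exists c.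
rewrite tc !lte_fin in tjb atj.
have h1 : `|m1 m b y - m1 m c y| <= Cm * `|b - c|.
  by apply: (mvt_piece jJ) => //; rewrite tc.
have h2 : `|m1 m c y - m1 m a y| <= Cm * `|c - a|.
  by apply: (ih (ltnW jJ)) => //; rewrite tc.
have -> : m1 m b y - m1 m a y = (m1 m b y - m1 m c y) + (m1 m c y - m1 m a y) by ring.
apply: le_trans (ler_normD _ _) _; apply: le_trans (lerD h1 h2) _.
by rewrite -mulrDr !gtr0_norm ?subr_gt0 ?(lt_trans atj tjb)// addrA subrK.
Qed.

(** At a knot the second derivative may exist although the bound of the smoothness condition is
    stated between knots only; it is then the derivative of a Lipschitz function. Where it does not
    exist, [m11] is 0. *)
Lemma m11_le s : `|m11 m s y| <= Cm.
Proof.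
rewrite /m11; case: asboolP => [h|_]; last by rewrite normr0 ltW.
exact: le_lipschitz_derive m1_lipschitz h.
Qed.

Lemma m_taylor1 s h : `|m (s + h) y - m s y - h * m1 m s y| <= Cm * h ^+ 2.
Proof.
have [->|h0] := eqVneq h 0.
  by rewrite addr0 subrr mul0r subr0 normr0 mulr_ge0 ?sqr_ge0// ltW.
have [c cs ->] : exists2 c, `|c - s| <= `|h| & m (s + h) y - m s y = h * m1 m c y.
  have [h1|h1|/esym/eqP] := ltgtP 0 h; last by rewrite (negbTE h0).
    have st : s < s + h by rewrite ltrDl.
    have [c] := is_derive_mvt is_derive_m st.
    rewrite in_itv/= => /andP[sc cs] ->; exists c; last by rewrite mulrC addrAC subrr add0r.
    by rewrite !gtr0_norm ?subr_gt0//; lra.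
  have st : s + h < s by rewrite gtrDl.
  have [c] := is_derive_mvt is_derive_m st.
  rewrite in_itv/= => /andP[sc cs] E; exists c; last by rewrite -opprB E; ring.
  rewrite ltr0_norm ?subr_lt0// ltr0_norm//; lra.
rewrite -mulrBr normrM -[h ^+ 2]real_normK ?num_real// expr2 mulrCA ler_wpM2l//.
by apply: le_trans (m1_lipschitz _ _) _; rewrite ler_wpM2l// ltW.
Qed.

(** The second derivative is available at the single point [s], so the remainder is of Peano type:
    the mean value theorem is applied to the remainder [k], whose derivative is the first-order
    error of [m1]. *)
Lemma m_taylor2 s e : has_m11 m s y -> 0 < e -> exists2 dl : R, 0 < dl &
  forall h, `|h| < dl ->
  `|m (s + h) y - m s y - h * m1 m s y - h ^+ 2 * (m11 m s y / 2)| <= e * h ^+ 2.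
Proof.
move=> hm e0; have [dl dl0 H] := derive1_quotient hm e0; exists dl => // h hdl.
rewrite -m11E// in H.
have H' u : `|u| < dl -> `|m1 m (s + u) y - m1 m s y - u * m11 m s y| <= e * `|u|.
  move=> udl; have [->|u0] := eqVneq u 0.
    by rewrite addr0 subrr mul0r subr0 normr0 mulr0.
  rewrite (_ : _ - _ = u * (u^-1 * (m1 m (s + u) y - m1 m s y) - m11 m s y)).
    by rewrite normrM mulrC ler_wpM2r// ltW// H.
  by rewrite mulrBr mulrA divff// mul1r.
pose k u := m (s + u) y - m s y - u * m1 m s y - u ^+ 2 * (m11 m s y / 2).
have dk (u : R) : is_derive u 1 (k : R -> R^o) (m1 m (s + u) y - m1 m s y - u * m11 m s y).
  have d1 := is_derive_m (s + u).
  have ds : is_derive u 1 (fun v : R => s + v) 1.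
    by apply: is_derive_eq; rewrite add0r mul1r.
  have d2 := @is_derive1_comp _ (fun v => m v y) (fun v => s + v) u _ _ d1 ds.
  rewrite /comp/= in d2.
  by apply: is_derive_eq; rewrite /GRing.scale/=; field.
have k0 : k 0 = 0 by rewrite /k addr0 expr2 !mul0r subrr !subr0.
rewrite -/(k h).
have [->|h0] := eqVneq h 0; first by rewrite k0 normr0 mulr_ge0 ?sqr_ge0// ltW.
have [c ch E] : exists2 c, `|c| <= `|h| &
    k h = h * (m1 m (s + c) y - m1 m s y - c * m11 m s y).
  have [h1|h1|/esym/eqP] := ltgtP 0 h; last by rewrite (negbTE h0).
    have [c] := is_derive_mvt dk h1.
    rewrite in_itv/= => /andP[sc cs]; rewrite k0 !subr0 => ->; exists c; last exact: mulrC.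
    by rewrite !gtr0_norm// ltW.
  have [c] := is_derive_mvt dk h1.
  rewrite in_itv/= => /andP[sc cs]; rewrite k0 !sub0r => E.
  exists c; last by rewrite -[LHS]opprK E; ring.
  by rewrite !ltr0_norm//; lra.
rewrite E normrM -[h ^+ 2]real_normK ?num_real// expr2 mulrCA ler_wpM2l//.
apply: le_trans (H' c (le_lt_trans ch hdl)) _.
by rewrite ler_wpM2l// ltW.
Qed.

(** The linear term carries [m11] at the displaced point, because step 3 evaluates the second
    derivative at the estimate. With [D] fixed, one condition on the knots covers every displacement
    up to [D]. *)
Lemma no_knot_expansion (s0 D h : R) : 0 <= D ->
  (forall j, (0 < j < J)%N ->
     ~~ (((s0 - D)%:E <= t j) && (t j <= (s0 + D)%:E))%E) ->
  `|h| <= D -> has_m11 m s0 y /\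
  `|m11 m (s0 + h) y - m11 m s0 y| <= Cm * `|h| /\
  `|m1 m (s0 + h) y - m1 m s0 y - h * m11 m (s0 + h) y| <= Cm * h ^+ 2.
Proof.
move=> D0 nok hD.
have ab : s0 - D <= s0 + D by lra.
have [j jJ /andP[tj1 tj2]] := knots_locate kn ab nok.
have sm' s : `|s - s0| <= D -> [/\ has_m11 m s y, has_m111 m s y,
    `|m11 m s y| <= Cm & `|m111 m s y| <= Cm].
  rewrite ler_norml => /andP[h1 h2]; apply: (sm jJ).
    by apply: lt_le_trans tj1 _; rewrite lee_fin; lra.
  by apply: le_lt_trans tj2; rewrite lee_fin; lra.
have near_s c : `|c - s0| <= `|h| -> `|c - s0| <= D by move=> /le_trans; apply.
have lip11 (a b : R) : a < b -> `|a - s0| <= D -> `|b - s0| <= D ->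
    `|m11 m b y - m11 m a y| <= Cm * `|b - a|.
  move=> ab' aD bD.
  have between c : c \in `[a, b] -> `|c - s0| <= D.
    rewrite in_itv/= => /andP[ac cb]; move: aD bD; rewrite !ler_norml; lra.
  have H c : c \in `]a, b[ -> is_derive c 1 (fun u => m11 m u y : R^o) (m111 m c y).
    move=> /subset_itv_oo_cc cab; apply: is_derive_m11.
    by have [] := sm' c (between c cab).
  have cc : {within `[a, b], continuous (fun u => m11 m u y : R^o)}.
    apply: derivable_within_continuous => c cab.
    by have [] := sm' c (between c cab).
  have [c /subset_itv_oo_cc cab ->] := MVT ab' H cc.
  rewrite normrM ler_wpM2r//.
  by have [] := sm' c (between c cab).
have lip a b : `|a - s0| <= D -> `|b - s0| <= D ->
    `|m11 m b y - m11 m a y| <= Cm * `|b - a|.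
  move=> aD bD; have [ab'|ba|->] := ltgtP a b.
  - exact: lip11.
  - by rewrite distrC [`|b - a|]distrC; exact: lip11.
  - by rewrite !subrr normr0 mulr0.
have s0D : `|s0 - s0| <= D by rewrite subrr normr0.
have sh : s0 + h - s0 = h by ring.
have hsD : `|s0 + h - s0| <= D by rewrite sh.
have lip0 : `|m11 m (s0 + h) y - m11 m s0 y| <= Cm * `|h|.
  by have := lip s0 (s0 + h) s0D hsD; rewrite sh.
split; first by have [] := sm' s0 s0D.
split=> //.
have [->|h0] := eqVneq h 0.
  by rewrite addr0 subrr mul0r subr0 normr0 mulr_ge0 ?sqr_ge0// ltW.
have mvt1 (a b : R) : a < b -> `|a - s0| <= D -> `|b - s0| <= D -> exists2 c,
    a <= c <= b & m1 m b y - m1 m a y = m11 m c y * (b - a).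
  move=> ab' aD bD.
  have between c : c \in `[a, b] -> `|c - s0| <= D.
    rewrite in_itv/= => /andP[ac cb]; move: aD bD; rewrite !ler_norml; lra.
  have H c : c \in `]a, b[ -> is_derive c 1 (fun u => m1 m u y : R^o) (m11 m c y).
    move=> /subset_itv_oo_cc cab; apply: is_derive_m1.
    by have [] := sm' c (between c cab).
  have cc : {within `[a, b], continuous (fun u => m1 m u y : R^o)}.
    exact: continuous_subspaceT.
  have [c /subset_itv_oo_cc + ->] := MVT ab' H cc.
  by rewrite in_itv/= => cab; exists c.
have [c [cs cD] ->] : exists2 c, `|c - (s0 + h)| <= `|h| /\ `|c - s0| <= D &
    m1 m (s0 + h) y - m1 m s0 y = h * m11 m c y.
  have [h1|h1|/esym/eqP] := ltgtP 0 h; last by rewrite (negbTE h0).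
    have st : s0 < s0 + h by rewrite ltrDl.
    have [c /andP[c1 c2] ->] := mvt1 _ _ st s0D hsD.
    exists c; last by rewrite mulrC addrAC subrr add0r.
    move: hD; rewrite gtr0_norm// !ler_norml; lra.
  have st : s0 + h < s0 by rewrite gtrDl.
  have [c /andP[c1 c2] E] := mvt1 _ _ st hsD s0D.
  exists c; last by rewrite -opprB E; ring.
  move: hD; rewrite ltr0_norm// !ler_norml; lra.
have := lip _ _ hsD cD.
move: (m11 m c y) (m11 m (s0 + h) y) => X Z XZ.
rewrite -mulrBr normrM -[h ^+ 2]real_normK ?num_real// expr2 mulrCA ler_wpM2l//.
by apply: le_trans XZ _; rewrite ler_wpM2l// ltW.
Qed.

End smooth_pieces.

(** * Null sets and measurability of the derivatives of the loss *)

Section ae_integral.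
Context {R : realType} {d : measure_display} {T : measurableType d}.
Variable P : probability T R.
Import HBNNSimple.

Let ge0_ae_le_integral (N : set T) (f g : T -> \bar R) :
  measurable N -> P N = 0%E -> (forall x, (0 <= f x)%E) -> (forall x, (0 <= g x)%E) ->
  (forall x, ~ N x -> f x = g x) -> (\int[P]_x f x <= \int[P]_x g x)%E.
Proof.
move=> mN PN f0 g0 fg; rewrite !ge0_integralTE//.
apply: ge_ereal_sup => _ [h hf <-].
(* Killing the simple function on the null set keeps its integral and puts it below [g]. *)
pose h' : {nnsfun T >-> R} := proj_nnsfun h (measurableC mN).
have h'E x : h' x = h x * \1_(~` N) x by [].
have -> : sintegral P h = sintegral P h'.
  rewrite -!integralT_nnsfun; apply: ae_eq_integral => //.
  - by apply/measurable_EFinP.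
  - by apply/measurable_EFinP.
  - exists N; split=> // x /= H; apply: contrapT => Nx; apply: H => _.
    congr EFin; apply/esym; transitivity (h x * \1_(~` N) x) => //.
    by rewrite indicE mem_set// mulr1.
apply: ereal_sup_ubound; exists h' => // x.
rewrite -[h' x]/(h x * \1_(~` N) x) indicE.
have [Nx|Nx] := pselect (N x).
  by rewrite memNset ?mulr0//=; apply.
by rewrite mem_set// mulr1 -fg.
Qed.

(* Unlike [ae_eq_integral], this does not ask [f] and [g] to be measurable: the
   integral of a nonnegative function is a supremum over simple functions. *)
Lemma integral_ae_eq_nonmeasurable (f g : T -> \bar R) :
  {ae P, forall x, f x = g x} -> (\int[P]_x f x = \int[P]_x g x)%E.
Proof.
move=> [N [mN PN H]].
have fg x : ~ N x -> f x = g x by move=> Nx; apply: contrapT => K; apply/Nx/H.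
rewrite [LHS]integralE [RHS]integralE; congr (_ - _)%E.
  apply/eqP; rewrite eq_le; apply/andP; split; apply: (ge0_ae_le_integral mN) => //.
    by move=> x /fg E; rewrite !funeposE E.
  by move=> x /fg E; rewrite !funeposE E.
apply/eqP; rewrite eq_le; apply/andP; split; apply: (ge0_ae_le_integral mN) => //.
  by move=> x /fg E; rewrite !funenegE E.
by move=> x /fg E; rewrite !funenegE E.
Qed.

End ae_integral.

Lemma derive1_seq {R : realType} (f : R -> R) (s : R) : derivable f s 1 ->
  n.+1%:R * (f (s + n.+1%:R^-1) - f s) @[n --> \oo] --> derive1 f s.
Proof.
move=> df; apply/cvgrPdist_lt => e e0.
have [dl dl0 H] := derive1_quotient df e0; near=> n.
rewrite distrC -[X in X * _]invrK; apply: H; first by rewrite invr_eq0 pnatr_eq0.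
rewrite gtr0_norm ?invr_gt0 ?ltr0n//; near: n.
exact: (near_infty_natSinv_lt (PosNum dl0)).
Unshelve. all: by end_near. Qed.

Section measurability.
Context {R : realType} {k : nat} {d : measure_display} {Y : measurableType d}.
Local Notation X := (k.+1.-tuple R).
Local Notation T := (X * Y)%type.
Variables (m : R -> Y -> R).
Hypothesis mm : measurable_fun [set: R * Y] (fun u => m u.1 u.2).
Hypothesis dm : forall (y : Y) (s : R), derivable (fun u => m u y : R^o) s 1.

Lemma measurable_coord (j : 'I_k.+1) : measurable_fun [set: T] (fun z => tnth z.1 j).
Proof. exact: (measurableT_comp (measurable_tnth j)). Qed.

Lemma measurable_dotp (theta : 'rV[R]_k.+1) :
  measurable_fun [set: T] (fun z => dotp z.1 theta).
Proof.
apply: measurable_sum => j; apply: measurable_funM => //.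
exact: measurable_coord.
Qed.

Lemma measurable_resid (mu : 'rV[R]_k) : measurable_fun [set: T] (fun z => resid z.1 mu).
Proof.
apply: measurable_funB; first exact: measurable_coord.
apply: measurable_sum => j; apply: measurable_funM => //.
exact: measurable_coord.
Qed.

Lemma measurable_norm_inf : measurable_fun [set: T] (fun z => norm_inf z.1).
Proof.
rewrite /norm_inf.
rewrite (_ : (fun z : T => _) =
    fun z => \big[Num.max/0]_(j <- enum 'I_k.+1) `|tnth z.1 j|); last first.
  by apply/funext => z; rewrite big_enum.
elim: (enum _) => [|j s ih].
  by under eq_fun do rewrite big_nil; exact: measurable_cst.
under eq_fun do rewrite big_cons.
apply: measurable_maxr => //; apply: measurableT_comp => //.
exact: measurable_coord.
Qed.

Lemma measurable_loss (theta : 'rV[R]_k.+1) (f : T -> R) : measurable_fun setT f ->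
  measurable_fun [set: T] (fun z => m (dotp z.1 theta + f z) z.2).
Proof.
move=> mf; apply: (measurableT_comp mm (f := fun u => m u.1 u.2)
  (g := fun z : T => (dotp z.1 theta + f z, z.2))).
apply: measurable_fun_pair; last exact: measurable_snd.
by apply: measurable_funD => //; exact: measurable_dotp.
Qed.

(** A pointwise limit of difference quotients of the jointly measurable loss. The displacement [f]
    makes the same lemma serve for the quotients of [m1] itself in [m11_proxy]. *)
Lemma measurable_m1 (theta : 'rV[R]_k.+1) (f : T -> R) : measurable_fun setT f ->
  measurable_fun [set: T] (fun z => m1 m (dotp z.1 theta + f z) z.2).
Proof.
move=> mf.
apply: (measurable_fun_cvg (h := fun n z => n.+1%:R *
   (m (dotp z.1 theta + (f z + n.+1%:R^-1)) z.2 - m (dotp z.1 theta + f z) z.2))).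
  move=> n; apply: measurable_funM => //; apply: measurable_funB.
    by apply: measurable_loss; exact: measurable_funD.
  exact: measurable_loss.
move=> z _; have := derive1_seq (@dm z.2 (dotp z.1 theta + f z)).
by apply: cvg_trans; apply: near_eq_cvg; near=> n; rewrite addrA.
Unshelve. all: by end_near. Qed.

(* The hypotheses do not make [m11] measurable; this measurable function agrees
   with it wherever the second derivative exists, by [m11_proxyE]. *)
Definition m11_proxy (Cm : R) (theta : 'rV[R]_k.+1) (z : T) : R :=
  Num.max (- Cm) (Num.min Cm (fine (limn_esup (fun n => (n.+1%:R *
   (m1 m (dotp z.1 theta + n.+1%:R^-1) z.2 - m1 m (dotp z.1 theta) z.2))%:E)))).

Lemma measurable_m11_proxy Cm theta : measurable_fun setT (m11_proxy Cm theta).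
Proof.
apply: measurable_maxr => //; apply: measurable_minr => //.
apply: measurableT_comp => //; apply: measurable_fun_limn_esup => n.
apply/measurable_EFinP; apply: measurable_funM => //; apply: measurable_funB.
  exact: measurable_m1.
have := @measurable_m1 theta (cst 0) (@measurable_cst _ _ _ _ _ _).
by under eq_fun do rewrite addr0.
Qed.

Lemma m11_proxy_le Cm theta z : 0 <= Cm -> `|m11_proxy Cm theta z| <= Cm.
Proof.
move=> C0; rewrite ler_norml /m11_proxy le_max lexx/= ge_max ge_min lexx/=.
by rewrite andbT; lra.
Qed.

Lemma m11_proxyE Cm theta z : has_m11 m (dotp z.1 theta) z.2 ->
  `|m11 m (dotp z.1 theta) z.2| <= Cm ->
  m11_proxy Cm theta z = m11 m (dotp z.1 theta) z.2.
Proof.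
move=> h C; rewrite /m11_proxy.
have E := m11E h; have c := derive1_seq h; rewrite -E in c.
have /cvg_limn_einf_sup[_ ->] : (n.+1%:R *
   (m1 m (dotp z.1 theta + n.+1%:R^-1) z.2 - m1 m (dotp z.1 theta) z.2))%:E
   @[n --> \oo] --> (m11 m (dotp z.1 theta) z.2)%:E.
  by apply/fine_cvgP; split; [exact: nearW|exact: c].
move: C; rewrite ler_norml /= => /andP[C1 C2].
by rewrite min_r// max_r.
Qed.

End measurability.

(** * Deterministic expansion of the debiased estimator *)

Section sample_average.
Context {R : realType} {n : nat}.
Implicit Types f g : 'I_n -> R.

Definition avg f : R := n%:R^-1 * \sum_(i < n) f i.

Lemma avgD f g : avg (fun i => f i + g i) = avg f + avg g.
Proof. by rewrite /avg big_split mulrDr. Qed.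

Lemma avgZ (c : R) f : avg (fun i => c * f i) = c * avg f.
Proof. by rewrite /avg -mulr_sumr mulrCA. Qed.

Lemma avg_sum (I : finType) (F : I -> 'I_n -> R) :
  avg (fun i => \sum_j F j i) = \sum_j avg (F j).
Proof. by rewrite /avg exchange_big/= mulr_sumr. Qed.

Lemma le_avg f g : (forall i, f i <= g i) -> avg f <= avg g.
Proof. by move=> fg; rewrite /avg ler_wpM2l ?invr_ge0// ler_sum. Qed.

Lemma ler_norm_avg f : `|avg f| <= avg (fun i => `|f i|).
Proof.
by rewrite /avg normrM ger0_norm ?invr_ge0// ler_wpM2l ?invr_ge0// ler_norm_sum.
Qed.

Lemma eq_avg f g : (forall i, f i = g i) -> avg f = avg g.
Proof. by move=> fg; rewrite /avg; under eq_bigr do rewrite fg. Qed.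

Lemma avg_cst (c : R) : (0 < n)%N -> avg (fun=> c) = c.
Proof.
move=> n0; rewrite /avg sumr_const card_ord -[c *+ n]mulr_natl mulrA mulVf ?mul1r//.
by rewrite pnatr_eq0 -lt0n.
Qed.

(* Cauchy-Schwarz against an indicator, in the form of AM-GM with weight. *)
Lemma avg_indicator f (kink : 'I_n -> R) (A b w : R) : 0 < b -> 0 < w ->
  (forall i, kink i = 0 \/ kink i = 1) ->
  avg (fun i => f i ^+ 2) <= A * b ^+ 2 -> avg kink <= A * w ^+ 2 ->
  avg (fun i => `|f i| * kink i) <= A * b * w.
Proof.
move=> b0 w0 k01 fA kA.
apply: (@le_trans _ _ (avg (fun i => (w / b / 2) * f i ^+ 2 + (b / w / 2) * kink i))).
  apply: le_avg => i; case: (k01 i) => ->.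
    by rewrite !mulr0 addr0 mulr_ge0 ?sqr_ge0// !mulr_ge0 ?invr_ge0// ltW.
  rewrite !mulr1 -[f i ^+ 2]real_normK ?num_real//.
  have -> : w / b / 2 * `|f i| ^+ 2 + b / w / 2 =
      `|f i| + (w / b / 2) * (`|f i| - b / w) ^+ 2.
    by field; rewrite !gt_eqF.
  by rewrite lerDl mulr_ge0 ?sqr_ge0// !mulr_ge0 ?invr_ge0// ltW.
rewrite avgD !avgZ.
have -> : A * b * w = w / b / 2 * (A * b ^+ 2) + b / w / 2 * (A * w ^+ 2).
  by field; rewrite !gt_eqF.
by apply: lerD; rewrite ler_wpM2l// !mulr_ge0 ?invr_ge0// ltW.
Qed.

End sample_average.

(** * Averages of linear forms under an l1-bound *)

Section coordinates.
Context {R : realType} {p : nat}.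
Implicit Types (x : p.-tuple R) (w : 'rV[R]_p).

Lemma norm1_ge0 w : 0 <= norm1 w.
Proof. exact: sumr_ge0. Qed.

Lemma coord_le_norm_inf x j : `|tnth x j| <= norm_inf x.
Proof. by rewrite /norm_inf (bigD1 j)//= le_max lexx. Qed.

Lemma norm_inf_ge0 x : 0 <= norm_inf x.
Proof.
by rewrite /norm_inf; elim/big_ind : _ => // a b a0 b0; rewrite le_max a0.
Qed.

Lemma dotp_le x w : `|dotp x w| <= \sum_j `|w 0 j| * `|tnth x j|.
Proof.
by apply: le_trans (ler_norm_sum _ _ _) _; apply: ler_sum => j _; rewrite normrM mulrC.
Qed.

Lemma dotp_norm1 x w : `|dotp x w| <= norm1 w * norm_inf x.
Proof.
apply: le_trans (dotp_le x w) _; rewrite /norm1 mulr_suml.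
by apply: ler_sum => j _; rewrite ler_wpM2l// coord_le_norm_inf.
Qed.

Lemma dotpB x w w' : dotp x (w - w') = dotp x w - dotp x w'.
Proof. by rewrite /dotp -sumrB; apply: eq_bigr => j _; rewrite !mxE mulrBr. Qed.

(** Expanding the linear form and splitting each product into two squares leaves averages indexed by
    single coordinates, which a union bound controls in high dimension; the l1-norm collects the
    weights. *)
Lemma avg_dotp {n : nat} (x : 'I_n -> p.-tuple R) (y V : 'I_n -> R) (A : R) w :
  (forall i, 0 <= V i) -> (forall j, avg (fun i => tnth (x i) j ^+ 2 * V i) <= A) ->
  avg (fun i => y i ^+ 2 * V i) <= A ->
  avg (fun i => `|dotp (x i) w| * `|y i| * V i) <= norm1 w * A.
Proof.
move=> V0 xA yA.
apply: (@le_trans _ _ (avg (fun i => \sum_j `|w 0 j| *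
    (2^-1 * (tnth (x i) j ^+ 2 * V i) + 2^-1 * (y i ^+ 2 * V i))))).
  apply: le_avg => i; rewrite -mulrA.
  apply: le_trans (ler_wpM2r _ (dotp_le _ _)) _; first by rewrite mulr_ge0.
  rewrite mulr_suml; apply: ler_sum => j _; rewrite -mulrA ler_wpM2l//.
  rewrite -[tnth _ _ ^+ 2]real_normK ?num_real// -[y i ^+ 2]real_normK ?num_real//.
  have := V0 i; have : 0 <= (`|tnth (x i) j| - `|y i|) ^+ 2 by exact: sqr_ge0.
  nra.
rewrite avg_sum /norm1 mulr_suml; apply: ler_sum => j _.
rewrite avgZ ler_wpM2l// avgD !avgZ; have := xA j; lra.
Qed.

Lemma avg_dotp2 {n : nat} (x : 'I_n -> p.-tuple R) (V : 'I_n -> R) (A : R) w w' :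
  (forall i, 0 <= V i) -> (forall j, avg (fun i => tnth (x i) j ^+ 2 * V i) <= A) ->
  avg (fun i => `|dotp (x i) w| * `|dotp (x i) w'| * V i) <= norm1 w * norm1 w' * A.
Proof.
move=> V0 xA.
apply: (@le_trans _ _ (avg (fun i => \sum_j `|w' 0 j| *
    (`|dotp (x i) w| * `|tnth (x i) j| * V i)))).
  apply: le_avg => i; rewrite mulrAC mulrC.
  apply: le_trans (ler_wpM2r _ (dotp_le _ w')) _; first by rewrite mulr_ge0.
  by rewrite mulr_suml; apply: ler_sum => j _; rewrite le_eqVlt; apply/orP; left; apply/eqP; ring.
rewrite avg_sum (_ : norm1 w * norm1 w' * A = \sum_j `|w' 0 j| * (norm1 w * A)).
  by apply: ler_sum => j _; rewrite avgZ ler_wpM2l//; exact: avg_dotp.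
by rewrite -mulr_suml -/(norm1 w'); ring.
Qed.

(** The premise is restricted to the support of [w] because the averages of [g v X_j] are centered
    only for the coordinates of W, and padded vectors vanish at the coordinate of D. *)
Lemma dotp_sample_avg {n : nat} (x : 'I_n -> p.-tuple R) (y : 'I_n -> R) (c : R) w :
  (forall j, w 0 j != 0 -> `|avg (fun i => y i * tnth (x i) j)| <= c) ->
  `|avg (fun i => y i * dotp (x i) w)| <= norm1 w * c.
Proof.
move=> yc.
have -> : avg (fun i => y i * dotp (x i) w) =
    \sum_j w 0 j * avg (fun i => y i * tnth (x i) j).
  under [RHS]eq_bigr do rewrite -avgZ.
  rewrite -avg_sum; apply: eq_avg => i; rewrite /dotp mulr_sumr.
  by apply: eq_bigr => j _; ring.
apply: le_trans (ler_norm_sum _ _ _) _; rewrite /norm1 mulr_suml.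
apply: ler_sum => j _; rewrite normrM.
have [->|wj] := eqVneq (w 0 j) 0; first by rewrite normr0 !mul0r.
by rewrite ler_wpM2l// yc.
Qed.

End coordinates.

Section embedding.
Context {R : realType} {k : nat}.
Implicit Types (x : k.+1.-tuple R) (w : 'rV[R]_k) (u : 'rV[R]_k.+1).

(** Places the coefficients of W among those of X, so that linear forms in W inherit the bounds
    proved for [dotp]. *)
Definition pad0 w : 'rV[R]_k.+1 := \row_j (if unlift ord0 j is Some i then w 0 i else 0).

Definition tail_row u : 'rV[R]_k := \row_j u 0 (lift ord0 j).

Lemma pad00 w : pad0 w 0 ord0 = 0.
Proof. by rewrite mxE unlift_none. Qed.

Lemma pad0_lift w j : pad0 w 0 (lift ord0 j) = w 0 j.
Proof. by rewrite mxE liftK. Qed.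

Lemma dotp_pad0 x w : dotp x (pad0 w) = \sum_j regW x j * w 0 j.
Proof.
rewrite /dotp big_ord_recl pad00 mulr0 add0r.
by apply: eq_bigr => j _; rewrite pad0_lift.
Qed.

Lemma norm1_pad0 w : norm1 (pad0 w) = norm1 w.
Proof.
rewrite /norm1 big_ord_recl pad00 normr0 add0r.
by apply: eq_bigr => j _; rewrite pad0_lift.
Qed.

Lemma norm1_tail u : norm1 (tail_row u) <= norm1 u.
Proof.
rewrite /norm1 [leRHS]big_ord_recl ler_wpDl//.
by apply: ler_sum => j _; rewrite mxE.
Qed.

Lemma dotp_split x u : dotp x u = regD x * u 0 ord0 + dotp x (pad0 (tail_row u)).
Proof.
rewrite dotp_pad0 /dotp big_ord_recl; congr (_ + _).
by apply: eq_bigr => j _; rewrite mxE.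
Qed.

Lemma residE x w : resid x w = regD x - dotp x (pad0 w).
Proof. by rewrite dotp_pad0. Qed.

End embedding.

(** * Linearization of numerator and denominator of step 3 *)

Section debiased_expansion.
Context {R : realType} {n k : nat}.
Variables (x : 'I_n -> k.+1.-tuple R) (M1 M2 e g v kink : 'I_n -> R).
Variables (delta : 'rV[R]_k.+1) (eta : 'rV[R]_k).
Variables (Cm A B al l w kap : R).
Hypotheses (Cm0 : 0 < Cm) (A0 : 0 < A) (B0 : 0 < B) (al0 : 0 <= al) (l0 : 0 <= l)
  (w0 : 0 < w).
Hypothesis delta_al : norm1 delta <= al.
Hypothesis eta_al : norm1 eta <= al.

Let D i := regD (x i).
Let dX i := dotp (x i) delta.
Let dW i := dotp (x i) (pad0 (tail_row delta)).
Let hW i := dotp (x i) (pad0 eta).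
Let u i := v i - hW i.

Hypothesis kink01 : forall i, kink i = 0 \/ kink i = 1.
Hypothesis M1_exp : forall i,
  `|M1 i - e i - dX i * M2 i| <= Cm * dX i ^+ 2 + 2 * Cm * (`|dX i| * kink i).
Hypothesis M2_exp : forall i, `|M2 i - g i| <= Cm * `|dX i| + 2 * Cm * kink i.
Hypothesis M2_le : forall i, `|M2 i| <= Cm.
Hypothesis small_X : forall i, al * norm_inf (x i) <= 1.
Hypothesis score : forall j, `|avg (fun i => e i * tnth (x i) j)| <= A * l.
Hypothesis ortho : forall j : 'I_k,
  `|avg (fun i => g i * v i * tnth (x i) (lift ord0 j))| <= A * l.
Hypothesis hessian : `|avg (fun i => g i * v i * D i) - kap| <= A * l.
Hypothesis quad : forall j, avg (fun i => tnth (x i) j ^+ 2 * (1 + `|v i|)) <= A.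
Hypothesis quadB : avg (fun i => (norm_inf (x i) * (1 + `|v i|)) ^+ 2) <= A * B ^+ 2.
Hypothesis quadD : avg (fun i => (v i * D i) ^+ 2) <= A.
Hypothesis kink_le : avg kink <= A * w ^+ 2.

Let V i := 1 + `|v i|.
Let V0 i : 0 <= V i. Proof. by rewrite addr_ge0. Qed.
Let V1 i : 1 <= V i. Proof. by rewrite lerDl. Qed.
Let vV i : `|v i| <= V i. Proof. by rewrite lerDr. Qed.
Let k0 i : 0 <= kink i. Proof. by case: (kink01 i) => ->. Qed.

Let tail_al : norm1 (pad0 (tail_row delta)) <= al.
Proof. by rewrite norm1_pad0 (le_trans (norm1_tail _)). Qed.

Let pad_al : norm1 (pad0 eta) <= al.
Proof. by rewrite norm1_pad0. Qed.

Let u_le i : `|u i| <= V i.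
Proof.
rewrite (le_trans (ler_normB _ _))// addrC lerD2r.
rewrite (le_trans (dotp_norm1 _ _))// (le_trans _ (small_X i))//.
by rewrite ler_wpM2r// norm_inf_ge0.
Qed.

Let kink_part z : norm1 z <= al ->
  avg (fun i => `|dotp (x i) z| * V i * kink i) <= al * (A * B * w).
Proof.
move=> zal.
apply: (@le_trans _ _ (avg (fun i => al * (`|norm_inf (x i) * V i| * kink i)))).
  apply: le_avg => i; rewrite mulrA ler_wpM2r//.
  have nV : 0 <= norm_inf (x i) * V i by rewrite mulr_ge0 ?norm_inf_ge0.
  rewrite (ger0_norm nV) mulrA ler_wpM2r//.
  by rewrite (le_trans (dotp_norm1 _ _))// ler_wpM2r// norm_inf_ge0.
by rewrite avgZ ler_wpM2l//; apply: avg_indicator.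
Qed.

Let quad_part z z' : norm1 z <= al -> norm1 z' <= al ->
  avg (fun i => `|dotp (x i) z| * `|dotp (x i) z'| * V i) <= al ^+ 2 * A.
Proof.
move=> zal zal'; apply: le_trans (avg_dotp2 _ _ V0 quad) _.
by rewrite expr2 ler_wpM2r ?(ltW A0)// ler_pM ?norm1_ge0.
Qed.

(* With [M1] and [M2] the derivatives of the loss at the estimate, this is the
   error of linearizing the numerator of step 3; [kink] marks the observations
   for which a knot separates the two linear predictors. *)
Definition debias_remainder : R :=
  avg (fun i => M1 i * u i) - avg (fun i => e i * v i)
  - avg (fun i => M2 i * u i * D i) * delta 0 ord0.

(** The D-part of [dX] cancels against the denominator times the error of the first coefficient. Of
    the rest, [r1] and [r3] pair centered averages with l1-errors; [r2] and [r4] are Taylor errors,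
    each with a quadratic part and a knot part; [r5] is a product of two errors. Hence the factors
    2, 3 and 4. *)
Lemma debias_remainder_le : `|debias_remainder| <=
  2 * al * A * l + 3 * Cm * (al ^+ 2 * A) + 4 * Cm * (al * (A * B * w)).
Proof.
pose r1 := avg (fun i => e i * hW i).
pose r2 := avg (fun i => (M1 i - e i - dX i * M2 i) * u i).
pose r3 := avg (fun i => g i * v i * dW i).
pose r4 := avg (fun i => (M2 i - g i) * v i * dW i).
pose r5 := avg (fun i => M2 i * hW i * dW i).
have E : avg (fun i => M1 i * u i) = avg (fun i => e i * v i) + (-1) * r1 + r2 +
    delta 0 ord0 * avg (fun i => M2 i * u i * D i) + r3 + r4 + (-1) * r5.
  rewrite /r1 /r2 /r3 /r4 /r5 -!avgZ -!avgD; apply: eq_avg => i.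
  by rewrite /dX dotp_split -/(dW i) -/(D i) /u; ring.
have -> : debias_remainder = - r1 + r2 + r3 + r4 - r5.
  by rewrite /debias_remainder E; ring.
have b1 : `|r1| <= al * (A * l).
  apply: le_trans (@dotp_sample_avg _ _ _ x e (A * l) (pad0 eta) _) _ => //.
  by rewrite ler_wpM2r// mulr_ge0// ltW.
have b3 : `|r3| <= al * (A * l).
  apply: le_trans (@dotp_sample_avg _ _ _ x (fun i => g i * v i) (A * l) _ _) _.
    move=> j; case: (unliftP ord0 j) => [j'|] -> //.
    by rewrite pad00 eqxx.
  by rewrite ler_wpM2r// mulr_ge0// ltW.
have b2 : `|r2| <= Cm * (al ^+ 2 * A) + 2 * Cm * (al * (A * B * w)).
  apply: le_trans (ler_norm_avg _) _.
  apply: (@le_trans _ _ (avg (fun i => Cm * (`|dX i| * `|dX i| * V i)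
      + 2 * Cm * (`|dX i| * V i * kink i)))).
    apply: le_avg => i; rewrite normrM.
    apply: le_trans (ler_pM _ _ (M1_exp i) (u_le i)) _ => //.
    rewrite -[dX i ^+ 2]real_normK ?num_real// le_eqVlt; apply/orP; left; apply/eqP; ring.
  rewrite avgD !avgZ lerD// ler_wpM2l//; [exact: ltW|exact: quad_part| |exact: kink_part].
  by rewrite mulr_ge0// ltW.
have b4 : `|r4| <= Cm * (al ^+ 2 * A) + 2 * Cm * (al * (A * B * w)).
  apply: le_trans (ler_norm_avg _) _.
  apply: (@le_trans _ _ (avg (fun i => Cm * (`|dX i| * `|dW i| * V i)
      + 2 * Cm * (`|dW i| * V i * kink i)))).
    apply: le_avg => i; rewrite !normrM -mulrA.
    have h : `|v i| * `|dW i| <= V i * `|dW i| by rewrite ler_wpM2r.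
    apply: le_trans (ler_pM _ _ (M2_exp i) h) _ => //.
    by rewrite le_eqVlt; apply/orP; left; apply/eqP; ring.
  rewrite avgD !avgZ lerD// ler_wpM2l//; [exact: ltW|exact: quad_part| |exact: kink_part].
  by rewrite mulr_ge0// ltW.
have b5 : `|r5| <= Cm * (al ^+ 2 * A).
  apply: le_trans (ler_norm_avg _) _.
  apply: (@le_trans _ _ (avg (fun i => Cm * (`|hW i| * `|dW i| * V i)))).
    apply: le_avg => i; rewrite !normrM -mulrA ler_pM ?mulr_ge0//.
    by rewrite ler_peMr// mulr_ge0.
  by rewrite avgZ ler_wpM2l//; [exact: ltW|exact: quad_part].
move: b1 b2 b3 b4 b5; rewrite !ler_norml => *; lra.
Qed.

(** This error gets multiplied by the normalized sum, which is bounded in probability, and not by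
    sqrt n. Bounds of first order in [al] and [w] are therefore enough. *)
Lemma debias_denominator_le :
  `|avg (fun i => M2 i * u i * D i) - kap| <=
  A * l + 2 * Cm * (al * A) + 2 * Cm * (A * w).
Proof.
pose r1 := avg (fun i => (M2 i - g i) * v i * D i).
pose r2 := avg (fun i => M2 i * hW i * D i).
have E : avg (fun i => M2 i * u i * D i) =
    avg (fun i => g i * v i * D i) + r1 + (-1) * r2.
  by rewrite /r1 /r2 -!avgZ -!avgD; apply: eq_avg => i; rewrite /u; ring.
have -> : avg (fun i => M2 i * u i * D i) - kap =
    (avg (fun i => g i * v i * D i) - kap) + r1 - r2 by rewrite E; ring.
have part z : norm1 z <= al -> avg (fun i => `|dotp (x i) z| * `|D i| * V i) <= al * A.
  move=> zal; apply: le_trans (@avg_dotp _ _ _ x D V A z V0 quad _) _.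
    exact: quad.
  by rewrite ler_wpM2r// ltW.
have b1 : `|r1| <= Cm * (al * A) + 2 * Cm * (A * w).
  apply: le_trans (ler_norm_avg _) _.
  apply: (@le_trans _ _ (avg (fun i => Cm * (`|dX i| * `|D i| * V i)
      + 2 * Cm * (`|v i * D i| * kink i)))).
    apply: le_avg => i; rewrite !normrM -mulrA.
    apply: le_trans (ler_wpM2r _ (M2_exp i)) _; first by rewrite mulr_ge0.
    rewrite mulrDl lerD//; last by rewrite le_eqVlt; apply/orP; left; apply/eqP; ring.
    rewrite -[leLHS]mulrA ler_wpM2l ?(ltW Cm0)// -[leRHS]mulrA ler_wpM2l// mulrC ler_wpM2l//.
  rewrite avgD !avgZ lerD// ler_wpM2l//; [exact: ltW|exact: part| |].
    by rewrite mulr_ge0// ltW.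
  rewrite -[A]mulr1; apply: avg_indicator => //; first by rewrite expr1n mulr1.
have b2 : `|r2| <= Cm * (al * A).
  apply: le_trans (ler_norm_avg _) _.
  apply: (@le_trans _ _ (avg (fun i => Cm * (`|hW i| * `|D i| * V i)))).
    apply: le_avg => i; rewrite !normrM -mulrA ler_pM ?mulr_ge0//.
    by rewrite ler_peMr// mulr_ge0.
  by rewrite avgZ ler_wpM2l//; [exact: ltW|exact: part].
move: b1 b2 hessian; rewrite !ler_norml => *; lra.
Qed.

End debiased_expansion.

(** * Population moments *)

Section moment_products.
Context {R : realType} {d : measure_display} {T : measurableType d}.
Variable P : probability T R.

(** Replacing the smaller base by the larger one leaves its power [p + q], which is at most 1 or at
    most its power [rho]. *)
Lemma powR_young (a b p q rho : R) : 0 < a -> 0 < b -> 0 <= p -> 0 <= q ->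
  p + q <= rho -> a `^ p * b `^ q <= 1 + a `^ rho + b `^ rho.
Proof.
move=> a0 b0 p0 q0 pq.
have rho0 : 0 <= rho by lra.
wlog ab : a b p q a0 b0 p0 q0 pq / a <= b.
  move=> H; have [ab|/ltW ba] := leP a b; first exact: H.
  by rewrite mulrC addrAC; apply: H => //; rewrite addrC.
apply: (@le_trans _ _ (b `^ (p + q))).
  rewrite powRD; last by rewrite (gt_eqF b0) implybT.
  by rewrite ler_wpM2r ?powR_ge0// ge0_ler_powR ?nnegrE// ltW.
have [b1|/ltW b1] := leP b 1.
  apply: (@le_trans _ _ 1); last by rewrite -addrA lerDl addr_ge0 ?powR_ge0.
  have : b `^ (p + q) <= b `^ 0 by apply: ger_powR; rewrite ?b0 ?addr_ge0.
  by rewrite powRr0.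
by rewrite (le_trans (ler_powR b1 pq))// lerDr addr_ge0 ?powR_ge0.
Qed.

Lemma measurable_powRr (f : T -> R) p : measurable_fun setT f ->
  measurable_fun setT (fun x => f x `^ p).
Proof. by move=> mf; apply: (@measurableT_comp _ _ _ _ _ _ (fun x => x `^ p) _ f). Qed.

Lemma mean_le_young (f g : T -> R) (p q rho C : R) :
  measurable_fun setT f -> measurable_fun setT g ->
  (forall x, 0 < f x) -> (forall x, 0 < g x) -> 0 <= p -> 0 <= q -> p + q <= rho ->
  mean_le P (fun x => f x `^ rho) C -> mean_le P (fun x => g x `^ rho) C ->
  mean_le P (fun x => f x `^ p * g x `^ q) (1 + 2 * C).
Proof.
move=> mf mg f0 g0 p0 q0 pq fC gC.
have := mean_leD (mean_leD (mean_le_cst P 1) fC) gC.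
rewrite normr1 mulr_natl mulr2n addrA; apply: le_mean_le => [|x].
  by apply: measurable_funM; exact: measurable_powRr.
rewrite ger0_norm ?mulr_ge0 ?powR_ge0//.
rewrite [leRHS]ger0_norm ?addr_ge0 ?powR_ge0//.
exact: powR_young.
Qed.

Lemma mean_le_one_plus (f : T -> R) (rho r c : R) : measurable_fun setT f ->
  0 <= rho <= r -> mean_le P (fun x => `|f x| `^ r) c ->
  mean_le P (fun x => (1 + `|f x|) `^ rho) (2 `^ rho * (1 + c)).
Proof.
move=> mf /andP[rho0 rhor] fc.
have := mean_leZ (2 `^ rho) (mean_leD (mean_le_cst P 1) fc).
rewrite normr1 ger0_norm ?powR_ge0//; apply: le_mean_le => [|x].
  apply: measurable_powRr; apply: measurable_funD => //.
  exact: measurableT_comp.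
rewrite (ger0_norm (powR_ge0 _ _)) [leRHS]ger0_norm; last first.
  by rewrite mulr_ge0 ?powR_ge0// addr_ge0 ?powR_ge0.
rewrite /=; have t0 := normr_ge0 (f x); move: `|f x| t0 => t t0.
have [t1|/ltW t1] := leP t 1.
  apply: (@le_trans _ _ (2 `^ rho)).
    by apply: ge0_ler_powR; rewrite ?nnegrE ?addr_ge0//; lra.
  by rewrite ler_peMr ?powR_ge0// lerDl powR_ge0.
apply: (@le_trans _ _ ((2 * t) `^ rho)).
  by apply: ge0_ler_powR; rewrite ?nnegrE ?addr_ge0 ?mulr_ge0//; lra.
rewrite powRM// ler_wpM2l ?powR_ge0// (le_trans (ler_powR t1 rhor))//.
by rewrite lerDr.
Qed.

Lemma Lnorm_mean_le (f : T -> R) (p C : R) : 0 < p -> 0 <= C ->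
  measurable_fun setT f -> ('N[P]_(p%:E)[(fun z => (f z)%:E)] <= C%:E)%E ->
  mean_le P (fun x => `|f x| `^ p) (C `^ p).
Proof.
move=> p0 C0 mf fC; split.
  by apply: measurable_powRr; exact: measurableT_comp.
have E : ('N[P]_(p%:E)[(fun z => (f z)%:E)] `^ p)%E = (\int[P]_x (`|f x| `^ p)%:E)%E.
  by apply: poweR_Lnorm; rewrite gt_eqF.
under eq_integral do rewrite ger0_norm ?powR_ge0//.
rewrite -E -poweR_EFin.
apply: gt0_ler_poweR => //; first exact: ltW.
- by rewrite in_itv/= Lnorm_ge0 leey.
- by rewrite in_itv/= lee_fin C0 leey.
Qed.

End moment_products.

Section second_moments.
Context {R : realType} {d : measure_display} {T : measurableType d}.
Variable P : probability T R.

Lemma mean_le_mul2 (f g : T -> R) a b : measurable_fun setT f -> measurable_fun setT g ->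
  mean_le P (fun x => f x ^+ 2) a -> mean_le P (fun x => g x ^+ 2) b ->
  mean_le P (fun x => f x * g x) (a + b).
Proof.
move=> mf mg fa gb; apply: le_mean_le (mean_leD fa gb) => [|x].
  exact: measurable_funM.
rewrite normrM [leRHS]ger0_norm ?addr_ge0 ?sqr_ge0//.
rewrite -[f x ^+ 2]real_normK ?num_real// -[g x ^+ 2]real_normK ?num_real//.
have : 0 <= (`|f x| - `|g x|) ^+ 2 by exact: sqr_ge0.
have := sqr_ge0 `|f x|; have := sqr_ge0 `|g x|; nra.
Qed.

Lemma mean_le_sqr_sum (I : Type) (s : seq I) (f : I -> T -> R) c :
  (forall i, measurable_fun setT (f i)) -> (forall i, mean_le P (fun x => f i x ^+ 2) c) ->
  exists c', mean_le P (fun x => (\sum_(i <- s) f i x) ^+ 2) c'.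
Proof.
move=> mf fc; elim: s => [|i s [c' ih]].
  exists 0; under eq_fun do rewrite big_nil expr0n/=.
  by have := mean_le_cst P 0; rewrite normr0.
exists (2 * c + 2 * c'); have := mean_leD (mean_leZ 2 (fc i)) (mean_leZ 2 ih).
rewrite normr_nat; apply: le_mean_le => [|x].
  by apply: measurable_funX; exact: measurable_sum.
rewrite big_cons; set a := f i x; set b := \sum_(_ <- _) _.
rewrite [leLHS]ger0_norm ?sqr_ge0// [leRHS]ger0_norm; last first.
  by rewrite addr_ge0// mulr_ge0// sqr_ge0.
have : 0 <= (a - b) ^+ 2 by exact: sqr_ge0.
nra.
Qed.

Lemma mean_le_sqr (f : T -> R) (r c : R) : measurable_fun setT f -> 2 <= r ->
  mean_le P (fun x => `|f x| `^ r) c -> mean_le P (fun x => f x ^+ 2) (1 + c).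
Proof.
move=> mf r2 fc; have := mean_leD (mean_le_cst P 1) fc; rewrite normr1.
apply: le_mean_le => [|x]; first exact: measurable_funX.
rewrite normrX [leRHS]ger0_norm ?addr_ge0 ?powR_ge0//=.
have [f1|/ltW f1] := leP `|f x| 1.
  apply: (@le_trans _ _ 1); last by rewrite lerDl powR_ge0.
  by rewrite expr_le1.
by rewrite -powR_mulrn// (le_trans (ler_powR f1 r2))// lerDr.
Qed.

End second_moments.

(** A small step against the sign of [a] makes the linear term outweigh the quadratic one. The step
    [h] is cut off so that [h * b] stays below the absolute value of [a]. *)
Lemma linear_dominated_eq0 {R : realFieldType} (a b h0 : R) : 0 < h0 -> 0 <= b ->
  (forall h, `|h| < h0 -> 0 <= h * a + h ^+ 2 * b) -> a = 0.
Proof.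
move=> h00 b0 H; apply/eqP; rewrite -normr_le0 leNgt; apply/negP => a0.
pose h := Num.min (h0 / 2) (`|a| / (2 * (b + 1))).
have b1 : 0 < 2 * (b + 1) by lra.
have h_gt0 : 0 < h by rewrite lt_min !divr_gt0.
have hh0 : h < h0 by rewrite gt_min; apply/orP; left; lra.
have hb : h * b < `|a|.
  apply: (@le_lt_trans _ _ (`|a| / (2 * (b + 1)) * b)).
    by rewrite ler_wpM2r// ge_min lexx orbT.
  by rewrite mulrAC ltr_pdivrMr// ltr_pM2l//; lra.
have := H (- Num.sg a * h); rewrite normrM normrN normr_sg gtr0_norm//.
have a_neq0 : a != 0 by rewrite -normr_gt0.
rewrite a_neq0 mul1r => /(_ hh0).
have -> : - Num.sg a * h * a + (- Num.sg a * h) ^+ 2 * b =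
   h * (h * b * Num.sg a ^+ 2 - `|a|) by rewrite [in RHS]normrEsg; ring.
rewrite sqr_sg a_neq0 mulr1 pmulr_rge0// subr_ge0.
by rewrite leNgt hb.
Qed.

(** * First-order condition, orthogonality and curvature *)

Section population.
Context {R : realType} {k : nat} {d : measure_display} {Y : measurableType d}.
Local Notation X := (k.+1.-tuple R).
Local Notation T := (X * Y)%type.
Variables (P : probability T R) (m : R -> Y -> R).
Variables (calX : set X) (Theta : set 'rV[R]_k.+1).
Variables (theta0 : 'rV[R]_k.+1) (mu0 : 'rV[R]_k).
Variables (cM : R) (cM' : \bar R) (CM r' Cm : R) (J : nat) (t : Y -> nat -> \bar R).
Hypothesis Hset : setting P m calX Theta theta0.
Hypothesis Hmu0 : is_mu0 P m theta0 mu0.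
Hypothesis Hpar : parameter_space Theta theta0.
Hypothesis Hdiff : differentiability_integrability P m Theta.
Hypotheses (cM0 : 0 < cM) (cM'0 : (0 < cM')%E).
Hypothesis Hmar : margin P m Theta theta0 cM cM'.
Hypotheses (CM0 : 0 < CM) (r'4 : 4 < r').
Hypothesis Hint : integrability P m theta0 mu0 CM r'.
Hypothesis Cm0 : 0 < Cm.
Hypothesis Hsm : higher_order_smoothness P m theta0 Cm J t.

Let mm : measurable_fun [set: R * Y] (fun u => m u.1 u.2). Proof. by case: Hset. Qed.

Let dm (y : Y) (s : R) : derivable (fun u => m u y : R^o) s 1.
Proof. by case: Hsm => _ /(_ y)[H _] _ _; exact: H. Qed.

Definition score_fun (z : T) : R := m1 m (dotp z.1 theta0) z.2.
Definition resid_fun (z : T) : R := resid z.1 mu0.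
Definition hess_fun : T -> R := m11_proxy m Cm theta0.

Lemma measurable_score : measurable_fun setT score_fun.
Proof.
have := @measurable_m1 _ _ _ _ _ mm dm theta0 (cst 0) (@measurable_cst _ _ _ _ _ _).
by under eq_fun do rewrite addr0.
Qed.

Lemma measurable_hess : measurable_fun setT hess_fun.
Proof. exact: measurable_m11_proxy. Qed.

Lemma hess_le z : `|hess_fun z| <= Cm.
Proof. by apply: m11_proxy_le; exact: ltW. Qed.

Let mresid : measurable_fun setT resid_fun. Proof. exact: measurable_resid. Qed.

Lemma score_moment : mean_le P (fun z => `|score_fun z| `^ r') (CM `^ r').
Proof.
case: Hint => _ _ H; apply: Lnorm_mean_le (ltW CM0) measurable_score H.
exact: lt_trans r'4.
Qed.

Lemma resid_moment : mean_le P (fun z => `|resid_fun z| `^ r') (CM `^ r').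
Proof.
case: Hint => _ H _; apply: Lnorm_mean_le (ltW CM0) mresid H.
exact: lt_trans r'4.
Qed.

Lemma coord_moment j : mean_le P (fun z => `|tnth z.1 j| `^ r') (CM `^ r').
Proof.
case: Hint => /(_ j) H _ _; apply: Lnorm_mean_le (ltW CM0) (measurable_coord j) H.
exact: lt_trans r'4.
Qed.

Let r'2 : 2 <= r'. Proof. by apply/ltW/(lt_trans _ r'4); rewrite ltr_nat. Qed.

Let score_sqr := mean_le_sqr measurable_score r'2 score_moment.
Let resid_sqr := mean_le_sqr mresid r'2 resid_moment.
Let coord_sqr j := mean_le_sqr (measurable_coord j) r'2 (coord_moment j).

Lemma dotp_sqr w : exists c, mean_le P (fun z : T => dotp z.1 w ^+ 2) c.
Proof.
pose c0 := (\sum_j `|w 0 j|) ^+ 2 * (1 + CM `^ r').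
have := @mean_le_sqr_sum _ _ _ P _ (enum 'I_k.+1) (fun j (z : T) => tnth z.1 j * w 0 j) c0.
case=> [j|j|c' H].
- by apply: measurable_funM => //; exact: measurable_coord.
- apply: (@mean_leW _ _ _ _ _ (w 0 j ^+ 2 * (1 + CM `^ r'))).
    rewrite /c0 ler_wpM2r ?addr_ge0 ?powR_ge0// -[w 0 j ^+ 2]real_normK ?num_real//.
    rewrite ler_pXn2r ?nnegrE ?sumr_ge0// (bigD1 j)//= lerDl sumr_ge0//.
  have := mean_leZ (w 0 j ^+ 2) (coord_sqr j); rewrite ger0_norm ?sqr_ge0//.
  by under eq_fun do rewrite mulrC -exprMn.
- exists c'; move: H; congr mean_le; apply/funext => z.
  by rewrite big_enum.
Qed.

Let loss_integrable theta : Theta theta ->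
  P.-integrable setT (EFin \o (fun z => m (dotp z.1 theta) z.2)).
Proof.
move=> /Hdiff[_]; rewrite unlock => H; apply/integrableP; split=> //.
apply/measurable_EFinP.
have := @measurable_loss _ _ _ _ _ mm theta (cst 0) (@measurable_cst _ _ _ _ _ _).
by under eq_fun do rewrite addr0.
Qed.

Let dotpDZ (x : X) w h : dotp x (theta0 + h *: w) = dotp x theta0 + h * dotp x w.
Proof.
rewrite /dotp mulr_sumr -big_split/=; apply: eq_bigr => j _.
by rewrite !mxE; ring.
Qed.

Let Theta_near w : exists2 h0 : R, 0 < h0 & forall h, `|h| < h0 -> Theta (theta0 + h *: w).
Proof.
case: Hpar => _ _; rewrite /interior => /nbhs_ballP[e /= e0 H].
have n1 : 0 < 1 + norm1 w by rewrite ltr_wpDr ?norm1_ge0.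
exists (e / (1 + norm1 w)); first exact: divr_gt0.
move=> h hh; apply: H; split=> // i j; rewrite !ord1 /ball/=.
rewrite !mxE opprD addrA subrr sub0r normrN normrM.
apply: (@le_lt_trans _ _ (`|h| * (1 + norm1 w))).
  rewrite ler_wpM2l// /norm1 (bigD1 j)//= addrCA lerDl addr_ge0// sumr_ge0//.
by rewrite -ltr_pdivlMr.
Qed.

Let theta0_in : Theta theta0.
Proof.
have [h0 h00 H] := Theta_near 0; have := H 0; rewrite normr0 => /(_ h00).
by rewrite scale0r addr0.
Qed.

Let increment w h (z : T) := m (dotp z.1 theta0 + h * dotp z.1 w) z.2 - m (dotp z.1 theta0) z.2.

Let increment_integrable w h : Theta (theta0 + h *: w) ->
  P.-integrable setT (EFin \o increment w h).
Proof.
move=> /loss_integrable i1; have i0 := loss_integrable theta0_in.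
have := integrable_addr i1 (mean_le_integrable (mean_leZ (-1) (Rintegral_mean_le i0))).
by under eq_fun do rewrite dotpDZ mulN1r.
Qed.

Let incrementE w h : Theta (theta0 + h *: w) ->
  \int[P]_z increment w h z = \int[P]_z m (dotp z.1 (theta0 + h *: w)) z.2
   - \int[P]_z m (dotp z.1 theta0) z.2.
Proof.
move=> Hth; have i0 := loss_integrable theta0_in.
rewrite -RintegralB//; last exact: loss_integrable.
by apply: eq_Rintegral => z _; rewrite dotpDZ.
Qed.

Let increment_ge0 w h : Theta (theta0 + h *: w) -> 0 <= \int[P]_z increment w h z.
Proof.
move=> Hth; rewrite incrementE// subr_ge0.
case: Hset => _ _ [_ /(_ _ Hth)]; rewrite unlock => H.
by apply: fine_le => //; apply: integrable_fin_num => //; exact: loss_integrable.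
Qed.

Let score_dotp_integrable w :
  P.-integrable setT (EFin \o (fun z : T => score_fun z * dotp z.1 w)).
Proof.
have [c wc] := dotp_sqr w.
exact: mean_le_integrable (mean_le_mul2 measurable_score (measurable_dotp w) score_sqr wc).
Qed.

Let taylor1 w h (z : T) :
  `|increment w h z - h * dotp z.1 w * score_fun z| <= Cm * (h * dotp z.1 w) ^+ 2.
Proof.
have [H1 H2 H3 _] := Hsm; have [_ H2'] := H2 z.2.
exact: (m_taylor1 (H1 z.2) (@dm z.2) H2' Cm0 (H3 z.2)).
Qed.

(** Minimality makes the mean increment nonnegative for small steps in both directions along [w],
    and its linear part differs from it by at most [Cm * c * h ^+ 2]. This replaces differentiation
    under the integral. *)
Lemma first_order_condition w : \int[P]_z (score_fun z * dotp z.1 w) = 0.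
Proof.
have [c wc] := dotp_sqr w.
have [h0 h00 H] := Theta_near w.
have c0 := mean_le_ge0 wc.
apply: (@linear_dominated_eq0 _ _ (Cm * c) h0) => // [|h hh].
  by rewrite mulr_ge0// ltW.
apply: le_trans (increment_ge0 (H h hh)) _.
have -> : h * \int[P]_z (score_fun z * dotp z.1 w) + h ^+ 2 * (Cm * c) =
    h * \int[P]_z (score_fun z * dotp z.1 w) + (h ^+ 2 * Cm) * c by ring.
rewrite -lerBlDl -RintegralZl// -RintegralB//; last 2 first.
- exact: increment_integrable (H h hh).
- exact: mean_le_integrable (mean_leZ h (Rintegral_mean_le (score_dotp_integrable w))).
apply: le_trans (ler_norm _) _; apply: mean_le_Rintegral.
have hC0 : 0 <= h ^+ 2 * Cm by apply: mulr_ge0; [exact: sqr_ge0|exact: ltW].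
have := mean_leZ (h ^+ 2 * Cm) wc; rewrite (ger0_norm hC0).
apply: le_mean_le => [|z].
  apply: measurable_funB.
    by have /integrableP[/measurable_EFinP] := increment_integrable (H h hh).
  apply: measurable_funM => //.
  by have /integrableP[/measurable_EFinP] := score_dotp_integrable w.
rewrite [leRHS]ger0_norm; last by apply: mulr_ge0 => //; exact: sqr_ge0.
have -> : h ^+ 2 * Cm * dotp z.1 w ^+ 2 = Cm * (h * dotp z.1 w) ^+ 2 by ring.
have -> : h * (score_fun z * dotp z.1 w) = h * dotp z.1 w * score_fun z by ring.
exact: taylor1.
Qed.

Let w0 : 'rV[R]_k.+1 := \row_j (if unlift ord0 j is Some i then - mu0 0 i else 1).

Let dotp_w0 (x : X) : dotp x w0 = resid x mu0.
Proof.
rewrite /dotp big_ord_recl mxE unlift_none mulr1 /resid; congr (_ + _).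
by rewrite -sumrN; apply: eq_bigr => j _; rewrite mxE liftK mulrN.
Qed.

Lemma score_resid_mean : \int[P]_z (score_fun z * resid_fun z) = 0.
Proof.
by under eq_Rintegral do rewrite /resid_fun -dotp_w0; exact: first_order_condition.
Qed.

Lemma hess_ae : {ae P, forall z, hess_fun z = m11 m (dotp z.1 theta0) z.2}.
Proof.
have [H1 H2 H3 H4] := Hsm; apply: filterS H4 => z hz.
have [_ H2'] := H2 z.2; apply: m11_proxyE => //.
exact: (m11_le (H1 z.2) H2' Cm0 (H3 z.2)).
Qed.

Let hess_dotp_le w : exists c, mean_le P (fun z : T => hess_fun z * resid_fun z * dotp z.1 w) c.
Proof.
have [c wc] := dotp_sqr w.
have h := mean_le_mul2 mresid (measurable_dotp w) resid_sqr wc.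
exists (Cm * (1 + CM `^ r' + c)).
have := mean_leM_bounded h measurable_hess hess_le; rewrite (gtr0_norm Cm0).
by under eq_fun do rewrite mulrC mulrA.
Qed.

Lemma dotp_delta (x : X) (j : 'I_k.+1) : dotp x (delta_mx 0 j) = tnth x j.
Proof.
rewrite /dotp (bigD1 j)//= mxE !eqxx mulr1 big1 ?addr0// => i ij.
by rewrite mxE (negbTE ij) andbF mulr0.
Qed.

Lemma hess_coord_integrable j :
  P.-integrable setT (EFin \o (fun z : T => hess_fun z * resid_fun z * tnth z.1 j)).
Proof.
have [c /mean_le_integrable] := hess_dotp_le (delta_mx 0 j).
by under eq_fun do rewrite dotp_delta.
Qed.

Lemma hess_orthogonal (j : 'I_k) :
  \int[P]_z (hess_fun z * resid_fun z * tnth z.1 (lift ord0 j)) = 0.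
Proof.
have := Hmu0 j; rewrite unlock => H; rewrite /Rintegral.
rewrite (@integral_ae_eq_nonmeasurable _ _ _ _ _ (fun z : T => (m11 m (dotp z.1 theta0) z.2 *
  resid z.1 mu0 * regW z.1 j)%:E)) ?H//.
by apply: filterS hess_ae => z ->.
Qed.

Definition kappa : R := \int[P]_z (hess_fun z * resid_fun z * tnth z.1 ord0).

Lemma kappaE : kappa = fine 'E_P[fun z =>
  (m11 m (dotp z.1 theta0) z.2 * resid z.1 mu0 * regD z.1)%R]%E.
Proof.
rewrite unlock /kappa /Rintegral; congr fine.
by apply: integral_ae_eq_nonmeasurable; apply: filterS hess_ae => z ->.
Qed.

(** By [hess_orthogonal], D may be replaced by D - W^T mu0 in one factor. In this form [kappa] is
    twice the limit of the second-order quotients of the risk along [w0]. *)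
Let kappa_resid : kappa = \int[P]_z (hess_fun z * resid_fun z ^+ 2).
Proof.
under [RHS]eq_Rintegral => z _.
  rewrite (_ : _ * _ = \sum_(j <- enum 'I_k.+1) w0 0 j * (hess_fun z * resid_fun z * tnth z.1 j)).
    over.
  rewrite expr2 mulrA {2}/resid_fun -dotp_w0 /dotp mulr_sumr big_enum/=.
  by apply: eq_bigr => j _; ring.
rewrite Rintegral_bigsum; last first.
  move=> j; apply: mean_le_integrable (mean_leZ _ (Rintegral_mean_le _)).
  exact: hess_coord_integrable.
rewrite big_enum/= big_ord_recl RintegralZl//; last exact: hess_coord_integrable.
rewrite mxE unlift_none mul1r big1 ?addr0// => j _.
by rewrite RintegralZl ?hess_orthogonal ?mulr0//; exact: hess_coord_integrable.
Qed.

Let norm2_w0 : 1 <= norm2 w0 ^+ 2.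
Proof.
rewrite /norm2 sqr_sqrtr ?sumr_ge0// => [|i _]; last exact: sqr_ge0.
by rewrite big_ord_recl mxE unlift_none expr1n lerDl sumr_ge0// => i _; exact: sqr_ge0.
Qed.

(** The loss increment along [w0] without its linear term, divided by the squared step. It tends to
    half the curvature term wherever the second derivative at [theta0] exists. *)
Let quotient n (z : T) : R := n.+1%:R ^+ 2 *
  (increment w0 n.+1%:R^-1 z - n.+1%:R^-1 * resid_fun z * score_fun z).

Let quotient_mean : \forall n \near \oo, cM <= \int[P]_z quotient n z.
Proof.
have [h0 h00 H] := Theta_near w0.
have n2_0 : 0 <= norm2 w0 by exact: sqrtr_ge0.
(* The radius of the margin condition may be infinite; a finite positive one is needed to bound the
   step. *)
have [c c0 cc] : exists2 c : R, 0 < c & (c%:E <= cM')%E.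
  by case: cM' cM'0 => [c|_|//]; [rewrite lte_fin; exists c|exists 1; rewrite ?leey].
have d0 : 0 < Num.min h0 (c / (1 + norm2 w0)).
  by rewrite lt_min h00 divr_gt0// ltr_wpDr.
near=> n.
have : n.+1%:R^-1 < Num.min h0 (c / (1 + norm2 w0)).
  by near: n; exact: (near_infty_natSinv_lt (PosNum d0)).
set h : R := n.+1%:R^-1.
have hp : 0 < h by rewrite invr_gt0 ltr0n.
rewrite lt_min => /andP[hh0 hc].
have Th : Theta (theta0 + h *: w0) by apply: H; rewrite gtr0_norm.
have n2E : norm2 (theta0 + h *: w0 - theta0) = h * norm2 w0.
  rewrite addrAC subrr add0r /norm2.
  under eq_bigr do rewrite mxE exprMn.
  by rewrite -mulr_sumr sqrtrM ?sqr_ge0// sqrtr_sqr gtr0_norm.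
have := Hmar Th; rewrite n2E => Hm.
have {}Hm : ((cM * (h * norm2 w0) ^+ 2)%:E <= excess_risk P m theta0 (theta0 + h *: w0)%R)%E.
  apply: Hm; apply: le_trans cc; rewrite lee_fin.
  apply: (@le_trans _ _ (h * (1 + norm2 w0))); first by rewrite ler_pM2l// lerDr.
  by rewrite -ler_pdivlMr ?ltr_wpDr// ltW.
have ii := increment_integrable Th.
have exE : excess_risk P m theta0 (theta0 + h *: w0) = (\int[P]_z increment w0 h z)%:E.
  rewrite /excess_risk unlock /Rintegral fineK; last exact: integrable_fin_num.
  by apply: eq_integral => z _; rewrite dotpDZ.
rewrite exE lee_fin in Hm.
have -> : \int[P]_z quotient n z = n.+1%:R ^+ 2 * \int[P]_z increment w0 h z.
  have is_ := score_dotp_integrable w0.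
  have is2 := mean_le_integrable (mean_leZ h (Rintegral_mean_le is_)).
  have E z : h * resid_fun z * score_fun z = h * (score_fun z * dotp z.1 w0).
    by rewrite dotp_w0 /resid_fun; ring.
  rewrite /quotient; under eq_Rintegral do rewrite -/h E.
  rewrite RintegralZl//; last first.
    have := integrable_addr ii (mean_le_integrable (mean_leZ (-1) (Rintegral_mean_le is2))).
    by under eq_fun do rewrite mulN1r.
  by rewrite RintegralB// RintegralZl// first_order_condition mulr0 subr0.
have hn : n.+1%:R * h = 1 by rewrite /h divff// pnatr_eq0.
apply: (@le_trans _ _ (n.+1%:R ^+ 2 * (cM * (h * norm2 w0) ^+ 2))); last first.
  by rewrite ler_wpM2l// sqr_ge0.
have -> : n.+1%:R ^+ 2 * (cM * (h * norm2 w0) ^+ 2) =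
  (n.+1%:R * h) ^+ 2 * (cM * norm2 w0 ^+ 2) by ring.
by rewrite hn expr1n mul1r ler_peMr// ltW.
Unshelve. all: by end_near. Qed.

Let quotient_measurable n : measurable_fun setT (quotient n).
Proof.
apply: measurable_funM => //; apply: measurable_funB.
  apply: measurable_funB.
    by apply: measurable_loss => //; apply: measurable_funM => //; exact: measurable_dotp.
  have := @measurable_loss _ _ _ _ _ mm theta0 (cst 0) (@measurable_cst _ _ _ _ _ _).
  by under eq_fun do rewrite addr0.
by apply: measurable_funM; [exact: measurable_funM|exact: measurable_score].
Qed.

Let quotient_le n z : `|quotient n z| <= Cm * resid_fun z ^+ 2.
Proof.
have := taylor1 w0 n.+1%:R^-1 z; rewrite dotp_w0 -/(resid_fun z) => H.
rewrite /quotient normrM ger0_norm ?sqr_ge0//.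
apply: le_trans (ler_wpM2l (sqr_ge0 _) H) _.
have hn : n.+1%:R * n.+1%:R^-1 = 1 :> R by rewrite divff// pnatr_eq0.
rewrite le_eqVlt; apply/orP; left; apply/eqP.
have -> : n.+1%:R ^+ 2 * (Cm * (n.+1%:R^-1 * resid_fun z) ^+ 2) =
  (n.+1%:R * n.+1%:R^-1) ^+ 2 * (Cm * resid_fun z ^+ 2) by ring.
by rewrite hn expr1n mul1r.
Qed.

Let quotient_cvg z : has_m11 m (dotp z.1 theta0) z.2 ->
  quotient n z @[n --> \oo] --> m11 m (dotp z.1 theta0) z.2 * resid_fun z ^+ 2 / 2.
Proof.
move=> hz; apply/cvgrPdist_le => e e0.
set v := resid_fun z.
have e1 : 0 < e / (v ^+ 2 + 1) by rewrite divr_gt0// ltr_wpDl// sqr_ge0.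
have [dl dl0 H] := m_taylor2 (@dm z.2) hz e1.
have d0 : 0 < dl / (`|v| + 1) by rewrite divr_gt0// ltr_wpDl.
near=> n.
have : n.+1%:R^-1 < dl / (`|v| + 1).
  by near: n; exact: (near_infty_natSinv_lt (PosNum d0)).
set h : R := n.+1%:R^-1 => hd.
have hp : 0 < h by rewrite invr_gt0 ltr0n.
have := H (h * v); rewrite normrM (gtr0_norm hp).
have hv : h * `|v| < dl.
  apply: (@le_lt_trans _ _ (h * (`|v| + 1))); first by rewrite ler_pM2l// lerDl.
  by rewrite -ltr_pdivlMr// ltr_wpDl.
move=> /(_ hv).
have hn : n.+1%:R * h = 1 by rewrite /h divff// pnatr_eq0.
rewrite /quotient /increment -/h dotp_w0 -/(resid_fun z) -/v /score_fun.
move: (m (dotp z.1 theta0 + h * v) z.2) (m (dotp z.1 theta0) z.2)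
  (m1 m (dotp z.1 theta0) z.2) (m11 m (dotp z.1 theta0) z.2) => a b c g {}H.
have n0 : 0 <= n.+1%:R ^+ 2 :> R by exact: sqr_ge0.
have hn2 : n.+1%:R ^+ 2 * h ^+ 2 = 1 by rewrite -exprMn hn expr1n.
have -> : g * v ^+ 2 / 2 - n.+1%:R ^+ 2 * (a - b - h * v * c) =
    - (n.+1%:R ^+ 2 * (a - b - h * v * c - (h * v) ^+ 2 * (g / 2))).
  have -> : n.+1%:R ^+ 2 * (a - b - h * v * c - (h * v) ^+ 2 * (g / 2)) =
    n.+1%:R ^+ 2 * (a - b - h * v * c) - (n.+1%:R ^+ 2 * h ^+ 2) * (g * v ^+ 2 / 2).
    by field.
  by rewrite hn2 mul1r; ring.
rewrite normrN normrM (ger0_norm n0); apply: le_trans (ler_wpM2l n0 H) _.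
have -> : n.+1%:R ^+ 2 * (e / (v ^+ 2 + 1) * (h * v) ^+ 2) =
  (n.+1%:R ^+ 2 * h ^+ 2) * (e * (v ^+ 2 / (v ^+ 2 + 1))).
  by field; rewrite gt_eqF// ltr_wpDl// sqr_ge0.
rewrite hn2 mul1r ler_piMr ?(ltW e0)// ler_pdivrMr ?mul1r ?lerDl//.
by rewrite ltr_wpDl// sqr_ge0.
Unshelve. all: by end_near. Qed.

(* Along the direction [w0] with [X^T w0 = D - W^T mu0], the second-order
   expansion of the risk turns the margin condition into a lower bound on the
   curvature. *)
Lemma kappa_ge : 2 * cM <= kappa.
Proof.
pose f (z : T) := hess_fun z * resid_fun z ^+ 2 / 2.
have mf : measurable_fun setT f.
  apply: measurable_funM => //; apply: measurable_funM; first exact: measurable_hess.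
  exact: measurable_funX.
have ibound : P.-integrable setT (EFin \o (fun z : T => Cm * resid_fun z ^+ 2)).
  exact: mean_le_integrable (mean_leZ Cm resid_sqr).
have mq n : measurable_fun setT (EFin \o quotient n) by exact/measurable_EFinP.
have mfE : measurable_fun setT (EFin \o f) by exact/measurable_EFinP.
have [//|//|iff _ qf] := dominated_convergence measurableT mq mfE _ ibound _.
- have [_ _ _ H4] := Hsm; apply: filterS2 H4 hess_ae => z hz E _ /=.
  apply/fine_cvgP; split; first exact: nearW.
  by rewrite /f E; exact: quotient_cvg.
- by apply: aeW => z n _ /=; rewrite lee_fin; exact: quotient_le.
have qfr : \int[P]_z quotient n z @[n --> \oo] --> \int[P]_z f z.
  by apply: fine_cvg; rewrite fineK //; exact: integrable_fin_num.
have kf : kappa = 2 * \int[P]_z f z.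
  rewrite -RintegralZl// kappa_resid; apply: eq_Rintegral => z _.
  by rewrite /f; field.
rewrite kf ler_pM2l// -(cvg_lim (@Rhausdorff R) qfr).
apply: limr_ge; last exact: quotient_mean.
by apply/cvg_ex; exists (\int[P]_z f z).
Qed.

End population.

(** * Joint moments with uniform constants *)

Section moment_bounds.
Context {R : realType} {k : nat} {d : measure_display} {Y : measurableType d}.
Local Notation X := (k.+1.-tuple R).
Local Notation T := (X * Y)%type.
Variables (P : probability T R) (m : R -> Y -> R).
Variables (calX : set X) (Theta : set 'rV[R]_k.+1).
Variables (theta0 : 'rV[R]_k.+1) (mu0 : 'rV[R]_k).
Variables (cM : R) (cM' : \bar R) (CM r' Cm : R) (J : nat) (t : Y -> nat -> \bar R).
Variables (cL : \bar R) (CL r B : R) (L : T -> R).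
Hypothesis Hset : setting P m calX Theta theta0.
Hypothesis Hmu0 : is_mu0 P m theta0 mu0.
Hypotheses (CM0 : 0 < CM) (r'4 : 4 < r').
Hypothesis Hint : integrability P m theta0 mu0 CM r'.
Hypothesis Cm0 : 0 < Cm.
Hypothesis Hsm : higher_order_smoothness P m theta0 Cm J t.
Hypotheses (r4 : 4 < r) (B1 : 1 <= B).
Hypothesis Hloc : local_loss P m calX Theta theta0 cL CL r B L.

Local Notation e := (score_fun m theta0).
Local Notation v := (resid_fun mu0 : T -> R).
Local Notation g := (hess_fun m theta0 Cm).

Definition rho : R := Num.min r r'.
(* Young's inequality bounds a product of powers of total degree at most [rho]
   by the sum of the marginal [rho]-th moments, so one constant serves for all
   the joint moments below. *)
Definition marginal_bound : R := 2 `^ rho * (2 + CM `^ r').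
Definition joint_bound : R := 1 + 2 * marginal_bound.

Definition normX (z : T) : R := norm_inf z.1.
(** Division by [B] makes the r-th moment of the largest coordinate at most 1, so this factor shares
    [marginal_bound] with the scalar ones. Adding 1 gives the positivity that [mean_le_young]
    requires. *)
Definition scaleX (z : T) : R := 1 + `|normX z / B|.

Let rho4 : 4 < rho. Proof. by rewrite lt_min r4 r'4. Qed.
Let rho_r : rho <= r. Proof. by rewrite ge_min lexx. Qed.
Let rho_r' : rho <= r'. Proof. by rewrite ge_min lexx orbT. Qed.
Let rho0 : 0 <= rho. Proof. by rewrite ltW// (lt_trans _ rho4). Qed.
Let B0 : 0 < B. Proof. exact: lt_le_trans B1. Qed.

Let marginal_bound_ge0 : 0 <= marginal_bound.
Proof. by rewrite mulr_ge0 ?powR_ge0// addr_ge0 ?powR_ge0. Qed.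

Lemma joint_bound_ge1 : 1 <= joint_bound. Proof. by rewrite lerDl mulr_ge0. Qed.

Let mN : measurable_fun setT normX. Proof. exact: measurable_norm_inf. Qed.

Lemma normX_moment : mean_le P (fun z => normX z `^ r) (B `^ r).
Proof.
case: Hloc => mL L1 [_ _ H] _ _; split; first exact: measurable_powRr.
under eq_integral do rewrite ger0_norm ?powR_ge0//.
rewrite unlock in H; apply: le_trans H.
apply: ae_ge0_le_integral => //.
- by move=> z _; rewrite lee_fin powR_ge0.
- by apply/measurable_EFinP; exact: measurable_powRr.
- apply/measurable_EFinP/measurable_powRr/measurableT_comp => //.
  exact: measurable_funM.
case: Hset => + _ _; apply: filterS => -[x y] /= /(L1 _ y) L1xy _.
rewrite lee_fin ge0_ler_powR ?nnegrE ?norm_inf_ge0 ?(ltW (lt_trans _ r4))//.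
rewrite normrM [`|norm_inf x|]ger0_norm ?norm_inf_ge0// ler_peMl ?norm_inf_ge0//.
by rewrite (le_trans L1xy) ?ler_norm.
Qed.

Let scaleX_moment : mean_le P (fun z => scaleX z `^ rho) marginal_bound.
Proof.
have mNB : measurable_fun setT (fun z => normX z / B) by exact: measurable_funM.
have h : mean_le P (fun z => `|normX z / B| `^ r) 1.
  have := mean_leZ (B^-1 `^ r) normX_moment.
  rewrite ger0_norm ?powR_ge0// -powRM ?invr_ge0 ?(ltW B0)// mulVf ?gt_eqF// powR1.
  apply: le_mean_le => [|z].
    by apply: measurable_powRr; exact: measurableT_comp.
  rewrite ger0_norm ?powR_ge0// normrM normfV (gtr0_norm B0).
  rewrite [leRHS]ger0_norm; last by rewrite mulr_ge0 ?powR_ge0.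
  rewrite mulrC powRM ?invr_ge0 ?(ltW B0)// (ger0_norm (norm_inf_ge0 _)).
  exact: lexx.
apply: mean_leW (mean_le_one_plus mNB _ h); last by rewrite rho0.
rewrite ler_wpM2l ?powR_ge0//; have := powR_ge0 CM r'; lra.
Qed.

Let plus_moment (f : T -> R) : measurable_fun setT f ->
  mean_le P (fun z => `|f z| `^ r') (CM `^ r') ->
  mean_le P (fun z => (1 + `|f z|) `^ rho) marginal_bound.
Proof.
move=> mf fc; apply: mean_leW (mean_le_one_plus mf _ fc); last by rewrite rho0.
by rewrite ler_wpM2l ?powR_ge0//; lra.
Qed.

Let score_plus := plus_moment (measurable_score Hset Hsm) (score_moment Hset CM0 r'4 Hint Hsm).
Let resid_plus := plus_moment (measurable_resid mu0) (resid_moment CM0 r'4 Hint).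
Let coord_plus j := plus_moment (measurable_coord j) (coord_moment CM0 r'4 Hint j).

Let one_plus_gt0 (x : R) : 0 < 1 + `|x|. Proof. by rewrite ltr_pwDl. Qed.

Let measurable_plus (f : T -> R) : measurable_fun setT f ->
  measurable_fun setT (fun z => 1 + `|f z|).
Proof. by move=> mf; apply: measurable_funD => //; exact: measurableT_comp. Qed.

Lemma product_moment (a b : nat) (f h : T -> R) :
  measurable_fun setT f -> measurable_fun setT h -> (a + b <= 4)%N ->
  mean_le P (fun z => (1 + `|f z|) `^ rho) marginal_bound ->
  mean_le P (fun z => (1 + `|h z|) `^ rho) marginal_bound ->
  mean_le P (fun z => (1 + `|f z|) ^+ a * (1 + `|h z|) ^+ b) joint_bound.
Proof.
move=> mf mh ab fC hC.
have := @mean_le_young _ _ _ P (fun z => 1 + `|f z|) (fun z => 1 + `|h z|) a%:R b%:R rho marginal_bound.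
move=> /(_ (measurable_plus mf) (measurable_plus mh)).
have abr : a%:R + b%:R <= rho.
  rewrite -natrD; apply: le_trans (ltW rho4).
  by rewrite ler_nat.
move=> /(_ (fun z => one_plus_gt0 _) (fun z => one_plus_gt0 _) (ler0n _ _) (ler0n _ _) abr fC hC).
by under eq_fun do rewrite !powR_mulrn ?addr_ge0//.
Qed.

Let le_plus_sqr (x : R) : x ^+ 2 <= (1 + `|x|) ^+ 2.
Proof.
by rewrite -[x ^+ 2]real_normK ?num_real// ler_pXn2r ?nnegrE ?addr_ge0// lerDr.
Qed.

Let norm_plus_sqr (x : R) : `|x ^+ 2| <= `|(1 + `|x|) ^+ 2|.
Proof. by rewrite ger0_norm ?sqr_ge0// [leRHS]ger0_norm ?sqr_ge0// le_plus_sqr. Qed.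

Let sqr_product (f h : T -> R) : measurable_fun setT f -> measurable_fun setT h ->
  mean_le P (fun z => (1 + `|f z|) `^ rho) marginal_bound ->
  mean_le P (fun z => (1 + `|h z|) `^ rho) marginal_bound ->
  mean_le P (fun z => (f z * h z) ^+ 2) joint_bound.
Proof.
move=> mf mh fC hC; apply: le_mean_le (product_moment (a := 2) (b := 2) mf mh _ fC hC) => // [|z].
  by apply: measurable_funX; exact: measurable_funM.
by rewrite exprMn normrM [leRHS]normrM ler_pM.
Qed.

Lemma score_coord_sqr j : mean_le P (fun z => (e z * tnth z.1 j) ^+ 2) joint_bound.
Proof.
exact: sqr_product (measurable_score Hset Hsm) (measurable_coord j) score_plus (coord_plus j).
Qed.

Lemma resid_coord_sqr j : mean_le P (fun z => (v z * tnth z.1 j) ^+ 2) joint_bound.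
Proof.
exact: sqr_product (measurable_resid mu0) (measurable_coord j) resid_plus (coord_plus j).
Qed.

Lemma coord_sqr_resid j : mean_le P (fun z => tnth z.1 j ^+ 2 * (1 + `|v z|)) joint_bound.
Proof.
have mc := @measurable_coord R k _ Y j; have mv := @measurable_resid R k _ Y mu0.
apply: le_mean_le (product_moment (a := 2) (b := 1) mc mv _ (coord_plus j) resid_plus) => // [|z].
  by apply: measurable_funM; [exact: measurable_funX|exact: measurable_plus].
by rewrite expr1 normrM [leRHS]normrM ler_wpM2r.
Qed.

Lemma normX_le_scale z : normX z <= B * scaleX z.
Proof.
rewrite /scaleX mulrDr mulr1 ger0_norm; last by rewrite divr_ge0 ?norm_inf_ge0// ltW.
by rewrite mulrCA divff ?gt_eqF// mulr1 lerDr ltW.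
Qed.

Lemma scaleX_ge1 z : 1 <= scaleX z. Proof. by rewrite lerDl. Qed.

Lemma measurable_scaleX : measurable_fun setT scaleX.
Proof. by apply: measurable_plus; exact: measurable_funM. Qed.

Let mNB : measurable_fun setT (fun z => normX z / B). Proof. exact: measurable_funM. Qed.

Lemma normX_resid_sqr : mean_le P (fun z => (normX z * (1 + `|v z|)) ^+ 2) (B ^+ 2 * joint_bound).
Proof.
have mv := @measurable_resid R k _ Y mu0.
have := mean_leZ (B ^+ 2) (product_moment (a := 2) (b := 2) mNB mv isT scaleX_moment resid_plus).
rewrite ger0_norm ?sqr_ge0//; apply: le_mean_le => [|z].
  by apply: measurable_funX; apply: measurable_funM => //; exact: measurable_plus.
rewrite -/(scaleX z) exprMn.
have -> : B ^+ 2 * (scaleX z ^+ 2 * (1 + `|v z|) ^+ 2) =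
  (B * scaleX z) ^+ 2 * (1 + `|v z|) ^+ 2 by ring.
rewrite normrM [leRHS]normrM ler_wpM2r//.
rewrite ger0_norm ?sqr_ge0// [leRHS]ger0_norm ?sqr_ge0//.
have N0 : 0 <= normX z by exact: norm_inf_ge0.
rewrite ler_pXn2r ?nnegrE//; first exact: normX_le_scale.
exact: le_trans N0 (normX_le_scale z).
Qed.

(** The product has total degree [1 + p], so its power [q] stays within the available moments when
    [q * (1 + p) <= rho]. This yields the exponents [rho / 2] for envelopes linear in X and
    [rho / 3] for quadratic ones. *)
Let env_moment (f : T -> R) (c p q : R) : 0 <= c -> measurable_fun setT f ->
  mean_le P (fun z => (1 + `|f z|) `^ rho) marginal_bound -> 0 <= p -> 0 <= q ->
  q * (1 + p) <= rho ->
  mean_le P (fun z => (c * (scaleX z `^ p * (1 + `|f z|))) `^ q) (c `^ q * joint_bound).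
Proof.
move=> c0 mf fC p0 q0 pq.
have := @mean_le_young _ _ _ P scaleX (fun z => 1 + `|f z|) (p * q) q rho marginal_bound.
have pq' : p * q + q <= rho by rewrite -[X in _ + X]mul1r -mulrDl mulrC addrC.
have pq0 : 0 <= p * q by rewrite mulr_ge0.
move=> /(_ measurable_scaleX (measurable_plus mf) (fun z => one_plus_gt0 _)
  (fun z => one_plus_gt0 _) pq0 q0 pq' scaleX_moment fC) h.
have := mean_leZ (c `^ q) h; rewrite ger0_norm ?powR_ge0//.
congr mean_le; apply/funext => z; rewrite powRM ?mulr_ge0 ?powR_ge0 ?addr_ge0//.
by rewrite powRM ?powR_ge0 ?addr_ge0// powRrM.
Qed.

Lemma env_score_moment c : 0 <= c ->
  mean_le P (fun z => (c * (scaleX z * (1 + `|e z|))) `^ (rho / 2)) (c `^ (rho / 2) * joint_bound).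
Proof.
move=> c0; have := @env_moment e c 1 (rho / 2) c0 (measurable_score Hset Hsm) score_plus ler01.
have r2 : 0 <= rho / 2 by rewrite divr_ge0.
have r2' : rho / 2 * (1 + 1) <= rho by lra.
move=> /(_ r2 r2'); congr mean_le; apply/funext => z.
by rewrite powRr1// (le_trans ler01 (scaleX_ge1 z)).
Qed.

Lemma env_resid_moment c : 0 <= c ->
  mean_le P (fun z => (c * (scaleX z * (1 + `|v z|))) `^ (rho / 2)) (c `^ (rho / 2) * joint_bound).
Proof.
move=> c0; have := @env_moment v c 1 (rho / 2) c0 (measurable_resid mu0) resid_plus ler01.
have r2 : 0 <= rho / 2 by rewrite divr_ge0.
have r2' : rho / 2 * (1 + 1) <= rho by lra.
move=> /(_ r2 r2'); congr mean_le; apply/funext => z.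
by rewrite powRr1// (le_trans ler01 (scaleX_ge1 z)).
Qed.

Lemma env_quad_moment c : 0 <= c ->
  mean_le P (fun z => (c * (scaleX z ^+ 2 * (1 + `|v z|))) `^ (rho / 3)) (c `^ (rho / 3) * joint_bound).
Proof.
move=> c0.
have := @env_moment v c 2 (rho / 3) c0 (measurable_resid mu0) resid_plus (ler0n _ _).
have r2 : 0 <= rho / 3 by rewrite divr_ge0.
have r2' : rho / 3 * (1 + 2) <= rho by lra.
move=> /(_ r2 r2'); congr mean_le; apply/funext => z.
by rewrite powR_mulrn// (le_trans ler01 (scaleX_ge1 z)).
Qed.

Lemma score_resid_moment del : 0 <= del -> (2 + del) + (2 + del) <= rho ->
  mean_le P (fun z => `|e z * v z| `^ (2 + del)) joint_bound.
Proof.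
move=> d0 dr; have d2 : 0 <= 2 + del by rewrite addr_ge0.
have me := measurable_score Hset Hsm; have mv := @measurable_resid R k _ Y mu0.
have := @mean_le_young _ _ _ P (fun z => 1 + `|e z|) (fun z => 1 + `|v z|) (2 + del) (2 + del)
  rho marginal_bound (measurable_plus me) (measurable_plus mv) (fun z => one_plus_gt0 _)
  (fun z => one_plus_gt0 _) d2 d2 dr score_plus resid_plus.
apply: le_mean_le => [|z].
  by apply: measurable_powRr; apply: measurableT_comp => //; exact: measurable_funM.
rewrite [leRHS]ger0_norm ?mulr_ge0 ?powR_ge0// ger0_norm ?powR_ge0//.
rewrite normrM powRM// ler_pM ?powR_ge0//.
  by apply: ge0_ler_powR; rewrite ?nnegrE ?addr_ge0// lerDr.
by apply: ge0_ler_powR; rewrite ?nnegrE ?addr_ge0// lerDr.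
Qed.

Lemma score_resid_sqr : mean_le P (fun z => (e z * v z) ^+ 2) joint_bound.
Proof.
exact: sqr_product (measurable_score Hset Hsm) (measurable_resid mu0) score_plus resid_plus.
Qed.

Lemma hess_coord_mean j : `|\int[P]_z (g z * v z * tnth z.1 j)| <= Cm * joint_bound.
Proof.
apply: mean_le_Rintegral.
have mc := @measurable_coord R k _ Y j; have mv := @measurable_resid R k _ Y mu0.
have h := product_moment (a := 1) (b := 1) mc mv isT (coord_plus j) resid_plus.
have := mean_leZ Cm h; rewrite (gtr0_norm Cm0); apply: le_mean_le => [|z].
  by apply: measurable_funM => //; apply: measurable_funM => //; exact: (measurable_hess Hset Hsm).
rewrite !expr1 -mulrA normrM [leRHS]normrM (gtr0_norm Cm0) ler_pM//.
  by have := hess_le m theta0 Cm0 z.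
have plus x : `|x| <= `|(1 + `|x|)| by rewrite [leRHS]ger0_norm ?addr_ge0// lerDr.
by rewrite normrM mulrC [leRHS]normrM ler_pM ?plus.
Qed.

End moment_bounds.

(** * Fixed-sample error bound *)

Lemma powR_inv_base {R : realType} (x r : R) : 0 <= x -> x^-1 `^ r = (x `^ r)^-1.
Proof.
by move=> x0; rewrite -powR_inv1// -powRrM mulrC powRrM powR_inv1 ?powR_ge0.
Qed.

(** * Observations near a knot *)

Section kink_set.
Context {R : realType} {k : nat} {d : measure_display} {Y : measurableType d}.
Local Notation X := (k.+1.-tuple R).
Local Notation T := (X * Y)%type.
Variables (P : probability T R) (m : R -> Y -> R).
Variables (theta0 : 'rV[R]_k.+1) (Cm : R) (J : nat) (t : Y -> nat -> \bar R).
Hypothesis Cm0 : 0 < Cm.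
Hypothesis Hsm : higher_order_smoothness P m theta0 Cm J t.

Definition expansion_at (z : T) (h : R) : Prop :=
  `|m1 m (dotp z.1 theta0 + h) z.2 - score_fun m theta0 z
     - h * m11 m (dotp z.1 theta0 + h) z.2| <= Cm * h ^+ 2 /\
  `|m11 m (dotp z.1 theta0 + h) z.2 - hess_fun m theta0 Cm z| <= Cm * `|h|.

Let expansion (z : T) (D h : R) : 0 <= D ->
  (forall j, (0 < j < J)%N ->
     ~~ (((dotp z.1 theta0 - D)%:E <= t z.2 j)
         && (t z.2 j <= (dotp z.1 theta0 + D)%:E))%E) ->
  `|h| <= D -> expansion_at z h.
Proof.
have [H1 H2 H3 _] := Hsm; have [dm cm1] := H2 z.2.
move=> D0 nok hD.
have [hs [b1 b2]] := no_knot_expansion (H1 z.2) cm1 Cm0 (H3 z.2) D0 nok hD.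
split=> //; rewrite /hess_fun m11_proxyE//.
exact: (m11_le (H1 z.2) cm1 Cm0 (H3 z.2)).
Qed.

Lemma expansion_no_knot (z : T) (h : R) : (J < 2)%N -> expansion_at z h.
Proof.
move=> J2; apply: (@expansion z `|h|) => // j /andP[j0 jJ]; exfalso; lia.
Qed.

(** For use on the knot set, where the Lipschitz bound on [m1] and the bound on [m11] are what
    remains. *)
Lemma loss_crude_expansion (z : T) (h : R) :
  [/\ `|m1 m (dotp z.1 theta0 + h) z.2 - score_fun m theta0 z
        - h * m11 m (dotp z.1 theta0 + h) z.2| <= 2 * Cm * `|h|,
      `|m11 m (dotp z.1 theta0 + h) z.2 - hess_fun m theta0 Cm z| <= 2 * Cm &
      `|m11 m (dotp z.1 theta0 + h) z.2| <= Cm].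
Proof.
have [H1 H2 H3 _] := Hsm; have [dm cm1] := H2 z.2.
have b1 := m1_lipschitz (H1 z.2) cm1 (H3 z.2) (dotp z.1 theta0 + h) (dotp z.1 theta0).
have b2 := m11_le (H1 z.2) cm1 Cm0 (H3 z.2) (dotp z.1 theta0 + h).
have b3 := hess_le m theta0 Cm0 z.
rewrite /score_fun; move: b1 b2 b3.
rewrite (_ : dotp z.1 theta0 + h - dotp z.1 theta0 = h); last by ring.
move: (m1 m _ _) (m1 m _ _) (m11 m _ _) (hess_fun _ _ _ _) => a b c g b1 b2 b3.
split=> //.
- apply: le_trans (ler_normB _ _) _; rewrite normrM mulrC.
  have : `|h| * `|c| <= `|h| * Cm by rewrite ler_wpM2l.
  lra.
- apply: le_trans (ler_normB _ _) _; lra.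
Qed.

(** The set collects the observations with a knot within [Delta] of the true index, and those whose
    regressor is so large that a displacement could exceed [Delta]; Markov's inequality for the r-th
    moment handles the latter. It depends on no estimate and hence serves all displacements at
    once. *)
Lemma kink_set (Cf Delta al B r : R) : 0 < Cf -> 0 < Delta -> 0 <= al -> 0 < B -> 0 < r ->
  density P theta0 Cf Delta J t ->
  mean_le P (fun z => norm_inf z.1 `^ r) (B `^ r) ->
  exists KS : set T, [/\ measurable KS,
    (P KS <= (J%:R * (Cf * Delta) + (B * al / Delta) `^ r)%:E)%E &
    forall z h, ~ KS z -> `|h| <= al * norm_inf z.1 -> expansion_at z h].
Proof.
move=> Cf0 D0 al0 B0 r0 Hden NB.
pose E (j : 'I_J) : set T := if (0 < j)%N then
  [set z | ((dotp z.1 theta0 - Delta)%:E <= t z.2 j)%E /\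
           (t z.2 j <= (dotp z.1 theta0 + Delta)%:E)%E] else set0.
have mE j : measurable (E j).
  rewrite /E; case: ifP => // j0; have jJ : (0 < j < J)%N by rewrite j0 ltn_ord.
  have [mt _] := Hden j jJ.
  have mtz : measurable_fun [set: T] (fun z => t z.2 j).
    exact: (measurableT_comp mt measurable_snd).
  have md := @measurable_dotp _ k _ Y theta0.
  apply: measurableI.
    have := @measurable_lee _ _ _ _ measurableT (fun z : T => (dotp z.1 theta0 - Delta)%:E) _ _ mtz.
    rewrite setTI; apply; apply/measurable_EFinP; exact: measurable_funB.
  have := @measurable_lee _ _ _ _ measurableT _ (fun z : T => (dotp z.1 theta0 + Delta)%:E) mtz.
  rewrite setTI; apply; apply/measurable_EFinP; exact: measurable_funD.
have EP j : (P (E j) <= (Cf * Delta)%:E)%E.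
  rewrite /E; case: ifP => j0; last by rewrite measure0 lee_fin mulr_ge0 ?ltW.
  have jJ : (0 < j < J)%N by rewrite j0 ltn_ord.
  by have [] := Hden j jJ.
have mN : measurable_fun [set: T] (fun z => norm_inf z.1) by exact: measurable_norm_inf.
have mN2 : measurable [set z : T | Delta < al * norm_inf z.1].
  by apply: measurable_setlt => //; exact: measurable_funM.
exists ([set z | exists j, E j z] `|` [set z | Delta < al * norm_inf z.1]); split.
- by apply: measurableU => //; exact: measurable_existsb.
- apply: le_trans (measureU2 _ _ _) _ => //; first exact: measurable_existsb.
  rewrite EFinD; apply: leeD.
    by have := union_bound mE EP; rewrite card_ord.
  have Dr0 : 0 < Delta `^ r by exact: powR_gt0.
  have := mean_le_tail Dr0 (mean_leZ (al `^ r) NB).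
  rewrite (ger0_norm (powR_ge0 _ _)).
  have -> : al `^ r * B `^ r / Delta `^ r = (B * al / Delta) `^ r.
    have iD : 0 <= Delta^-1 by rewrite invr_ge0 ltW.
    have BA : 0 <= B * al by apply: mulr_ge0 => //; exact: ltW.
    rewrite (powRM _ BA iD) (powRM _ (ltW B0) al0) powR_inv_base ?ltW//.
    by rewrite [al `^ r * _]mulrC.
  apply: le_trans; apply: le_measure; rewrite ?inE//.
    apply: measurable_setlt => //; apply: measurableT_comp => //.
    by apply: measurable_funM => //; exact: measurable_powRr.
  move=> z /= Dz; rewrite ger0_norm ?mulr_ge0 ?powR_ge0// -powRM ?norm_inf_ge0//.
  by rewrite gt0_ltr_powR// ?nnegrE ?mulr_ge0 ?norm_inf_ge0// ltW.
- move=> z h KSz hz; apply: (@expansion z Delta) (ltW D0) _ _.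
    move=> j /andP[j0 jJ]; apply/negP => /andP[a b]; apply: KSz; left.
    by exists (Ordinal jJ); rewrite /E /= j0.
  rewrite (le_trans hz)// leNgt; apply/negP => Dz; apply: KSz; by right.
Qed.

End kink_set.

Section small_events.
Context {R : realType} {d : measure_display} {T : measurableType d}.
Variable Q : probability T R.

Definition small_event (E : set T) (c : R) := measurable E /\ (Q E <= c%:E)%E.

Lemma small_eventU E F a b : small_event E a -> small_event F b ->
  small_event (E `|` F) (a + b).
Proof.
move=> [mE Ea] [mF Fb]; split; first exact: measurableU.
by apply: le_trans (measureU2 _ _ _) _ => //; rewrite EFinD leeD.
Qed.

Lemma small_eventW E a b : a <= b -> small_event E a -> small_event E b.
Proof. by move=> ab [mE Ea]; split=> //; rewrite (le_trans Ea)// lee_fin. Qed.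

Lemma small_event_tail (f : T -> R) (a c : R) : 0 < a -> (forall x, 0 <= f x) ->
  mean_le Q f c -> small_event [set w | a < f w] (c / a).
Proof.
move=> a0 f0 fc; split; first by apply: measurable_setlt => //; exact: fc.1.
have := mean_le_tail a0 fc; under eq_set do rewrite ger0_norm//.
by [].
Qed.

End small_events.

(** The exponent is at most [1 - ln (p * n)%:R], so a union over p indices still leaves a
    probability of order 1/n. *)
Lemma union_expR_le {R : realType} (p n : nat) (tau c : R) : (0 < p)%N -> (0 < n)%N ->
  tau <= 2 -> 1 <= c ->
  p%:R * expR (tau / 2 - ln (p * n)%:R * c) <= expR 1 / n%:R.
Proof.
move=> p0 n0 tau2 c1; have pn1 : 1 <= (p * n)%:R :> R by rewrite ler1n muln_gt0 p0.
have L0 : 0 <= ln (p * n)%:R :> R by rewrite ln_ge0.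
apply: (@le_trans _ _ (p%:R * expR (1 - ln (p * n)%:R))).
  by rewrite ler_wpM2l// ler_expR lerB//; [lra|exact: ler_peMr].
rewrite expRD expRN lnK ?posrE ?(lt_le_trans ltr01)// natrM le_eqVlt; apply/orP; left; apply/eqP.
by field; rewrite !pnatr_eq0 -!lt0n n0 p0.
Qed.

Lemma avg_le_sum {R : realType} (n : nat) (f : 'I_n -> R) (c : R) : (0 < n)%N ->
  \sum_(i < n) f i <= n%:R * c -> avg f <= c.
Proof. by move=> n0 H; rewrite /avg mulrC ler_pdivrMr ?ltr0n// [c * _]mulrC. Qed.

Lemma norm_avg_le_sum {R : realType} (n : nat) (f : 'I_n -> R) (c : R) : (0 < n)%N ->
  `|\sum_(i < n) f i| <= n%:R * c -> `|avg f| <= c.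
Proof.
move=> n0 H; rewrite /avg normrM ger0_norm ?invr_ge0// mulrC ler_pdivrMr ?ltr0n//.
by rewrite [c * _]mulrC.
Qed.

(** * The event on which all sample averages behave *)

Section good_event.
Context {R : realType} {k : nat} {d : measure_display} {Y : measurableType d}.
Local Notation X := (k.+1.-tuple R).
Local Notation T := (X * Y)%type.
Variables (P : probability T R) (m : R -> Y -> R).
Variables (calX : set X) (Theta : set 'rV[R]_k.+1).
Variables (theta0 : 'rV[R]_k.+1) (mu0 : 'rV[R]_k).
Variables (CM r' Cm : R) (J : nat) (t : Y -> nat -> \bar R).
Variables (cL : \bar R) (CL r B : R) (L : T -> R).
Hypothesis Hset : setting P m calX Theta theta0.
Hypothesis Hmu0 : is_mu0 P m theta0 mu0.
Hypothesis Hpar : parameter_space Theta theta0.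
Hypothesis Hdiff : differentiability_integrability P m Theta.
Hypotheses (CM0 : 0 < CM) (r'4 : 4 < r').
Hypothesis Hint : integrability P m theta0 mu0 CM r'.
Hypothesis Cm0 : 0 < Cm.
Hypothesis Hsm : higher_order_smoothness P m theta0 Cm J t.
Hypotheses (r4 : 4 < r) (B1 : 1 <= B).
Hypothesis Hloc : local_loss P m calX Theta theta0 cL CL r B L.
Context {dO : measure_display} {Omega : measurableType dO}.
Variables (Q : probability Omega R) (n : nat) (Z : 'I_n -> {RV Q >-> T}).
Hypothesis iidZ : iid_from P Z.
Hypothesis n0 : (0 < n)%N.

Local Notation e := (score_fun m theta0).
Local Notation v := (resid_fun mu0 : T -> R).
Local Notation g := (hess_fun m theta0 Cm).
Local Notation rho := (rho r' r).
Local Notation joint_bound := (joint_bound CM r' r).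
Local Notation S := (scaleX B : T -> R).

Variable l : R.
Hypothesis l0 : 0 < l.
Hypothesis l_ln : n%:R * l ^+ 2 = ln (k.+1 * n)%:R.

(** Large enough that [G * B * (S z * (1 + |f z|))] dominates the coordinates of the score and of
    the Hessian terms, the latter after subtraction of means of size up to [Cm * joint_bound], and
    that [2 * G ^+ 2] bounds their second moments. *)
Definition env_const : R := (1 + Cm) * (1 + joint_bound).
Local Notation G := env_const.
(** The quantity [tau] of the maximal inequality, for an envelope with factor [G * B], exponent
    [rho / 2] and truncation at [(2 * l)^-1]. *)
Definition tail_mass : R := n%:R * (joint_bound * (2 * G * B * l) `^ (rho / 2)).
Local Notation tau := tail_mass.

Variable A : R.
Hypothesis A_G : 4 * G ^+ 2 + 1 <= A.
Hypothesis A_C3 : 2 * joint_bound + 1 <= A.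
Hypothesis tau2 : tau <= 2.
Hypothesis l_small : 2 * G * B * l <= 1.

Let rho4 : 4 < rho. Proof. by rewrite lt_min r4 r'4. Qed.
Let C31 : 1 <= joint_bound. Proof. exact: joint_bound_ge1. Qed.
Let B0 : 0 < B. Proof. exact: lt_le_trans B1. Qed.
Let me := measurable_score Hset Hsm.
Let mg := measurable_hess Hset Hsm.
Let mv : measurable_fun setT v. Proof. exact: measurable_resid. Qed.
Let mc j : measurable_fun [set: T] (fun z => tnth z.1 j).
Proof. exact: measurable_coord. Qed.
Let mN : measurable_fun [set: T] (fun z => norm_inf z.1).
Proof. exact: measurable_norm_inf. Qed.
Let mS : measurable_fun setT S. Proof. exact: measurable_scaleX. Qed.
Let m_plus (f : T -> R) : measurable_fun setT f -> measurable_fun setT (fun z => 1 + `|f z|).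
Proof. by move=> mf; apply: measurable_funD => //; exact: measurableT_comp. Qed.

Let G1 : 1 <= G.
Proof. by rewrite /env_const; have := C31; have := Cm0; nra. Qed.

Let A0 : 0 < A. Proof. by have := A_C3; have := C31; lra. Qed.

Let env_pow (c s : R) : 0 <= c ->
  c `^ s * joint_bound / ((2 * l)^-1 `^ s) = joint_bound * (2 * c * l) `^ s.
Proof.
move=> c0; have l2 : 0 <= 2 * l by rewrite mulr_ge0// ltW.
rewrite powR_inv_base// invrK (_ : 2 * c * l = c * (2 * l)); last by ring.
by rewrite (powRM _ c0 l2); ring.
Qed.

Let m_sumabs (f : T -> R) : measurable_fun setT f ->
  measurable_fun setT (fun w => `|\sum_(i < n) f (Z i w)|).
Proof.
move=> mf; apply: measurableT_comp => //; apply: measurable_sum => i.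
exact: measurableT_comp.
Qed.

Let centered_event (f : T -> R) (xi : 'I_k.+1 -> T -> R) :
  measurable_fun setT f -> (forall j, measurable_fun setT (xi j)) ->
  mean_le P (fun z => (G * B * (S z * (1 + `|f z|))) `^ (rho / 2))
    ((G * B) `^ (rho / 2) * joint_bound) ->
  (forall j z, `|xi j z| <= G * B * (S z * (1 + `|f z|))) ->
  (forall j, \int[P]_z xi j z = 0) ->
  (forall j, mean_le P (fun z => xi j z ^+ 2) (2 * G ^+ 2)) ->
  small_event Q [set w | exists j, n%:R * (A * l) < `|\sum_(i < n) xi j (Z i w)|]
    (2 * tau + 2 * (expR 1 / n%:R)).
Proof.
move=> mf mxi envK xienv xi0 xi2; split.
  by apply: measurable_existsb => j; apply: measurable_setlt => //; exact: m_sumabs.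
have GB : 0 <= G * B by rewrite mulr_ge0 ?(le_trans ler01 G1)// ltW.
have menv : measurable_fun setT (fun z => G * B * (S z * (1 + `|f z|))).
  by apply: measurable_funM => //; apply: measurable_funM => //; exact: m_plus.
have env0 z : 0 <= G * B * (S z * (1 + `|f z|)).
  by rewrite mulr_ge0// mulr_ge0 ?addr_ge0.
have s1 : 1 <= rho / 2 by have := rho4; lra.
apply: le_trans (max_centered iidZ env0 menv s1 envK A mxi xienv xi0 xi2 l0) _.
rewrite lee_fin env_pow// (_ : 2 * (G * B) * l = 2 * G * B * l); last by ring.
rewrite -/tau lerD2l -mulrA ler_wpM2l// card_ord l_ln.
(* With [sig2 = 2 * G ^+ 2], [A_G] makes [A - 2 * sig2] at least 1. *)
by apply: union_expR_le => //; have := A_G; lra.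
Qed.

Lemma score_event :
  small_event Q [set w | exists j, n%:R * (A * l) < `|\sum_(i < n) e (Z i w) * tnth (Z i w).1 j|]
    (2 * tau + 2 * (expR 1 / n%:R)).
Proof.
apply: (@centered_event e (fun j z => e z * tnth z.1 j)) => //.
- by move=> j; exact: measurable_funM.
- apply: (env_score_moment Hset CM0 r'4 Hint Hsm r4 B1 Hloc).
  by rewrite mulr_ge0 ?(le_trans ler01 G1)// ltW.
- move=> j z; rewrite normrM mulrC.
  have h1 : `|tnth z.1 j| <= B * S z.
    exact: le_trans (coord_le_norm_inf _ _) (normX_le_scale B1 _).
  apply: (@le_trans _ _ (B * S z * (1 + `|e z|))).
    by rewrite ler_pM// lerDr.
  rewrite -[G * B * _]mulrA -[leLHS]mulrA ler_peMl// ?mulr_ge0 ?addr_ge0 ?(ltW B0)//.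
- move=> j; have := first_order_condition Hset Hpar Hdiff CM0 r'4 Hint Cm0 Hsm (delta_mx 0 j).
  by under eq_Rintegral do rewrite dotp_delta.
- move=> j; apply: mean_leW (score_coord_sqr Hset CM0 r'4 Hint Hsm r4 j).
  by rewrite /env_const; have := C31; have := Cm0; nra.
Qed.

Let hess_mean j : R := \int[P]_z (g z * v z * tnth z.1 j).

Let hess_mean_le j : `|hess_mean j| <= Cm * joint_bound.
Proof. exact: (hess_coord_mean Hset CM0 r'4 Hint Cm0 Hsm r4). Qed.

Lemma hess_event : small_event Q [set w | exists j, n%:R * (A * l) <
    `|\sum_(i < n) (g (Z i w) * v (Z i w) * tnth (Z i w).1 j - hess_mean j)|]
    (2 * tau + 2 * (expR 1 / n%:R)).
Proof.
have mgv j : measurable_fun setT (fun z : T => g z * v z * tnth z.1 j).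
  by apply: measurable_funM => //; exact: measurable_funM.
apply: (@centered_event v (fun j z => g z * v z * tnth z.1 j - hess_mean j)) => //.
- by move=> j; exact: measurable_funB.
- by apply: (env_resid_moment Hset CM0 r'4 Hint r4 B1 Hloc); rewrite mulr_ge0 ?(le_trans ler01 G1)// ltW.
- move=> j z.
  have h1 : `|tnth z.1 j| <= B * S z.
    exact: le_trans (coord_le_norm_inf _ _) (normX_le_scale B1 _).
  have BS : 1 <= B * S z by have := scaleX_ge1 B z; have := B1; nra.
  apply: le_trans (ler_normB _ _) _.
  apply: (@le_trans _ _ (Cm * `|v z| * (B * S z) + Cm * joint_bound)).
    rewrite lerD ?hess_mean_le// !normrM ler_pM ?mulr_ge0// ler_wpM2r//.
    exact: hess_le.
  rewrite (_ : G * B * (S z * (1 + `|v z|)) = G * (B * S z * (1 + `|v z|))); last by ring.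
  rewrite /env_const; move: (B * S z) BS (`|v z|) (normr_ge0 (v z)) => q q1 a a0.
  have := C31; have := Cm0; move: joint_bound => c3 hCm hc3.
  have h2 : q + a * q <= (1 + c3) * (q * (1 + a)).
    rewrite (_ : q + a * q = 1 * (q * (1 + a))); last by ring.
    by rewrite ler_wpM2r ?mulr_ge0; lra.
  have qa : 1 <= q * (1 + a) by nra.
  have h3 : c3 <= c3 * (q * (1 + a)) by rewrite ler_peMr//; lra.
  have h4 : a * q <= q * (1 + a) by nra.
  have : Cm * (a * q + c3) <= Cm * ((1 + c3) * (q * (1 + a))) by rewrite ler_wpM2l ?ltW//; lra.
  have : 0 <= (1 + c3) * (q * (1 + a)) by rewrite mulr_ge0; lra.
  lra.
- move=> j.
  have i1 := hess_coord_integrable Hset CM0 r'4 Hint Cm0 Hsm j.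
  have i2 := mean_le_integrable (mean_le_cst P (hess_mean j)).
  by rewrite (RintegralB measurableT i1 i2) mean_Rintegral_cst subrr.
- move=> j; apply: (@mean_leW _ _ _ _ _ ((2 * Cm ^+ 2) * joint_bound + 2 * (Cm * joint_bound) ^+ 2)).
    rewrite /env_const; have := C31; have := Cm0; move: joint_bound => c3 hCm hc3.
    have -> : 2 * Cm ^+ 2 * c3 + 2 * (Cm * c3) ^+ 2 = 2 * (Cm ^+ 2 * (c3 + c3 ^+ 2)) by ring.
    rewrite exprMn ler_wpM2l// ler_pM ?sqr_ge0 ?addr_ge0 ?sqr_ge0//.
      lra.
      by nra.
    by nra.
  have h := mean_leD (mean_leZ (2 * Cm ^+ 2) (resid_coord_sqr CM0 r'4 Hint r4 j))
    (mean_le_cst P (2 * (Cm * joint_bound) ^+ 2)).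
  have c2 : 0 <= 2 * Cm ^+ 2 by rewrite mulr_ge0 ?sqr_ge0.
  have c2' : 0 <= 2 * (Cm * joint_bound) ^+ 2 by rewrite mulr_ge0 ?sqr_ge0.
  rewrite (ger0_norm c2) (ger0_norm c2') in h.
  apply: le_mean_le h => [|z]; first by apply: measurable_funX; exact: measurable_funB.
  rewrite [leLHS]ger0_norm ?sqr_ge0//= [leRHS]ger0_norm; last first.
    by rewrite addr_ge0// mulr_ge0 ?sqr_ge0.
  have := hess_le m theta0 Cm0 z; rewrite -!/(hess_fun _ _ _) => gC.
  have := hess_mean_le j; move: (hess_mean j) => hm hmC.
  have hm2 : hm ^+ 2 <= (Cm * joint_bound) ^+ 2.
    by rewrite -[hm ^+ 2]real_normK ?num_real// ler_pXn2r ?nnegrE// (le_trans _ hmC).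
  have g2 : (g z * v z * tnth z.1 j) ^+ 2 <= Cm ^+ 2 * (v z * tnth z.1 j) ^+ 2.
    rewrite -mulrA exprMn ler_wpM2r ?sqr_ge0// -[g z ^+ 2]real_normK ?num_real//.
    by rewrite ler_pXn2r ?nnegrE// ltW.
  rewrite -[2 * Cm ^+ 2 * _]mulrA; move: g2 hm2.
  move: (g z * v z * tnth z.1 j) (Cm ^+ 2 * _) ((Cm * joint_bound) ^+ 2) => x y u xy hu.
  have : 0 <= (x + hm) ^+ 2 by exact: sqr_ge0.
  nra.
Qed.

(** The summands are quadratic in X and are truncated at the square of [(2 * l)^-1], which turns the
    Chernoff exponent into [2 * ln (k.+1 * n)%:R]. The tail comes out with power [2 * rho / 3] of a
    base at most 1, hence below the power [rho / 2] in [tau]. *)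
Lemma quad_event : small_event Q [set w | exists j, n%:R * (2 * joint_bound + 1) <
    \sum_(i < n) (tnth (Z i w).1 j ^+ 2 * (1 + `|v (Z i w)|))]
    (tau + expR 1 / n%:R).
Proof.
have mq j : measurable_fun [set: T] (fun z => tnth z.1 j ^+ 2 * (1 + `|v z|)).
  by apply: measurable_funM; [exact: measurable_funX|exact: m_plus].
split.
  apply: measurable_existsb => j; apply: measurable_setlt => //.
  by apply: measurable_sum => i; exact: (measurableT_comp (mq j)).
have s1 : 1 <= rho / 3 by have := rho4; lra.
have M0 : 0 < (2 * l)^-1 ^+ 2 by rewrite exprn_gt0// invr_gt0 mulr_gt0.
have menv : measurable_fun setT (fun z => B ^+ 2 * (S z ^+ 2 * (1 + `|v z|))).
  apply: measurable_funM => //; apply: measurable_funM; last exact: m_plus.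
  exact: measurable_funX.
have env0 z : 0 <= B ^+ 2 * (S z ^+ 2 * (1 + `|v z|)).
  by rewrite mulr_ge0 ?sqr_ge0// mulr_ge0 ?sqr_ge0// addr_ge0.
have envK := env_quad_moment Hset CM0 r'4 Hint r4 B1 Hloc (sqr_ge0 B).
have := @max_nonnegative _ _ _ _ _ Q P n Z iidZ _ _ _ env0 menv s1 envK _
  (fun (j : 'I_k.+1) z => tnth z.1 j ^+ 2 * (1 + `|v z|)) joint_bound _ 1 mq.
move=> /(_ _ _ _ _ M0) H; apply: le_trans (H _ _ _) _.
- by move=> j z; rewrite mulr_ge0 ?sqr_ge0// addr_ge0.
- move=> j z; rewrite mulrA ler_wpM2r ?addr_ge0//.
  have h1 : `|tnth z.1 j| <= B * S z.
    exact: le_trans (coord_le_norm_inf _ _) (normX_le_scale B1 _).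
  rewrite -exprMn -[tnth _ _ ^+ 2]real_normK ?num_real// ler_pXn2r ?nnegrE//.
  exact: le_trans h1.
- by move=> j; exact: (coord_sqr_resid CM0 r'4 Hint r4).
rewrite lee_fin card_ord; apply: lerD.
  rewrite /tau ler_wpM2l//.
  have -> : (B ^+ 2) `^ (rho / 3) * joint_bound / ((2 * l)^-1 ^+ 2) `^ (rho / 3) =
    joint_bound * (2 * B * l) `^ (2 * (rho / 3)).
    rewrite -!powR_mulrn ?invr_ge0 ?mulr_ge0 ?(ltW l0) ?(ltW B0)// -!powRrM.
    by rewrite env_pow// ltW.
  rewrite ler_wpM2l ?(le_trans ler01 C31)//.
  have Gl : 2 * B * l <= 2 * G * B * l.
    rewrite (_ : 2 * G * B * l = G * (2 * B * l)); last by ring.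
    by rewrite ler_peMl// mulr_ge0 ?(ltW l0)// mulr_ge0// ltW.
  have Bl0 : 0 <= 2 * B * l by rewrite mulr_ge0 ?(ltW l0)// mulr_ge0// ltW.
  apply: (@le_trans _ _ ((2 * G * B * l) `^ (2 * (rho / 3)))).
    by rewrite ge0_ler_powR ?nnegrE//; [have := rho4; lra|exact: le_trans Gl].
  have G0 : 0 < G by exact: lt_le_trans G1.
  have Gl0 : 0 < 2 * G * B * l.
    by apply: mulr_gt0 => //; apply: mulr_gt0 => //; exact: mulr_gt0.
  by rewrite ger_powR ?l_small// ?Gl0//; have := rho4; lra.
have -> : - (n%:R * 1 / (2 * (2 * l)^-1 ^+ 2)) = 0 / 2 - ln (k.+1 * n)%:R * 2.
  by rewrite -l_ln; field; rewrite gt_eqF.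
by apply: union_expR_le => //; lra.
Qed.

(** At this threshold the union bound over the sample equals the inverse of [A] to the power r, and
    [A >= 1]. *)
Lemma max_event : small_event Q
  [set w | exists i, A * (n%:R `^ r^-1 * B) < norm_inf (Z i w).1] (1 / A).
Proof.
have r1 : 1 <= r by have := r4; lra.
have r0 : 0 < r by have := r4; lra.
have nr0 : 0 < n%:R `^ r^-1 :> R by rewrite powR_gt0// ltr0n.
have M0 : 0 < A * (n%:R `^ r^-1 * B) by rewrite !mulr_gt0.
have NB := normX_moment Hset r4 Hloc.
split.
  apply: measurable_existsb => i; apply: measurable_setlt => //.
  exact: (measurableT_comp mN).
apply: le_trans (envelope_tail iidZ (fun z => norm_inf_ge0 _) mN r1 NB M0) _.
have nr : 0 <= n%:R `^ r^-1 * B by rewrite mulr_ge0 ?powR_ge0// ltW.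
rewrite lee_fin (powRM _ (ltW A0) nr) (powRM _ (powR_ge0 _ _) (ltW B0)) -powRrM.
rewrite mulVf ?gt_eqF// powRr1//.
have Br0 : 0 < B `^ r by exact: powR_gt0.
have Ar0 : 0 < A `^ r by exact: powR_gt0.
have nn : 0 < n%:R :> R by rewrite ltr0n.
have -> : n%:R * (B `^ r / (A `^ r * (n%:R * B `^ r))) = (A `^ r)^-1.
  by field; rewrite !gt_eqF.
rewrite div1r lef_pV2 ?posrE// -[leLHS]powRr1 ?(ltW A0)//.
by apply: ler_powR => //; have := A_C3; have := C31; lra.
Qed.

Let sum_event (f : T -> R) (b c : R) : 0 < b -> (forall z, 0 <= f z) -> mean_le P f (b * c) ->
  small_event Q [set w | n%:R * (A * b) < \sum_(i < n) f (Z i w)] (c / A).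
Proof.
move=> b0 f0 fc; have nn : 0 < n%:R :> R by rewrite ltr0n.
have a0 : 0 < n%:R * (A * b) by rewrite !mulr_gt0.
have s0 w : 0 <= \sum_(i < n) f (Z i w) by rewrite sumr_ge0.
have := small_event_tail a0 s0 (mean_le_sum iidZ fc).
have -> // : n%:R * (b * c) / (n%:R * (A * b)) = c / A.
by field; rewrite !gt_eqF.
Qed.

Lemma normX_resid_event : small_event Q [set w | n%:R * (A * B ^+ 2) <
  \sum_(i < n) (norm_inf (Z i w).1 * (1 + `|v (Z i w)|)) ^+ 2] (joint_bound / A).
Proof.
apply: (@sum_event (fun z => (norm_inf z.1 * (1 + `|v z|)) ^+ 2)).
- by rewrite exprn_gt0.
- by move=> z; exact: sqr_ge0.
- exact: (normX_resid_sqr Hset CM0 r'4 Hint r4 B1 Hloc).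
Qed.

Lemma resid_coord_event : small_event Q [set w | n%:R * (A * 1) <
  \sum_(i < n) (v (Z i w) * tnth (Z i w).1 ord0) ^+ 2] (joint_bound / A).
Proof.
apply: (@sum_event (fun z => (v z * tnth z.1 ord0) ^+ 2)) => //.
- by move=> z; exact: sqr_ge0.
- by rewrite mul1r; exact: (resid_coord_sqr CM0 r'4 Hint r4).
Qed.

Variables (KS : set T) (w0 Ck : R).
Hypothesis mKS : measurable KS.
Hypothesis w00 : 0 < w0.
Hypothesis PKS : (P KS <= (Ck * w0 ^+ 2)%:E)%E.

Lemma kink_event : small_event Q [set w | n%:R * (A * w0 ^+ 2) <
  \sum_(i < n) \1_KS (Z i w)] (Ck / A).
Proof.
apply: (@sum_event (\1_KS)) => //.
- by rewrite exprn_gt0.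
- split; first exact: measurable_indic.
  under eq_integral do rewrite ger0_norm//.
  by rewrite integral_indic// setIT mulrC.
Qed.

Variable psi : T -> R.
Hypothesis psi0 : \int[P]_z psi z = 0.
Hypothesis psi2 : mean_le P (fun z => psi z ^+ 2) 1.
Hypothesis psi2E : \int[P]_z (psi z ^+ 2) = 1.
Hypothesis mpsi : measurable_fun setT psi.

Lemma clt_event : small_event Q [set w | A ^+ 2 < clt_sum Z psi w ^+ 2] (1 / A).
Proof.
have A1 : 1 <= A by have := A_C3; have := C31; lra.
have A2 : 0 < A ^+ 2 by rewrite exprn_gt0.
have h := small_event_tail A2 (fun w => sqr_ge0 _) (clt_sum_second_moment iidZ n0 psi0 psi2 psi2E mpsi).
apply: small_eventW h; rewrite !div1r lef_pV2 ?posrE//.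
by rewrite expr2 ler_peMr// ltW.
Qed.

Variable al : R.
Hypothesis al0 : 0 <= al.
Hypothesis al_small : al * (A * (n%:R `^ r^-1 * B)) <= 1.
Hypothesis KS_expansion : forall z h, ~ KS z -> `|h| <= al * norm_inf z.1 ->
  expansion_at m theta0 Cm z h.

(** [Bad] is chosen before [theta] and [mu], so on its complement the bounds apply to data-dependent
    estimates. Of its eight parts, two centered ones cost [2 * tau] each and the quadratic one
    [tau]; the other five are Markov-type bounds of order [1 / A]. *)
Lemma good_event : exists2 Bad : set Omega,
  small_event Q Bad (5 * tau + 5 * (expR 1 / n%:R) + (2 + 2 * joint_bound + Ck) / A) &
  forall w, ~ Bad w -> forall theta mu,
    norm1 (theta - theta0) <= al -> norm1 (mu - mu0) <= al ->
    let M1 i := m1 m (dotp (Z i w).1 theta) (Z i w).2 in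
    let M2 i := m11 m (dotp (Z i w).1 theta) (Z i w).2 in
    [/\ `|debias_remainder (fun i => (Z i w).1) M1 M2 (fun i => e (Z i w))
           (fun i => v (Z i w)) (theta - theta0) (mu - mu0)| <=
          2 * al * A * l + 3 * Cm * (al ^+ 2 * A) + 4 * Cm * (al * (A * B * w0)),
        `|avg (fun i => M2 i * resid (Z i w).1 mu * regD (Z i w).1)
           - kappa P m theta0 mu0 Cm| <=
          A * l + 2 * Cm * (al * A) + 2 * Cm * (A * w0) &
        `|clt_sum Z psi w| <= A].
Proof.
have := small_eventU (small_eventU (small_eventU (small_eventU (small_eventU
  (small_eventU (small_eventU score_event hess_event) quad_event) max_event)
  normX_resid_event) resid_coord_event) kink_event) clt_event.
set Bad := (X in small_event _ X) => HB; exists Bad.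
  apply: small_eventW HB; rewrite le_eqVlt; apply/orP; left; apply/eqP.
  by move: tau (expR 1 / n%:R) => a b; field; rewrite gt_eqF.
move=> w nBad theta mu dal eal M1 M2.
have [N1 N2 N3 N4 [N5 N6 N7 N8]] : [/\
  forall j, `|\sum_(i < n) e (Z i w) * tnth (Z i w).1 j| <= n%:R * (A * l),
  forall j, `|\sum_(i < n) (g (Z i w) * v (Z i w) * tnth (Z i w).1 j - hess_mean j)|
    <= n%:R * (A * l),
  forall j, \sum_(i < n) (tnth (Z i w).1 j ^+ 2 * (1 + `|v (Z i w)|))
    <= n%:R * (2 * joint_bound + 1),
  forall i, norm_inf (Z i w).1 <= A * (n%:R `^ r^-1 * B) &
  [/\ \sum_(i < n) (norm_inf (Z i w).1 * (1 + `|v (Z i w)|)) ^+ 2 <= n%:R * (A * B ^+ 2),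
  \sum_(i < n) (v (Z i w) * tnth (Z i w).1 ord0) ^+ 2 <= n%:R * (A * 1),
  \sum_(i < n) \1_KS (Z i w) <= n%:R * (A * w0 ^+ 2) &
  clt_sum Z psi w ^+ 2 <= A ^+ 2]].
  split; [| | | |split] => [j|j|j|i| | | |]; rewrite leNgt; apply/negP => H; apply: nBad.
  - by do 7 left; exists j.
  - by do 6 left; right; exists j.
  - by do 5 left; right; exists j.
  - by do 4 left; right; exists i.
  - by do 3 left; right.
  - by do 2 left; right.
  - by left; right.
  - by right.
have dotE i : dotp (Z i w).1 theta = dotp (Z i w).1 theta0 + dotp (Z i w).1 (theta - theta0).
  by rewrite dotpB; ring.
have residuE i : resid (Z i w).1 mu = v (Z i w) - dotp (Z i w).1 (pad0 (mu - mu0)).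
  rewrite /resid_fun !residE !dotp_pad0.
  under [X in _ - _ - X]eq_bigr do rewrite !mxE mulrBr.
  by rewrite sumrB; ring.
have small i : al * norm_inf (Z i w).1 <= 1.
  by apply: le_trans al_small; rewrite ler_wpM2l.
have dotal i : `|dotp (Z i w).1 (theta - theta0)| <= al * norm_inf (Z i w).1.
  by apply: le_trans (dotp_norm1 _ _) _; rewrite ler_wpM2r ?norm_inf_ge0.
have kink01 i : \1_KS (Z i w) = 0 :> R \/ \1_KS (Z i w) = 1 :> R.
  by rewrite indicE; case: (_ \in _); [right|left].
have M1_exp i : `|M1 i - e (Z i w) - dotp (Z i w).1 (theta - theta0) * M2 i| <=
    Cm * dotp (Z i w).1 (theta - theta0) ^+ 2
    + 2 * Cm * (`|dotp (Z i w).1 (theta - theta0)| * \1_KS (Z i w)).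
  rewrite /M1 /M2 dotE indicE; case: (boolP (Z i w \in KS)) => [_|/negP].
    have [b _ _] := loss_crude_expansion Cm0 Hsm (Z i w) (dotp (Z i w).1 (theta - theta0)).
    rewrite mulr1; apply: le_trans b _; rewrite lerDr mulr_ge0 ?sqr_ge0//.
    exact: ltW.
  rewrite inE => nK; have [b _] := KS_expansion nK (dotal i).
  by rewrite !mulr0 addr0.
have M2_exp i : `|M2 i - g (Z i w)| <=
    Cm * `|dotp (Z i w).1 (theta - theta0)| + 2 * Cm * \1_KS (Z i w).
  rewrite /M2 dotE indicE; case: (boolP (Z i w \in KS)) => [_|/negP].
    have [_ b _] := loss_crude_expansion Cm0 Hsm (Z i w) (dotp (Z i w).1 (theta - theta0)).
    rewrite mulr1; apply: le_trans b _; rewrite lerDr mulr_ge0//.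
    exact: ltW.
  rewrite inE => nK; have [_ b] := KS_expansion nK (dotal i).
  by rewrite !mulr0 addr0.
have M2_le i : `|M2 i| <= Cm.
  by rewrite /M2 dotE; have [] := loss_crude_expansion Cm0 Hsm (Z i w) (dotp (Z i w).1 (theta - theta0)).
have hess_j j : `|avg (fun i => g (Z i w) * v (Z i w) * tnth (Z i w).1 j) - hess_mean j|
    <= A * l.
  have := norm_avg_le_sum n0 (N2 j).
  have -> // : avg (fun i => g (Z i w) * v (Z i w) * tnth (Z i w).1 j - hess_mean j) =
    avg (fun i => g (Z i w) * v (Z i w) * tnth (Z i w).1 j) - hess_mean j.
  rewrite -[X in _ = _ - X](avg_cst (hess_mean j) n0) -[X in _ = _ + X]mulN1r -avgZ -avgD.
  by apply: eq_avg => i; rewrite mulN1r.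
have score j : `|avg (fun i => e (Z i w) * tnth (Z i w).1 j)| <= A * l.
  exact: norm_avg_le_sum.
have ortho (j : 'I_k) :
    `|avg (fun i => g (Z i w) * v (Z i w) * tnth (Z i w).1 (lift ord0 j))| <= A * l.
  have := hess_j (lift ord0 j); rewrite /hess_mean.
  by rewrite (hess_orthogonal Hmu0 Cm0 Hsm) subr0.
have hessian : `|avg (fun i => g (Z i w) * v (Z i w) * regD (Z i w).1)
    - kappa P m theta0 mu0 Cm| <= A * l by exact: hess_j.
have quad j : avg (fun i => tnth (Z i w).1 j ^+ 2 * (1 + `|v (Z i w)|)) <= A.
  apply: le_trans A_C3; exact: avg_le_sum.
have quadB := avg_le_sum n0 N5; have quadD := avg_le_sum n0 N6.
have kink := avg_le_sum n0 N7; rewrite mulr1 in quadD.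
have l0' := ltW l0.
split.
- exact: (@debias_remainder_le _ _ _ _ _ _ _ (fun i => g (Z i w)) _
    (fun i => \1_KS (Z i w))).
- under eq_avg do rewrite residuE.
  exact: (@debias_denominator_le _ _ _ _ _ (fun i => g (Z i w)) (fun i => v (Z i w))
    (fun i => \1_KS (Z i w)) (theta - theta0) (mu - mu0) Cm A al l w0 _).
- by rewrite -(ler_pXn2r (ltn0Sn 1)) ?nnegrE// ?(ltW A0)// real_normK ?num_real.
Qed.

End good_event.

(** The error splits into [(den - kap) / den] times the leading term and [kap / den] times the
    scaled remainder. From [2 * cM <= kap] and [dd <= cM] follow [cM <= den] and [kap <= 2 * den],
    which explains the factors [cM^-1] and 2. *)
Lemma debias_algebra {R : rcfType}
  (den kap cM dd S A sn num ev Rem delta0 RB sd sI beta beta0 : R) :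
  0 < cM -> 2 * cM <= kap -> `|den - kap| <= dd -> dd <= cM -> `|S| <= A ->
  S = - (sn * ev / sd) -> 0 < sI -> sI <= sd -> 0 <= sn -> `|Rem| <= RB ->
  num = ev + Rem + den * delta0 ->
  (den != 0 -> beta = beta0 + delta0 - num / den) ->
  `|sn * (beta - beta0) / (sd / kap) - S| <= A * dd / cM + 2 * sn * RB / sI.
Proof.
move=> cM0 ckap dkap ddc SA SE sI0 sIsd sn0 RemB numE betaE.
have den_ge : cM <= den by move: dkap; rewrite ler_norml => /andP[]; lra.
have den0 : 0 < den by exact: lt_le_trans den_ge.
have kap0 : 0 < kap by lra.
have sd0 : 0 < sd by exact: lt_le_trans sIsd.
have dd0 : 0 <= dd by exact: le_trans dkap.
have kden : kap / den <= 2.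
  by rewrite ler_pdivrMr//; move: dkap; rewrite ler_norml => /andP[]; lra.
rewrite betaE ?gt_eqF// numE SE.
have -> : sn * (beta0 + delta0 - (ev + Rem + den * delta0) / den - beta0) / (sd / kap)
    - - (sn * ev / sd) = ((den - kap) / den) * (sn * ev / sd) - (kap / den) * (sn * Rem / sd).
  by field; rewrite !gt_eqF.
apply: le_trans (ler_normB _ _) _; apply: lerD.
  rewrite normrM mulrC -[leRHS]mulrA ler_pM//.
    by rewrite -normrN -SE.
  rewrite normrM normfV (gtr0_norm den0) ler_pM ?invr_ge0 ?(ltW den0)//.
  by rewrite lef_pV2 ?posrE.
have kd0 : 0 <= kap / den by rewrite divr_ge0// ltW.
rewrite normrM (ger0_norm kd0) -[2 * sn * RB / sI]mulrA -[2 * sn * _]mulrA ler_pM//.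
rewrite normrM normfV (gtr0_norm sd0) normrM (ger0_norm sn0) -mulrA ler_wpM2l//.
by rewrite ler_pM ?invr_ge0 ?(ltW sd0)// lef_pV2 ?posrE.
Qed.

(** * Studentization and the influence function *)

Section studentized.
Context {R : realType} {k : nat} {d : measure_display} {Y : measurableType d}.
Local Notation X := (k.+1.-tuple R).
Local Notation T := (X * Y)%type.
Variables (P : probability T R) (m : R -> Y -> R).
Variables (calX : set X) (Theta : set 'rV[R]_k.+1).
Variables (theta0 : 'rV[R]_k.+1) (mu0 : 'rV[R]_k).
Variables (cM : R) (cM' : \bar R) (CM r' Cm : R) (J : nat) (t : Y -> nat -> \bar R).
Variables (r cI : R).
Hypothesis Hset : setting P m calX Theta theta0.
Hypothesis Hmu0 : is_mu0 P m theta0 mu0.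
Hypothesis Hpar : parameter_space Theta theta0.
Hypothesis Hdiff : differentiability_integrability P m Theta.
Hypotheses (cM0 : 0 < cM) (cM'0 : (0 < cM')%E).
Hypothesis Hmar : margin P m Theta theta0 cM cM'.
Hypotheses (CM0 : 0 < CM) (r'4 : 4 < r').
Hypothesis Hint : integrability P m theta0 mu0 CM r'.
Hypothesis Cm0 : 0 < Cm.
Hypothesis Hsm : higher_order_smoothness P m theta0 Cm J t.
Hypothesis r4 : 4 < r.
Hypothesis cI0 : 0 < cI.
Hypothesis Hid : identifiability P m theta0 mu0 cI.

Local Notation e := (score_fun m theta0).
Local Notation v := (resid_fun mu0 : T -> R).

Definition score_sd : R := Num.sqrt (\int[P]_z ((e z * v z) ^+ 2)).
Definition influence (z : T) : R := - (e z * v z / score_sd).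

Let i2 := mean_le_integrable (score_resid_sqr Hset CM0 r'4 Hint Hsm r4).

Let mev : measurable_fun setT (fun z => e z * v z).
Proof. by apply: measurable_funM; [exact: measurable_score Hset Hsm|exact: measurable_resid]. Qed.

Let sqr_ge : cI <= \int[P]_z ((e z * v z) ^+ 2).
Proof.
have := Hid; rewrite /identifiability unlock.
under eq_integral do rewrite real_normK ?num_real//.
by rewrite -lee_fin /Rintegral fineK//; exact: integrable_fin_num.
Qed.

Lemma score_sd_ge : Num.sqrt cI <= score_sd.
Proof. exact: ler_wsqrtr. Qed.

Lemma score_sd_gt0 : 0 < score_sd.
Proof. by apply: lt_le_trans score_sd_ge; rewrite sqrtr_gt0. Qed.

Let score_sd_sqr : score_sd ^+ 2 = \int[P]_z ((e z * v z) ^+ 2).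
Proof. by rewrite sqr_sqrtr// (le_trans _ sqr_ge)// ltW. Qed.

(** The square root of the squared denominator is the denominator itself because the curvature bound
    makes [kappa] positive. *)
Lemma sqrt_sigma0_sq : Num.sqrt (sigma0_sq P m theta0 mu0) = score_sd / kappa P m theta0 mu0 Cm.
Proof.
have kap := kappa_ge Hset Hmu0 Hpar Hdiff cM0 cM'0 Hmar CM0 r'4 Hint Cm0 Hsm.
have kap0 : 0 < kappa P m theta0 mu0 Cm by apply: lt_le_trans kap; rewrite mulr_gt0.
rewrite /sigma0_sq -(kappaE mu0 Cm0 Hsm) sqrtrM; last first.
  by rewrite unlock; apply: fine_ge0; apply: integral_ge0 => z _; rewrite lee_fin sqr_ge0.
rewrite sqrtrV ?sqr_ge0// sqrtr_sqr gtr0_norm//; congr (_ / _).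
by rewrite unlock.
Qed.

Lemma measurable_influence : measurable_fun setT influence.
Proof. by apply: measurable_funN; exact: measurable_funM. Qed.

Lemma influence_mean : \int[P]_z influence z = 0.
Proof.
have ev : mean_le P (fun z => e z * v z) (1 + joint_bound CM r' r).
  have := mean_leD (mean_le_cst P 1) (score_resid_sqr Hset CM0 r'4 Hint Hsm r4).
  rewrite normr1; apply: le_mean_le => // z; rewrite [leRHS]ger0_norm ?addr_ge0 ?sqr_ge0//=.
  rewrite -[_ ^+ 2]real_normK ?num_real//; move: `|_| (normr_ge0 (e z * v z)) => x x0.
  have : 0 <= (x - 1) ^+ 2 by exact: sqr_ge0.
  nra.
rewrite (_ : \int[P]_z influence z = \int[P]_z (- score_sd^-1 * (e z * v z))).
  rewrite RintegralZl//; last exact: mean_le_integrable ev.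
  by rewrite (score_resid_mean Hset Hpar Hdiff CM0 r'4 Hint Cm0 Hsm) mulr0.
by apply: eq_Rintegral => z _; rewrite /influence mulNr [_^-1 * _]mulrC.
Qed.

Let influence_sqrE z : influence z ^+ 2 = (score_sd ^+ 2)^-1 * (e z * v z) ^+ 2.
Proof. by rewrite /influence sqrrN exprMn exprVn mulrC. Qed.

Lemma influence_sqr : \int[P]_z (influence z ^+ 2) = 1.
Proof.
under eq_Rintegral do rewrite influence_sqrE.
rewrite RintegralZl// -score_sd_sqr mulVf//.
by rewrite sqrf_eq0 gt_eqF// score_sd_gt0.
Qed.

Lemma influence_sqr_le : mean_le P (fun z => influence z ^+ 2) 1.
Proof.
have ii : P.-integrable setT (EFin \o (fun z => influence z ^+ 2)).
  have := mean_le_integrable (mean_leZ (score_sd ^+ 2)^-1 (Rintegral_mean_le i2)).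
  by under eq_fun do rewrite -influence_sqrE.
have := Rintegral_mean_le ii; congr mean_le.
by rewrite -[RHS]influence_sqr; apply: eq_Rintegral => z _; rewrite ger0_norm ?sqr_ge0.
Qed.

Lemma influence_moment del : 0 <= del -> (2 + del) + (2 + del) <= rho r' r ->
  mean_le P (fun z => `|influence z| `^ (2 + del)) ((Num.sqrt cI)^-1 `^ (2 + del) * joint_bound CM r' r).
Proof.
move=> d0 dr; have h := score_resid_moment Hset CM0 r'4 Hint Hsm r4 d0 dr.
have := mean_leZ ((Num.sqrt cI)^-1 `^ (2 + del)) h; rewrite (ger0_norm (powR_ge0 _ _)).
apply: le_mean_le => [|z].
  apply: measurable_powRr; apply: measurableT_comp => //; exact: measurable_influence.
rewrite ger0_norm ?powR_ge0// [leRHS]ger0_norm ?mulr_ge0 ?powR_ge0//.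
have sI0 : 0 < Num.sqrt cI by rewrite sqrtr_gt0.
have d2 : 0 <= 2 + del by rewrite addr_ge0.
have iI : 0 <= (Num.sqrt cI)^-1 by rewrite invr_ge0 ltW.
rewrite -(powRM _ iI (normr_ge0 _)); apply: ge0_ler_powR => //.
  by rewrite nnegrE mulr_ge0.
rewrite /influence normrN normrM normfV (gtr0_norm score_sd_gt0) mulrC ler_wpM2r//.
by rewrite lef_pV2 ?posrE ?score_sd_gt0// score_sd_ge.
Qed.

Lemma studentized_error {dO : measure_display} {Omega : measurableType dO}
  (Q : probability Omega R) (n : nat) (Z : 'I_n -> {RV Q >-> T}) (w : Omega)
  (theta : 'rV[R]_k.+1) (mu : 'rV[R]_k) (beta A dd RB : R) :
  (0 < n)%N ->
  let M1 i := m1 m (dotp (Z i w).1 theta) (Z i w).2 in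
  let M2 i := m11 m (dotp (Z i w).1 theta) (Z i w).2 in
  step3 (fun i => Z i w) m theta mu beta ->
  `|debias_remainder (fun i => (Z i w).1) M1 M2 (fun i => e (Z i w))
      (fun i => v (Z i w)) (theta - theta0) (mu - mu0)| <= RB ->
  `|avg (fun i => M2 i * resid (Z i w).1 mu * regD (Z i w).1)
     - kappa P m theta0 mu0 Cm| <= dd ->
  dd <= cM -> `|clt_sum Z influence w| <= A ->
  `|Num.sqrt n%:R * (beta - theta0 0 ord0) / Num.sqrt (sigma0_sq P m theta0 mu0)
     - clt_sum Z influence w| <= A * dd / cM + 2 * Num.sqrt n%:R * RB / Num.sqrt cI.
Proof.
move=> n0 M1 M2 Hstep HR Hden ddc HS; rewrite sqrt_sigma0_sq.
have kap := kappa_ge Hset Hmu0 Hpar Hdiff cM0 cM'0 Hmar CM0 r'4 Hint Cm0 Hsm.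
have sI0 : 0 < Num.sqrt cI by rewrite sqrtr_gt0.
have residuE i : resid (Z i w).1 mu = v (Z i w) - dotp (Z i w).1 (pad0 (mu - mu0)).
  rewrite /resid_fun !residE !dotp_pad0.
  under [X in _ - _ - X]eq_bigr do rewrite !mxE mulrBr.
  by rewrite sumrB; ring.
apply: (@debias_algebra _ (avg (fun i => M2 i * resid (Z i w).1 mu * regD (Z i w).1))
  (kappa P m theta0 mu0 Cm) cM dd (clt_sum Z influence w) A (Num.sqrt n%:R)
  (avg (fun i => M1 i * resid (Z i w).1 mu)) (avg (fun i => e (Z i w) * v (Z i w))) _
  (theta 0 ord0 - theta0 0 ord0) RB score_sd (Num.sqrt cI) beta _ cM0 kap Hden ddc HS _ sI0
  score_sd_ge (sqrtr_ge0 _) HR).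
- rewrite /clt_sum /influence sumrN -mulr_suml /avg.
  have nn : 0 < n%:R :> R by rewrite ltr0n.
  have sn : 0 < Num.sqrt n%:R :> R by rewrite sqrtr_gt0.
  have -> : n%:R^-1 = (Num.sqrt n%:R)^-1 * (Num.sqrt n%:R)^-1 :> R.
    by rewrite -invfM -expr2 sqr_sqrtr// ltW.
  by field; rewrite !gt_eqF// score_sd_gt0.
- rewrite /debias_remainder !mxE.
  under [avg (fun i => M1 i * _)]eq_avg do rewrite residuE.
  under [avg (fun i => M2 i * resid _ _ * _)]eq_avg do rewrite residuE.
  by rewrite /regD; ring.
- by move=> den0; rewrite (Hstep den0) [in RHS]addrCA subrr addr0.
Qed.

End studentized.

Lemma le_prob_up_to {R : realType} {d : measure_display} {T : measurableType d}
  (Q : probability T R) (E F Bad : set T) (q : R) :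
  measurable E -> measurable F -> small_event Q Bad q ->
  (forall w, ~ Bad w -> E w -> F w) -> fine (Q E) <= fine (Q F) + q.
Proof.
move=> mE mF [mB Bq] EF.
have h : (Q E <= Q F + q%:E)%E.
  apply: (@le_trans _ _ (Q (F `|` Bad))).
    apply: le_measure; rewrite ?inE//; first exact: measurableU.
    move=> w Ew; have [Bw|nB] := pselect (Bad w); first by right.
    by left; exact: EF.
  by apply: le_trans (measureU2 _ _ _) _ => //; exact: leeD.
rewrite -lee_fin EFinD fineK ?fin_num_measure//.
by rewrite fineK ?fin_num_measure.
Qed.

Section studentized_cdf.
Context {R : realType} {k : nat} {d : measure_display} {Y : measurableType d}.
Local Notation X := (k.+1.-tuple R).
Local Notation T := (X * Y)%type.
Variables (P : probability T R) (m : R -> Y -> R).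
Variables (calX : set X) (Theta : set 'rV[R]_k.+1).
Variables (theta0 : 'rV[R]_k.+1) (mu0 : 'rV[R]_k).
Variables (cM : R) (cM' : \bar R) (CM r' Cm : R) (J : nat) (t : Y -> nat -> \bar R).
Variables (cL : \bar R) (CL r B cI : R) (L : T -> R).
Hypothesis Hset : setting P m calX Theta theta0.
Hypothesis Hmu0 : is_mu0 P m theta0 mu0.
Hypothesis Hpar : parameter_space Theta theta0.
Hypothesis Hdiff : differentiability_integrability P m Theta.
Hypotheses (cM0 : 0 < cM) (cM'0 : (0 < cM')%E).
Hypothesis Hmar : margin P m Theta theta0 cM cM'.
Hypotheses (CM0 : 0 < CM) (r'4 : 4 < r').
Hypothesis Hint : integrability P m theta0 mu0 CM r'.
Hypothesis Cm0 : 0 < Cm.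
Hypothesis Hsm : higher_order_smoothness P m theta0 Cm J t.
Hypotheses (r4 : 4 < r) (B1 : 1 <= B).
Hypothesis Hloc : local_loss P m calX Theta theta0 cL CL r B L.
Hypothesis cI0 : 0 < cI.
Hypothesis Hid : identifiability P m theta0 mu0 cI.
Context {dO : measure_display} {Omega : measurableType dO}.
Variables (Q : probability Omega R) (n : nat) (Z : 'I_n -> {RV Q >-> T}).
Hypothesis iidZ : iid_from P Z.
Hypothesis n0 : (0 < n)%N.
Variables (thetat : Omega -> 'rV[R]_k.+1) (mut : Omega -> 'rV[R]_k) (betah : Omega -> R).
Hypothesis mthetat : forall j, measurable_fun setT (fun w => thetat w 0 j).
Hypothesis mmut : forall j, measurable_fun setT (fun w => mut w 0 j).
Hypothesis mbetah : measurable_fun setT betah.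
Hypothesis Hstep : forall w, step3 (fun i => Z i w) m (thetat w) (mut w) (betah w).

Variable l : R.
Hypothesis l0 : 0 < l.
Hypothesis l_ln : n%:R * l ^+ 2 = ln (k.+1 * n)%:R.

Local Notation joint_bound := (joint_bound CM r' r).
Local Notation G := (env_const CM r' Cm r).
Local Notation tau := (tail_mass CM r' Cm r B n l).

Variables (A a K : R).
Hypothesis A_G : 4 * G ^+ 2 + 1 <= A.
Hypothesis A_C3 : 2 * joint_bound + 1 <= A.
Hypothesis tau2 : tau <= 2.
Hypothesis l_small : 2 * G * B * l <= 1.
Hypotheses (a0 : 0 < a) (K0 : 0 < K).
Hypothesis al_small : K * a * (A * (n%:R `^ r^-1 * B)) <= 1.

Variables (KS : set T) (w0 Ck : R).
Hypothesis mKS : measurable KS.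
Hypothesis w00 : 0 < w0.
Hypothesis PKS : (P KS <= (Ck * w0 ^+ 2)%:E)%E.
Hypothesis KS_expansion : forall z h, ~ KS z -> `|h| <= K * a * norm_inf z.1 ->
  expansion_at m theta0 Cm z h.

Variables (K1 q1 : R).
Hypothesis K1K : K1 <= K.
Hypothesis Hrate :
  (Q [set w | (K1 < `|(norm1 (thetat w - theta0) + norm1 (mut w - mu0)) / a|)%R] <= q1%:E)%E.

Let dd := A * l + 2 * Cm * (K * a * A) + 2 * Cm * (A * w0).
Let RB := 2 * (K * a) * A * l + 3 * Cm * ((K * a) ^+ 2 * A)
  + 4 * Cm * (K * a * (A * B * w0)).

Variable eta : R.
Hypothesis dd_small : dd <= cM.
Hypothesis err_small : A * dd / cM + 2 * Num.sqrt n%:R * RB / Num.sqrt cI <= eta.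

Let stat w := Num.sqrt n%:R * (betah w - theta0 0 ord0) / Num.sqrt (sigma0_sq P m theta0 mu0).
Let S := clt_sum Z (influence P m theta0 mu0).

Let mpsi := measurable_influence mu0 Hset Hsm.

Let mstat : measurable_fun setT stat.
Proof.
apply: measurable_funM => //; apply: measurable_funM => //.
exact: measurable_funB.
Qed.

Let mS : measurable_fun setT S. Proof. exact: measurable_clt_sum. Qed.

Definition deviation_mass : R :=
  5 * tau + 5 * (expR 1 / n%:R) + (2 + 2 * joint_bound + Ck) / A + q1.

(** Besides [Bad], the event excluded here is that the l1-errors exceed [K * a]; its probability
    [q1] comes from the convergence rates. *)
Let deviation : exists2 Bad, small_event Q Bad deviation_mass &
  forall w, ~ Bad w -> `|stat w - S w| <= eta.
Proof.
have Ka0 : 0 <= K * a by rewrite mulr_ge0 ?ltW.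
have [Bad HB H] := good_event Hset Hmu0 Hpar Hdiff CM0 r'4 Hint Cm0 Hsm r4 B1 Hloc iidZ n0
  l0 l_ln A_G A_C3 tau2 l_small mKS w00 PKS
  (influence_mean Hset Hpar Hdiff CM0 r'4 Hint Cm0 Hsm r4)
  (influence_sqr_le Hset CM0 r'4 Hint Hsm r4 cI0 Hid)
  (influence_sqr Hset CM0 r'4 Hint Hsm r4 cI0 Hid) mpsi Ka0 al_small KS_expansion.
pose rate w := (norm1 (thetat w - theta0) + norm1 (mut w - mu0)) / a.
have mrate : measurable_fun setT rate.
  apply: measurable_funM => //; apply: measurable_funD; apply: measurable_sum => j.
    apply: measurableT_comp => //; under eq_fun do rewrite !mxE.
    exact: measurable_funB.
  apply: measurableT_comp => //; under eq_fun do rewrite !mxE.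
  exact: measurable_funB.
have HR : small_event Q [set w | K1 < `|rate w|] q1.
  by split=> //; apply: measurable_setlt => //; exact: measurableT_comp.
exists (Bad `|` [set w | K1 < `|rate w|]).
  exact: small_eventU HB HR.
move=> w nB.
have rK : norm1 (thetat w - theta0) + norm1 (mut w - mu0) <= K * a.
  rewrite -ler_pdivrMr//; apply: le_trans K1K; apply: le_trans (ler_norm _) _.
  by rewrite leNgt; apply/negP => Kr; apply: nB; right.
have nBad : ~ Bad w by move=> Bw; apply: nB; left.
have h1 := norm1_ge0 (thetat w - theta0); have h2 := norm1_ge0 (mut w - mu0).
have d1 : norm1 (thetat w - theta0) <= K * a by lra.
have d2 : norm1 (mut w - mu0) <= K * a by lra.
have [b1 b2 b3] := H w nBad _ _ d1 d2.
apply: le_trans err_small.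
exact: (studentized_error Hset Hmu0 Hpar Hdiff cM0 cM'0 Hmar CM0 r'4 Hint Cm0 Hsm r4 cI0 Hid
  n0 (@Hstep w) b1 b2 dd_small b3).
Qed.

Lemma studentized_cdf_upper x y : x + eta <= y ->
  fine (Q [set w | (stat w <= x)%R]) <= fine (Q [set w | (S w <= y)%R]) + deviation_mass.
Proof.
move=> xy; have [Bad HB H] := deviation.
apply: (le_prob_up_to _ _ HB); [exact: measurable_setle|exact: measurable_setle|].
by move=> w /H /=; rewrite ler_norml => /andP[]; lra.
Qed.

Lemma studentized_cdf_lower x y : x + eta <= y ->
  fine (Q [set w | (S w <= x)%R]) <= fine (Q [set w | (stat w <= y)%R]) + deviation_mass.
Proof.
move=> xy; have [Bad HB H] := deviation.
apply: (le_prob_up_to _ _ HB); [exact: measurable_setle|exact: measurable_setle|].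
by move=> w /H /=; rewrite ler_norml => /andP[]; lra.
Qed.

End studentized_cdf.

(** * Rates *)

Lemma cvg0_squeeze {R : realType} (u v : nat -> R) (N : nat) :
  (forall n, (N <= n)%N -> 0 <= u n <= v n) -> v n @[n --> \oo] --> 0 ->
  u n @[n --> \oo] --> 0.
Proof.
move=> uv v0; apply: (@squeeze_cvgr _ _ _ _ (cst 0) v) => //.
  by near=> n; apply: uv; near: n; exact: nbhs_infty_ge.
exact: cvg_cst.
Unshelve. all: by end_near. Qed.

(** The order of the largest of p centered averages, normalized so that n times its square is the
    logarithm in the union bound. *)
Definition noise_level {R : realType} (p n : nat) : R := Num.sqrt (ln (p * n)%:R / n%:R).

Section noise_level.
Context {R : realType}.

Lemma noise_level_sqr (p n : nat) : (0 < p)%N -> (0 < n)%N ->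
  n%:R * noise_level p n ^+ 2 = ln (p * n)%:R :> R.
Proof.
move=> p0 n0; rewrite sqr_sqrtr; last first.
  by rewrite divr_ge0// ln_ge0// ler1n muln_gt0 p0.
by rewrite mulrC divfK// pnatr_eq0 -lt0n.
Qed.

Lemma noise_level_gt0 (p n : nat) : (0 < p)%N -> (1 < n)%N -> 0 < noise_level p n :> R.
Proof.
move=> p0 n1; have n0 : (0 < n)%N by exact: ltn_trans n1.
rewrite sqrtr_gt0 divr_gt0 ?ltr0n// ln_gt0// ltr1n.
by apply: leq_trans n1 _; exact: leq_pmull.
Qed.

Lemma sqrt_noise_level (p n : nat) : (0 < n)%N ->
  Num.sqrt n%:R * noise_level p n = Num.sqrt (ln (p * n)%:R) :> R.
Proof.
move=> n0; rewrite -sqrtrM// mulrC divfK// pnatr_eq0 -lt0n//.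
Qed.

Variables (p : nat -> nat) (B a : nat -> R) (r rho : R).
Hypothesis p0 : forall n, (3 <= n)%N -> (0 < p n)%N.
Hypothesis B1 : forall n, (3 <= n)%N -> 1 <= B n.
Hypothesis a0 : forall n, (3 <= n)%N -> 0 < a n.
Hypothesis rho4 : 4 < rho.
Hypothesis Bln : (fun n => B n ^+ 2 * ln (p n * n)%:R : R^o) =o_\oo
  (fun n => n%:R `^ (1 - 4 / rho) : R^o).

Local Notation l n := (noise_level (p n) n).

Lemma noise_level_le eps : 0 < eps -> \forall n \near \oo,
  (B n * l n) ^+ 2 <= eps * n%:R `^ (- (4 / rho)).
Proof.
move=> e0; move/eqoP : Bln => /(_ _ e0) H; near=> n.
have n3 : (3 <= n)%N by near: n; exact: nbhs_infty_ge.
have n0 : (0 < n)%N by exact: leq_trans n3.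
have nn : 0 < n%:R :> R by rewrite ltr0n.
have : `|B n ^+ 2 * ln (p n * n)%:R| <= eps * `|n%:R `^ (1 - 4 / rho)| by near: n.
rewrite (ger0_norm (powR_ge0 _ _)) => /(le_trans (ler_norm _)).
have -> : n%:R `^ (1 - 4 / rho) = n%:R * n%:R `^ (- (4 / rho)) :> R.
  by rewrite powRD ?powRr1 ?(ltW nn)// (gt_eqF nn) implybT.
rewrite -(noise_level_sqr (p0 n3) n0).
have -> : B n ^+ 2 * (n%:R * l n ^+ 2) = n%:R * (B n * l n) ^+ 2 by ring.
by rewrite [eps * (_ * _)]mulrCA ler_pM2l.
Unshelve. all: by end_near. Qed.

Lemma noise_level_small eps : 0 < eps -> \forall n \near \oo, B n * l n <= eps.
Proof.
move=> e0; have e2 : 0 < eps ^+ 2 by rewrite exprn_gt0.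
have H := noise_level_le e2; near=> n.
have n3 : (3 <= n)%N by near: n; exact: nbhs_infty_ge.
have n1 : 1 <= n%:R :> R by rewrite ler1n (leq_trans _ n3).
have Bl : 0 <= B n * l n by rewrite mulr_ge0 ?sqrtr_ge0 ?(le_trans ler01 (B1 n3)).
rewrite -(ler_pXn2r (ltn0Sn 1)) ?nnegrE ?(ltW e0)//.
have h : (B n * l n) ^+ 2 <= eps ^+ 2 * n%:R `^ (- (4 / rho)) by near: n.
apply: (le_trans h); rewrite ler_piMr ?(ltW e2)//.
rewrite -[leRHS](powRr0 n%:R); apply: ler_powR => //.
by rewrite oppr_le0 divr_ge0//; have := rho4; lra.
Unshelve. all: by end_near. Qed.

Lemma noise_level_cvg : l n @[n --> \oo] --> (0 : R).
Proof.
apply/cvgr0Pnorm_le => eps e0; have H := noise_level_small e0; near=> n.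
have n3 : (3 <= n)%N by near: n; exact: nbhs_infty_ge.
rewrite ger0_norm ?sqrtr_ge0//.
have h : B n * l n <= eps by near: n.
by apply: le_trans h; rewrite ler_peMl ?sqrtr_ge0// B1.
Unshelve. all: by end_near. Qed.

(** The assumed rate bounds [(B n * l n) ^+ 2] by a small multiple of n to the power [- (4 / rho)].
    Raised to the power [rho / 4] this cancels the factor n exactly; [e'] is chosen so that the
    resulting constant is [eps / D]. *)
Lemma noise_tail_small C c eps : 0 < C -> 0 < c -> 0 < eps -> \forall n \near \oo,
  n%:R * (C * (c * B n * l n) `^ (rho / 2)) <= eps.
Proof.
move=> C0 c0 e0; pose D := C * c `^ (rho / 2).
have D0 : 0 < D by rewrite mulr_gt0 ?powR_gt0.
have rho0 : 0 < rho by have := rho4; lra.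
pose e' := (eps / D) `^ (4 / rho).
have e'0 : 0 < e' by apply: powR_gt0; exact: divr_gt0.
have H := noise_level_le e'0; near=> n.
have n3 : (3 <= n)%N by near: n; exact: nbhs_infty_ge.
have nn : 0 < n%:R :> R by rewrite ltr0n (leq_trans _ n3).
have Bl : 0 <= B n * l n by rewrite mulr_ge0 ?sqrtr_ge0 ?(le_trans ler01 (B1 n3)).
have h : (B n * l n) ^+ 2 <= e' * n%:R `^ (- (4 / rho)) by near: n.
rewrite -mulrA (powRM _ (ltW c0) Bl).
have -> : n%:R * (C * (c `^ (rho / 2) * (B n * l n) `^ (rho / 2))) =
  D * (n%:R * (B n * l n) `^ (rho / 2)) by rewrite /D; ring.
rewrite mulrC -ler_pdivlMr//.
have -> : rho / 2 = 2%:R * (rho / 4) by field.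
rewrite powRrM powR_mulrn//.
have r4 : 0 <= rho / 4 by rewrite divr_ge0// ltW.
have h' := ge0_ler_powR r4 _ _ h.
apply: (@le_trans _ _ (n%:R * (e' * n%:R `^ (- (4 / rho))) `^ (rho / 4))).
  by rewrite ler_wpM2l ?(ltW nn)// h' ?nnegrE ?sqr_ge0// mulr_ge0 ?powR_ge0.
rewrite (powRM _ (ltW e'0) (powR_ge0 _ _)) /e' -!powRrM.
have -> : 4 / rho * (rho / 4) = 1 by field; rewrite gt_eqF.
have -> : - (4 / rho) * (rho / 4) = -1 by field; rewrite gt_eqF.
rewrite powRr1 ?divr_ge0 ?(ltW e0) ?(ltW D0)// powR_inv1 ?(ltW nn)//.
by rewrite mulrCA divff ?gt_eqF// mulr1.
Unshelve. all: by end_near. Qed.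

Hypothesis arate : a n * (n%:R `^ r^-1 * B n + Num.sqrt (ln (p n * n)%:R))
  @[n --> \oo] --> 0.

Lemma rate_envelope_cvg : a n * (n%:R `^ r^-1 * B n) @[n --> \oo] --> 0.
Proof.
apply: cvg0_squeeze arate => n n3.
have a_ := ltW (a0 n3); have B_ := le_trans ler01 (B1 n3).
by rewrite !mulr_ge0 ?powR_ge0//= ler_wpM2l// lerDl sqrtr_ge0.
Qed.

Lemma rate_noise_cvg : Num.sqrt n%:R * (a n * l n) @[n --> \oo] --> 0.
Proof.
apply: cvg0_squeeze arate => n n3.
have a_ := ltW (a0 n3); have B_ := le_trans ler01 (B1 n3).
rewrite mulrCA sqrt_noise_level ?(leq_trans _ n3)// mulr_ge0 ?sqrtr_ge0//=.
by rewrite ler_wpM2l// lerDr mulr_ge0 ?powR_ge0.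
Qed.

Variable w : nat -> R.
Hypothesis w0 : forall n, (3 <= n)%N -> 0 < w n.
Hypothesis wrate : (1 + Num.sqrt n%:R * B n * a n) * w n @[n --> \oo] --> 0.

Lemma kink_rate_cvg : w n @[n --> \oo] --> 0.
Proof.
apply: cvg0_squeeze wrate => n n3; rewrite (ltW (w0 n3))/= ler_peMl ?(ltW (w0 n3))//.
have a_ := ltW (a0 n3); have B_ := le_trans ler01 (B1 n3).
by rewrite lerDl !mulr_ge0.
Qed.

Lemma scaled_kink_rate_cvg : Num.sqrt n%:R * (a n * B n * w n) @[n --> \oo] --> 0.
Proof.
apply: cvg0_squeeze wrate => n n3.
have a_ := ltW (a0 n3); have B_ := le_trans ler01 (B1 n3); have w_ := ltW (w0 n3).
rewrite !mulr_ge0//= (_ : _ * (_ * _) = Num.sqrt n%:R * B n * a n * w n); last by ring.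
by rewrite ler_wpM2r// lerDr.
Qed.

Hypothesis acvg : a n @[n --> \oo] --> 0.
Hypothesis asqr : Num.sqrt n%:R * a n ^+ 2 @[n --> \oo] --> 0.

(** Multiplied out, the error is a fixed linear combination of six null sequences: [l], [a], [w],
    and sqrt n times each of [a * l], [a ^+ 2] and [a * B * w]. The last three come from the
    numerator. *)
Lemma linearization_error_cvg (A Cm cM K cI : R) :
  A * (A * l n + 2 * Cm * (K * a n * A) + 2 * Cm * (A * w n)) / cM
    + 2 * Num.sqrt n%:R * (2 * (K * a n) * A * l n + 3 * Cm * ((K * a n) ^+ 2 * A)
       + 4 * Cm * (K * a n * (A * B n * w n))) / cI @[n --> \oo] --> 0.
Proof.
pose lin (c1 c2 c3 c4 c5 c6 : R) n := c1 * l n + c2 * a n + c3 * w n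
  + c4 * (Num.sqrt n%:R * (a n * l n)) + c5 * (Num.sqrt n%:R * a n ^+ 2)
  + c6 * (Num.sqrt n%:R * (a n * B n * w n)).
have lin0 c1 c2 c3 c4 c5 c6 : lin c1 c2 c3 c4 c5 c6 n @[n --> \oo] --> 0.
  have scale_to0 (c : R) (u : nat -> R) : u n @[n --> \oo] --> 0 -> c * u n @[n --> \oo] --> 0.
    by move=> u0; rewrite -(mulr0 c); exact: cvgMr.
  have add_to0 (u1 u2 : nat -> R) : u1 n @[n --> \oo] --> 0 -> u2 n @[n --> \oo] --> 0 ->
      u1 n + u2 n @[n --> \oo] --> 0.
    by move=> h1 h2; rewrite -[0]addr0; exact: cvgD.
  apply: (add_to0 _ _); last exact: scale_to0 scaled_kink_rate_cvg.
  apply: (add_to0 _ _); last exact: scale_to0 asqr.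
  apply: (add_to0 _ _); last exact: scale_to0 rate_noise_cvg.
  apply: (add_to0 _ _); last exact: scale_to0 kink_rate_cvg.
  by apply: (add_to0 _ _); [exact: scale_to0 noise_level_cvg|exact: scale_to0 acvg].
have := lin0 (A * A / cM) (A * 2 * Cm * K * A / cM) (A * 2 * Cm * A / cM)
  (4 * K * A / cI) (6 * Cm * K ^+ 2 * A / cI) (8 * Cm * K * A / cI).
apply: cvg_trans; apply: near_eq_cvg; near=> n.
by rewrite /lin; ring.
Unshelve. all: by end_near. Qed.

End noise_level.

Lemma clt_rate_small {R : realType} (C kap del eps : R) : 0 < C -> 0 <= kap ->
  0 < del -> 0 < eps -> \forall n \near \oo,
  C * (2 * kap * (Num.sqrt n%:R)^-1 `^ del + (Num.sqrt n%:R)^-1) <= eps.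
Proof.
move=> C0 kap0 del0 e0; pose D := C * (2 * kap + 1).
have D0 : 0 < D by rewrite mulr_gt0// ltr_wpDl// mulr_ge0.
pose b := eps / D; have b0 : 0 < b by rewrite divr_gt0.
pose b' := Num.min b (b `^ del^-1).
have b'0 : 0 < b' by rewrite lt_min b0 powR_gt0.
have bi0 : 0 <= b'^-1 by rewrite invr_ge0 ltW.
near=> n.
have hn : b'^-1 ^+ 2 <= n%:R by near: n; exact: nbhs_infty_ger.
have ub : (Num.sqrt n%:R)^-1 <= b'.
  rewrite -[b']invrK lef_pV2 ?posrE ?invr_gt0//.
    by rewrite -[leLHS]ger0_norm// -sqrtr_sqr ler_wsqrtr.
  by rewrite sqrtr_gt0 (lt_le_trans _ hn)// exprn_gt0// invr_gt0.
have u0 : 0 <= (Num.sqrt n%:R)^-1 :> R by rewrite invr_ge0 sqrtr_ge0.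
move: ((Num.sqrt n%:R)^-1) u0 ub => u u0; rewrite le_min => /andP[ub1 ub2].
have ud : u `^ del <= b.
  have E : b = (b `^ del^-1) `^ del by rewrite -powRrM mulVf ?gt_eqF// powRr1 ?ltW.
  by rewrite [leRHS]E ge0_ler_powR ?nnegrE ?powR_ge0// ltW.
apply: (@le_trans _ _ (C * (2 * kap * b + b))).
  by rewrite ler_wpM2l ?(ltW C0)// lerD// ler_wpM2l// mulr_ge0.
have -> : C * (2 * kap * b + b) = D * b by rewrite /D; ring.
by rewrite /b mulrCA divff ?gt_eqF// mulr1.
Unshelve. all: by end_near. Qed.

(* Without kinks any positive sequence is allowed here, as long as it is
   negligible at the required rate. *)
Definition kink_rate {R : realType} (J n : nat) (B a Delta r : R) : R :=
  if (2 <= J)%N then Delta `^ 2^-1 + (B * a / Delta) `^ (r / 2)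
  else ((1 + Num.sqrt n%:R * B * a) * n.+1%:R)^-1.

Lemma kink_rate_gt0 {R : realType} (J n : nat) (B a Delta r : R) : 0 < B -> 0 < a ->
  ((2 <= J)%N -> 0 < Delta) -> 0 < kink_rate J n B a Delta r.
Proof.
move=> B0 a0 D0; rewrite /kink_rate; case: ifP => [/D0 Dp|_].
  by rewrite ltr_pwDl ?powR_gt0 ?powR_ge0.
rewrite invr_gt0 mulr_gt0 ?ltr0n// ltr_pwDl// mulr_ge0 ?(ltW a0)//.
by rewrite mulr_ge0 ?sqrtr_ge0// ltW.
Qed.

Section kink_set_rate.
Context {R : realType} {k : nat} {d : measure_display} {Y : measurableType d}.
Local Notation X := (k.+1.-tuple R).
Local Notation T := (X * Y)%type.
Variables (P : probability T R) (m : R -> Y -> R).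
Variables (theta0 : 'rV[R]_k.+1) (Cm : R) (J : nat) (t : Y -> nat -> \bar R).
Hypothesis Cm0 : 0 < Cm.
Hypothesis Hsm : higher_order_smoothness P m theta0 Cm J t.

(** [kink_rate] is a root of the probability because the Cauchy-Schwarz step consumes a root:
    [Delta] and the r-th power of [B * a / Delta] are squares of its two summands, each at most the
    square of the sum. *)
Lemma kink_set_rate (n : nat) (Cf Delta K a B r : R) : 0 < K -> 0 < a -> 0 < B -> 0 < r ->
  ((2 <= J)%N -> [/\ 0 < Cf, 0 < Delta & density P theta0 Cf Delta J t]) ->
  mean_le P (fun z => norm_inf z.1 `^ r) (B `^ r) ->
  exists KS : set T, [/\ measurable KS,
    (P KS <= ((J%:R * `|Cf| + K `^ r) * kink_rate J n B a Delta r ^+ 2)%:E)%E &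
    forall z h, ~ KS z -> `|h| <= K * a * norm_inf z.1 -> expansion_at m theta0 Cm z h].
Proof.
move=> K0 a0 B0 r0 HJ NB; have [J2|J2] := leqP 2 J; last first.
  exists set0; split => // [|z h _ _]; last exact: expansion_no_knot Hsm _ _ _.
  rewrite measure0 lee_fin; apply: mulr_ge0; last exact: sqr_ge0.
  by apply: addr_ge0; [exact: mulr_ge0|exact: powR_ge0].
have [Cf0 D0 Hden] := HJ J2.
have Ka0 : 0 <= K * a by rewrite mulr_ge0 ?ltW.
have [KS [mKS PKS HKS]] := kink_set Cm0 Hsm Cf0 D0 Ka0 B0 r0 Hden NB.
exists KS; split => //; apply: le_trans PKS _; rewrite lee_fin /kink_rate J2.
pose y := B * a / Delta; have y0 : 0 <= y by rewrite divr_ge0 ?(ltW D0)// mulr_ge0 ?ltW.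
have -> : B * (K * a) / Delta = K * y by rewrite /y; ring.
rewrite (powRM _ (ltW K0) y0) (gtr0_norm Cf0) -/y.
have D2 : (Delta `^ 2^-1) ^+ 2 = Delta.
  by rewrite -powR_mulrn ?powR_ge0// -powRrM mulVf// powRr1// ltW.
have yr : (y `^ (r / 2)) ^+ 2 = y `^ r.
  by rewrite -powR_mulrn ?powR_ge0// -powRrM divfK.
have u0 := powR_ge0 Delta 2^-1; have v0 := powR_ge0 y (r / 2).
have c0 : 0 <= J%:R * Cf by rewrite mulr_ge0// ltW.
have Kr := powR_ge0 K r.
rewrite -{1}D2 -yr mulrA; move: (Delta `^ _) (y `^ _) (J%:R * Cf) (K `^ r) u0 v0 c0 Kr
  => u v c c' u0 v0 c0 c'0.
have h1 : u ^+ 2 <= (u + v) ^+ 2 by rewrite ler_pXn2r ?nnegrE ?addr_ge0// lerDl.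
have h2 : v ^+ 2 <= (u + v) ^+ 2 by rewrite ler_pXn2r ?nnegrE ?addr_ge0// lerDr.
by rewrite mulrDl lerD// ler_wpM2l.
Qed.

End kink_set_rate.

Lemma sandwich_le {R : realFieldType} (F F1 F2 G G1 G2 d eps : R) :
  `|F1 - G1| <= d + eps -> `|F2 - G2| <= d + eps -> F <= F1 + 3 * eps ->
  F2 <= F + 3 * eps -> G1 <= G + d -> G <= G2 + d -> d <= eps -> `|G - F| <= 6 * eps.
Proof. rewrite !ler_norml => /andP[? ?] /andP[? ?] ? ? ? ? ?; apply/andP; split; lra. Qed.

Theorem theorem5p1 (R : realType)
  (k : nat -> nat) (dY : nat -> measure_display)
  (Y : forall n, measurableType (dY n))
  (P : forall n, probability ((k n).+1.-tuple R * Y n)%type R)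
  (calX : forall n, set ((k n).+1.-tuple R))
  (m : forall n, R -> Y n -> R)
  (Theta : forall n, set 'rV[R]_(k n).+1)
  (theta0 : forall n, 'rV[R]_(k n).+1) (mu0 : forall n, 'rV[R]_(k n))
  (dO : nat -> measure_display) (Omega : forall n, measurableType (dO n))
  (Q : forall n, probability (Omega n) R)
  (Z : forall n, 'I_n -> {RV (Q n) >-> ((k n).+1.-tuple R * Y n)%type})
  (lam1 lam2 : forall n, Omega n -> R)
  (thetat : forall n, Omega n -> 'rV[R]_(k n).+1)
  (mut : forall n, Omega n -> 'rV[R]_(k n))
  (betah : forall n, {RV (Q n) >-> R})
  (cM : R) (cM' : \bar R)
  (cL : \bar R) (CL r : R) (B : nat -> R)
  (L : forall n, (k n).+1.-tuple R * Y n -> R)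
  (q : R) (s : nat -> R) (cI CM r' Cm : R)
  (J : nat) (t : forall n, Y n -> nat -> \bar R)
  (Cf : R) (Delta a : nat -> R) :
  (forall n, (3 <= n)%N -> (1 <= k n)%N) ->
  (forall n, (3 <= n)%N ->
    setting (P n) (m n) (calX n) (Theta n) (theta0 n)) ->
  (forall n, (3 <= n)%N -> is_mu0 (P n) (m n) (theta0 n) (mu0 n)) ->
  (forall n, (3 <= n)%N -> iid_from (P n) (Z n)) ->
  (forall n, (3 <= n)%N -> forall w, 0 < lam1 n w /\ 0 < lam2 n w) ->
  (forall n, (3 <= n)%N ->
    (forall j, measurable_fun setT (fun w => thetat n w 0 j)) /\
    (forall j, measurable_fun setT (fun w => mut n w 0 j))) ->
  (forall n, (3 <= n)%N -> forall w, let S := fun i => Z n i w in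
    [/\ step1 S (m n) (Theta n) (lam1 n w) (thetat n w),
        step2 S (m n) (thetat n w) (lam2 n w) (mut n w) &
        step3 S (m n) (thetat n w) (mut n w) (betah n w)]) ->
  (forall n, (3 <= n)%N -> parameter_space (Theta n) (theta0 n)) ->
  (forall n, (3 <= n)%N -> convexity (m n)) ->
  (forall n, (3 <= n)%N ->
    differentiability_integrability (P n) (m n) (Theta n)) ->
  0 < cM <= 1 -> (0 < cM')%E ->
  (forall n, (3 <= n)%N ->
    margin (P n) (m n) (Theta n) (theta0 n) cM cM') ->
  (0 < cL)%E -> 1 <= CL -> 4 < r -> (forall n, (3 <= n)%N -> 1 <= B n) ->
  (forall n, (3 <= n)%N ->
    local_loss (P n) (m n) (calX n) (Theta n) (theta0 n) cL CL r (B n) (L n)) ->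
  0 <= q <= 1 -> (forall n, (3 <= n)%N -> 1 <= s n) ->
  (forall n, (3 <= n)%N -> sparsity q (theta0 n) <= s n) ->
  0 < cI ->
  (forall n, (3 <= n)%N ->
    identifiability (P n) (m n) (theta0 n) (mu0 n) cI) ->
  0 < CM -> 4 < r' ->
  (forall n, (3 <= n)%N ->
    integrability (P n) (m n) (theta0 n) (mu0 n) CM r') ->
  0 < Cm ->
  (forall n, (3 <= n)%N ->
    higher_order_smoothness (P n) (m n) (theta0 n) Cm J (t n)) ->
  ((2 <= J)%N -> 0 < Cf /\ forall n, (3 <= n)%N ->
    0 < Delta n /\ density (P n) (theta0 n) Cf (Delta n) J (t n)) ->
  (forall n, (3 <= n)%N -> 0 < a n) -> a n @[n --> \oo] --> 0 ->
  bounded_in_prob Q (fun n w =>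
    (norm1 (thetat n w - theta0 n) + norm1 (mut n w - mu0 n)) / a n) ->
  Num.sqrt n%:R * a n ^+ 2 @[n --> \oo] --> 0 ->
  a n * (n%:R `^ r^-1 * B n + Num.sqrt (ln ((k n).+1 * n)%:R))
    @[n --> \oo] --> 0 ->
  (fun n => B n ^+ 2 * ln ((k n).+1 * n)%:R : R^o) =o_\oo
    (fun n => n%:R `^ (1 - 4 / Num.min r r') : R^o) ->
  ((2 <= J)%N ->
    (1 + Num.sqrt n%:R * B n * a n) *
      (Delta n `^ 2^-1 + (B n * a n / Delta n) `^ (r / 2))
    @[n --> \oo] --> 0) ->
  cvg_in_distribution Q
    (fun n w => Num.sqrt n%:R * (betah n w - theta0 n 0 ord0) /
       Num.sqrt (sigma0_sq (P n) (m n) (theta0 n) (mu0 n)))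
    (normal_prob 0 1).
Proof.
move=> k1 Hset Hmu0 Hiid _ Hmeas Hstep Hpar _ Hdiff /andP[cM0 _] cM'0 Hmar _ _ r4 B1 Hloc
  _ _ _ cI0 Hid CM0 r'4 Hint Cm0 Hsm Hden a0 acvg Hrate asqr arate Bln Jrate x _.
pose w n := kink_rate J n (B n) (a n) (Delta n) r.
have rho4 : 4 < rho r' r by rewrite lt_min r4 r'4.
have r0 : 0 < r by exact: lt_trans r4.
have B0 n : (3 <= n)%N -> 0 < B n by move=> n3; apply: lt_le_trans (B1 n n3).
have w0 n : (3 <= n)%N -> 0 < w n.
  move=> n3; apply: kink_rate_gt0; rewrite ?B0 ?a0// => J2.
  by have [_ /(_ n n3)[]] := Hden J2.
have wrate : (1 + Num.sqrt n%:R * B n * a n) * w n @[n --> \oo] --> 0.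
  have [J2|J2] := leqP 2 J.
    have := Jrate J2; apply: cvg_trans; apply: near_eq_cvg; apply: nearW => n.
    by rewrite /w /kink_rate J2.
  (* For [J < 2] the definition of [kink_rate] makes this product exactly the inverse of n + 1. *)
  apply: (@cvg0_squeeze _ _ (@harmonic R) 3); last exact: cvg_harmonic.
  move=> n n3; have p0 : 0 < 1 + Num.sqrt n%:R * B n * a n.
    by rewrite ltr_pwDl// !mulr_ge0 ?sqrtr_ge0 ?(ltW (B0 n n3)) ?(ltW (a0 n n3)).
  rewrite /w /kink_rate leqNgt J2/= invfM mulrA divff ?gt_eqF// mul1r.
  by rewrite invr_ge0 ler0n lexx.
have p0 n : (3 <= n)%N -> (0 < (k n).+1)%N by [].
pose C := joint_bound CM r' r; pose G := env_const CM r' Cm r.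
have C1 : 1 <= C by exact: joint_bound_ge1.
have C0 : 0 < C by exact: lt_le_trans C1.
have G0 : 0 < G by apply: mulr_gt0; exact: addr_gt0.
(* The product of score and residual is controlled up to moments of order [rho / 2], which exceeds 2
   as [rho > 4]. [del] is the excess, capped at 1 as Stein's bound requires. *)
pose del := Num.min 1 (rho r' r / 2 - 2).
have del0 : 0 < del by rewrite lt_min ltr01/=; move: rho4; lra.
have del1 : del <= 1 by rewrite ge_min lexx.
have del2 : 2 + del + (2 + del) <= rho r' r.
  have : del <= rho r' r / 2 - 2 by rewrite ge_min lexx orbT.
  lra.
pose kap := (Num.sqrt cI)^-1 `^ (2 + del) * C.
have kap0 : 0 <= kap by rewrite mulr_ge0 ?powR_ge0// (le_trans ler01 C1).
have mstat n : measurable_fun setT (fun o => Num.sqrt n%:R * (betah n o - theta0 n 0 ord0) /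
    Num.sqrt (sigma0_sq (P n) (m n) (theta0 n) (mu0 n))).
  apply: measurable_funM => //; apply: measurable_funM => //.
  exact: measurable_funB.
rewrite -EFin_std_cdf; apply/fine_cvgP; split.
  by apply: nearW => n; apply: fin_num_measure; exact: measurable_setle.
(* Six shares of [eps]: three for the bad event, one for the Stein bound, one for relaxing the
   indicator and one for shifting the normal distribution function by [eta]. *)
apply/cvgrPdist_le => eps0 e0; pose eps := eps0 / 6.
have eps_gt0 : 0 < eps by rewrite divr_gt0.
have [K1 HK1] := Hrate eps eps_gt0.
pose K := Num.max 1 K1.
have K0 : 0 < K by rewrite lt_max ltr01.
have K1K : K1 <= K by rewrite le_max lexx orbT.
pose Ck := J%:R * `|Cf| + K `^ r.
(* The first two entries are the thresholds required by the tail bounds, the third makes the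
   Markov-type bounds add up to at most [eps]. It contains [Ck] and so must be chosen after [K]. *)
pose A := Num.max (4 * G ^+ 2 + 1) (Num.max (2 * C + 1) ((2 + 2 * C + Ck) / eps)).
have A_G : 4 * G ^+ 2 + 1 <= A by rewrite le_max lexx.
have A_C : 2 * C + 1 <= A by rewrite !le_max lexx orbT.
have A0 : 0 < A by apply: lt_le_trans A_C; move: C1; lra.
have A_eps : (2 + 2 * C + Ck) / A <= eps.
  by rewrite ler_pdivrMr// [eps * A]mulrC -ler_pdivrMr// !le_max lexx !orbT.
have peak0 : 0 <= normal_peak 1 :> R by exact: normal_peak_ge0.
(* [eta] is both the tolerance for the linearization error and the width of the ramps; the normal
   mass of an interval of this length is at most [eps]. *)
pose eta := eps / (1 + normal_peak 1).
have eta0 : 0 < eta by rewrite divr_gt0// ltr_pwDl.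
have peak_eta : normal_peak 1 * eta <= eps.
  rewrite /eta mulrCA ler_piMr ?(ltW eps_gt0)// ler_pdivrMr ?ltr_pwDl//.
  by rewrite mul1r lerDr.
have [D1 D10 clt1] := clt_cdf (x + eta) eta0.
have [D2 D20 clt2] := clt_cdf (x - eta) eta0.
have n1 := clt_rate_small D10 kap0 del0 eps_gt0.
have n2 := clt_rate_small D20 kap0 del0 eps_gt0.
have G20 : 0 < 2 * G by rewrite mulr_gt0.
(* The bound 2 is the premise on [tau] in the union bound; as the tail mass is counted five times,
   [eps / 10] lets it contribute at most [eps / 2]. *)
have tau0 : 0 < Num.min 2 (eps / 10) by rewrite lt_min ltr0n divr_gt0.
have n3 := noise_tail_small p0 B1 rho4 Bln C0 G20 tau0.
have G2i : 0 < (2 * G)^-1 by rewrite invr_gt0.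
have n4 := noise_level_small p0 B1 rho4 Bln G2i.
have KA0 : 0 < (K * A)^-1 by rewrite invr_gt0 mulr_gt0.
have /cvgr0Pnorm_le/(_ _ KA0) n5 := rate_envelope_cvg B1 a0 arate.
(* The bound by [A] serves a second purpose: from [A * dd n / cM <= A] it yields [dd n <= cM], which
   keeps the denominator away from zero. *)
have err0 : 0 < Num.min eta A by rewrite lt_min eta0.
have /cvgr0Pnorm_le/(_ _ err0) n6 := linearization_error_cvg p0 B1 a0 rho4 Bln arate w0 wrate
  acvg asqr A Cm cM K (Num.sqrt cI).
pose l n : R := noise_level (k n).+1 n.
pose dd n := A * l n + 2 * Cm * (K * a n * A) + 2 * Cm * (A * w n).
pose RB n := 2 * (K * a n) * A * l n + 3 * Cm * ((K * a n) ^+ 2 * A)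
  + 4 * Cm * (K * a n * (A * B n * w n)).
near=> n.
have n_ge3 : (3 <= n)%N by near: n; exact: nbhs_infty_ge.
have n_gt0 : (0 < n)%N by exact: leq_trans n_ge3.
have nn : 0 < n%:R :> R by rewrite ltr0n.
have ln0 : 0 < l n by rewrite noise_level_gt0// (leq_trans _ n_ge3).
have l_ln : n%:R * l n ^+ 2 = ln ((k n).+1 * n)%:R by exact: noise_level_sqr.
have an := a0 n n_ge3; have Bn := B0 n n_ge3; have wn := w0 n n_ge3.
have tau_le : tail_mass CM r' Cm r (B n) n (l n) <= Num.min 2 (eps / 10) by near: n.
have [tau2 tau_eps] : tail_mass CM r' Cm r (B n) n (l n) <= 2 /\
    tail_mass CM r' Cm r (B n) n (l n) <= eps / 10.
  by move: tau_le; rewrite le_min => /andP[].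
have Gl : 2 * G * B n * l n <= 1.
  have : B n * l n <= (2 * G)^-1 by near: n.
  by rewrite -[_^-1]mul1r ler_pdivlMr// mulrC mulrA.
have al_small : K * a n * (A * (n%:R `^ r^-1 * B n)) <= 1.
  have : `|a n * (n%:R `^ r^-1 * B n)| <= (K * A)^-1 by near: n.
  move=> /(le_trans (ler_norm _)); rewrite -[(K * A)^-1]mul1r ler_pdivlMr ?mulr_gt0//.
  by apply: le_trans; rewrite le_eqVlt; apply/orP; left; apply/eqP; ring.
have err : `|A * dd n / cM + 2 * Num.sqrt n%:R * RB n / Num.sqrt cI| <= Num.min eta A by near: n.
have {err} [err_eta err_A] : A * dd n / cM + 2 * Num.sqrt n%:R * RB n / Num.sqrt cI <= eta /\
    A * dd n / cM + 2 * Num.sqrt n%:R * RB n / Num.sqrt cI <= A.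
  by move: err => /(le_trans (ler_norm _)); rewrite le_min => /andP[].
have RB0 : 0 <= RB n.
  have Ka := mulr_ge0 (ltW K0) (ltW an); have A_ := ltW A0; have Cm_ := ltW Cm0.
  have Bw := mulr_ge0 (mulr_ge0 A_ (ltW Bn)) (ltW wn).
  apply: addr_ge0; first apply: addr_ge0.
  - by apply: mulr_ge0 (ltW ln0); apply: mulr_ge0 A_; exact: mulr_ge0.
  - by apply: mulr_ge0; [exact: mulr_ge0|apply: mulr_ge0 A_; exact: sqr_ge0].
  - by apply: mulr_ge0; [exact: mulr_ge0|exact: mulr_ge0].
have dd_small : dd n <= cM.
  have : A * dd n / cM <= A.
    by apply: le_trans err_A; rewrite lerDl !mulr_ge0// ?invr_ge0 ?sqrtr_ge0.
  by rewrite ler_pdivrMr// ler_pM2l.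
have [KS [mKS PKS HKS]] : exists KS : set _, [/\ measurable KS,
    (P n KS <= (Ck * w n ^+ 2)%:E)%E &
    forall z h, ~ KS z -> `|h| <= K * a n * norm_inf z.1 ->
      expansion_at (m n) (theta0 n) Cm z h].
  apply: (kink_set_rate Cm0 (Hsm n n_ge3)) => //.
    by move=> J2; have [Cf0 /(_ n n_ge3)[]] := Hden J2.
  exact: (normX_moment (Hset n n_ge3) r4 (Hloc n n_ge3)).
have HQ : (Q n [set o | (K1 < `|(norm1 (thetat n o - theta0 n)
    + norm1 (mut n o - mu0 n)) / a n|)%R] <= eps%:E)%E by near: n.
have [mth mmu] := Hmeas n n_ge3.
have mbeta : measurable_fun setT (betah n) by [].
have step3n o : step3 (fun i => Z n i o) (m n) (thetat n o) (mut n o) (betah n o).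
  by have [] := Hstep n n_ge3 o.
have up := @studentized_cdf_upper _ _ _ _ _ _ _ _ _ _ _ _ _ _ _ _ _ _ _ _ _ _ _
  (Hset n n_ge3) (Hmu0 n n_ge3) (Hpar n n_ge3) (Hdiff n n_ge3) cM0 cM'0 (Hmar n n_ge3) CM0 r'4
  (Hint n n_ge3) Cm0 (Hsm n n_ge3) r4 (B1 n n_ge3) (Hloc n n_ge3) cI0 (Hid n n_ge3) _ _ _ _ _
  (Hiid n n_ge3) n_gt0 _ _ _ mth mmu mbeta step3n _ ln0 l_ln _ _ _ A_G A_C tau2 Gl an K0 al_small
  _ _ _ mKS wn PKS HKS _ _ K1K HQ _ dd_small err_eta x (x + eta) (lexx _).
have lo := @studentized_cdf_lower _ _ _ _ _ _ _ _ _ _ _ _ _ _ _ _ _ _ _ _ _ _ _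
  (Hset n n_ge3) (Hmu0 n n_ge3) (Hpar n n_ge3) (Hdiff n n_ge3) cM0 cM'0 (Hmar n n_ge3) CM0 r'4
  (Hint n n_ge3) Cm0 (Hsm n n_ge3) r4 (B1 n n_ge3) (Hloc n n_ge3) cI0 (Hid n n_ge3) _ _ _ _ _
  (Hiid n n_ge3) n_gt0 _ _ _ mth mmu mbeta step3n _ ln0 l_ln _ _ _ A_G A_C tau2 Gl an K0 al_small
  _ _ _ mKS wn PKS HKS _ _ K1K HQ _ dd_small err_eta (x - eta) x.
have {lo} := lo _; rewrite subrK => /(_ (lexx _)) lo.
(* Half of [eps] each from the tail masses and from the terms of order 1/n, one [eps] from the
   Markov-type bounds and one from the convergence rates. *)
have dev : deviation_mass CM r' Cm r (B n) n (l n) A Ck eps <= 3 * eps.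
  rewrite /deviation_mass.
  have e1 : 5 * (expR 1 / n%:R) <= eps / 2.
    have : 10 * expR 1 / eps <= n%:R by near: n; exact: nbhs_infty_ger.
    rewrite ler_pdivrMr// => h; rewrite mulrA ler_pdivrMr//; lra.
  move: A_eps tau_eps e1; rewrite -/C; lra.
have psi0 := influence_mean (Hset n n_ge3) (Hpar n n_ge3) (Hdiff n n_ge3) CM0 r'4
  (Hint n n_ge3) Cm0 (Hsm n n_ge3) r4.
have psi2 := influence_sqr_le (Hset n n_ge3) CM0 r'4 (Hint n n_ge3) (Hsm n n_ge3) r4 cI0
  (Hid n n_ge3).
have psi2E := influence_sqr (Hset n n_ge3) CM0 r'4 (Hint n n_ge3) (Hsm n n_ge3) r4 cI0
  (Hid n n_ge3).
have mpsi := measurable_influence (mu0 n) (Hset n n_ge3) (Hsm n n_ge3).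
have psikap := influence_moment (Hset n n_ge3) CM0 r'4 (Hint n n_ge3) (Hsm n n_ge3) r4 cI0
  (Hid n n_ge3) (ltW del0) del2.
have del01 : 0 < del <= 1 by rewrite del0.
have c1 := clt1 _ _ _ _ _ _ _ _ _ _ _ (Hiid n n_ge3) n_gt0 psi0 psi2 psi2E mpsi del01 psikap.
have c2 := clt2 _ _ _ _ _ _ _ _ _ _ _ (Hiid n n_ge3) n_gt0 psi0 psi2 psi2E mpsi del01 psikap.
have c1e : D1 * (2 * kap * (Num.sqrt n%:R)^-1 `^ del + (Num.sqrt n%:R)^-1) <= eps by near: n.
have c2e : D2 * (2 * kap * (Num.sqrt n%:R)^-1 `^ del + (Num.sqrt n%:R)^-1) <= eps by near: n.
have i1 := std_cdf_increment x (ltW eta0).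
have i2 := std_cdf_increment (x - eta) (ltW eta0); rewrite subrK in i2.
have epsE : eps0 = 6 * eps by rewrite /eps; field.
pose S o := clt_sum (Z n) (influence (P n) (m n) (theta0 n) (mu0 n)) o.
pose T o := Num.sqrt n%:R * (betah n o - theta0 n 0 ord0) /
  Num.sqrt (sigma0_sq (P n) (m n) (theta0 n) (mu0 n)).
pose F1 := fine (Q n [set o | (S o <= x + eta)%R]).
pose F2 := fine (Q n [set o | (S o <= x - eta)%R]).
pose F := fine (Q n [set o | (T o <= x)%R]).
have {}c1 : `|F1 - std_cdf (x + eta)| <= normal_peak 1 * eta + eps.
  exact: le_trans c1 (lerD (lexx _) c1e).
have {}c2 : `|F2 - std_cdf (x - eta)| <= normal_peak 1 * eta + eps.
  exact: le_trans c2 (lerD (lexx _) c2e).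
have {}up : F <= F1 + 3 * eps by exact: le_trans up (lerD (lexx _) dev).
have {}lo : F2 <= F + 3 * eps by exact: le_trans lo (lerD (lexx _) dev).
rewrite epsE; exact: sandwich_le c1 c2 up lo i1 i2 peak_eta.
Unshelve. all: by end_near. Qed.
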